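(* A left-invariant Riemannian metric on the four-dimensional Lie group $\widetilde{SL}(2,\mathbb{R})\times\mathbb{R}$ or $SU(2)\times\mathbb{R}$ is $\mathcal{F}_t$-critical for some $t\in\mathbb{R}$ if and only if it is locally isometric to a product $\mathbb{R}\times N^3(\kappa)$, where $N^3(\kappa)$ is a three-dimensional manifold of constant sectional curvature $\kappa$; this occurs if $\lambda_1=\lambda_2=\lambda_3=\lambda$ in the description of the metric by structure constants $(\lambda_1,\lambda_2,\lambda_3,k_1,k_2,k_3)$ given in the context, and then $\kappa=\lambda^2/4$.
   Context: **Critical metrics.** On a homogeneous Riemannian $4$-manifold $(M,g)$ let $R$ be the curvature tensor, $\rho$ the Ricci tensor and $\tau$ the scalar curvature. For $t\in\mathbb{R}$ let $\mathcal{F}_t(g)=\int_M\{\|\rho\|^2+t\tau^2\}\,\mathrm{dvol}_g$. A homogeneous metric is called $\mathcal{F}_t$-critical if it satisfies the Euler-Lagrange equation of $\mathcal{F}_t$ for variations of constant volume, which in the homogeneous four-dimensional case is $$-\Delta\rho+\tfrac12(\|\rho\|^2+t\tau^2)g-2R[\rho]-2t\tau\rho=0,$$ where $\Delta\rho$ is the rough Laplacian (trace of $\nabla^2\rho$), and $R[\rho]_{ij}=R_{ikj\ell}\rho^{k\ell}$, with sign convention such that $R_{ikj\ell}g^{k\ell}=\rho_{ij}$. **Left-invariant metrics.** Let $\mathfrak{g}=\mathfrak{g}_3\times\mathbb{R}$ with $\mathfrak{g}_3=\mathfrak{sl}(2,\mathbb{R})$ or $\mathfrak{su}(2)$. Every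 inner product on $\mathfrak{g}$ (equivalently, every left-invariant metric on the simply connected group) admits an orthonormal basis $\{e_1,e_2,e_3,e_4\}$ with $$[e_2,e_3]=\lambda_1e_1,\quad [e_3,e_1]=\lambda_2e_2,\quad [e_1,e_2]=\lambda_3e_3,$$ $$[e_1,e_4]=k_3\lambda_2e_2-k_2\lambda_3e_3,\quad [e_2,e_4]=k_1\lambda_3e_3-k_3\lambda_1e_1,\quad [e_3,e_4]=k_2\lambda_1e_1-k_1\lambda_2e_2,$$ for some $k_1,k_2,k_3\in\mathbb{R}$ and $\lambda_1,\lambda_2,\lambda_3\in\mathbb{R}$ with $\lambda_1\lambda_2\lambda_3\neq0$. The group is $SU(2)\times\mathbb{R}$ if $\lambda_1,\lambda_2,\lambda_3$ all have the same sign, and $\widetilde{SL}(2,\mathbb{R})\times\mathbb{R}$ otherwise. *)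

(* Defs.v *)
From mathcomp Require Import all_boot all_order all_algebra.
From mathcomp Require Import complex.
From mathcomp Require Import all_classical all_reals all_analysis.

Set Implicit Arguments.
Unset Strict Implicit.
Unset Printing Implicit Defensive.

Import Order.TTheory GRing.Theory Num.Theory.
Import numFieldNormedType.Exports.

Local Open Scope classical_set_scope.
Local Open Scope ring_scope.

Section Smooth.
Variable R : realType.

Fixpoint Ck (V W : normedModType R) (k : nat) (U : set V) (f : V -> W) : Prop :=
  match k with
  | 0 => forall x, U x -> {for x, continuous f}
  | k'.+1 => (forall x, U x -> differentiable f x) /\
             (forall v : V, Ck k' U (fun x => 'D_v f x))
  end.

Definition smooth (V W : normedModType R) (U : set V) (f : V -> W) : Prop :=
  forall k, Ck k U f.

End Smooth.

Section RiemannianMetrics.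
Variables (R : realType) (n : nat).

(* A Riemannian metric on an open subset of R^n, in the global coordinates:
   g x i j = g_x(d_i, d_j). *)
Definition metric_field := 'rV[R]_n -> 'M[R]_n.

Definition inner (g : metric_field) (x u v : 'rV[R]_n) : R :=
  (u *m g x *m v^T) 0 0.

Definition riemannian (U : set 'rV[R]_n) (g : metric_field) : Prop :=
  [/\ forall i j, smooth U (fun x => g x i j : R^o),
      forall x, U x -> (g x)^T = g x &
      forall x, U x -> forall u, u != 0 -> 0 < inner g x u u].

Definition pd (i : 'I_n) (f : 'rV[R]_n -> R) (x : 'rV[R]_n) : R :=
  'D_(delta_mx 0 i) (f : 'rV[R]_n -> R^o) x.

(* [ginv g i j x] is g^{ij}. *)
Definition ginv (g : metric_field) (i j : 'I_n) (x : 'rV[R]_n) : R :=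
  invmx (g x) i j.

(* [Gamma g i j k] is the Christoffel symbol Gamma_{ij}^k of the Levi-Civita
   connection. *)
Definition Gamma (g : metric_field) (i j k : 'I_n) (x : 'rV[R]_n) : R :=
  2^-1 * \sum_l ginv g k l x *
    (pd i (fun y => g y j l) x + pd j (fun y => g y i l) x
     - pd l (fun y => g y i j) x).

(* R(d_i, d_j) d_k = \sum_l [curv g i j k l] d_l with
   R(X, Y) = [nabla_X, nabla_Y] - nabla_[X, Y]. *)
Definition curv (g : metric_field) (i j k l : 'I_n) (x : 'rV[R]_n) : R :=
  pd i (Gamma g j k l) x - pd j (Gamma g i k l) x
  + \sum_m (Gamma g j k m x * Gamma g i m l x
            - Gamma g i k m x * Gamma g j m l x).

(* R_{ijkl} = g(R(d_i, d_j) d_l, d_k), so that R_{ikjl} g^{kl} is the Ricci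
   tensor and R_{ijij} > 0 on round spheres. *)
Definition riem (g : metric_field) (i j k l : 'I_n) (x : 'rV[R]_n) : R :=
  \sum_m curv g i j l m x * g x m k.

Definition ricci (g : metric_field) (i j : 'I_n) (x : 'rV[R]_n) : R :=
  \sum_k \sum_l riem g i k j l x * ginv g k l x.

Definition scal (g : metric_field) (x : 'rV[R]_n) : R :=
  \sum_i \sum_j ricci g i j x * ginv g i j x.

Definition ricci_up (g : metric_field) (k l : 'I_n) (x : 'rV[R]_n) : R :=
  \sum_a \sum_b ginv g k a x * ginv g l b x * ricci g a b x.

Definition ricci_norm2 (g : metric_field) (x : 'rV[R]_n) : R :=
  \sum_i \sum_j ricci g i j x * ricci_up g i j x.

(* R[rho]_{ij} = R_{ikjl} rho^{kl} *)
Definition riem_ricci (g : metric_field) (i j : 'I_n) (x : 'rV[R]_n) : R :=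
  \sum_k \sum_l riem g i k j l x * ricci_up g k l x.

Definition nabla_ricci (g : metric_field) (k i j : 'I_n) (x : 'rV[R]_n) : R :=
  pd k (ricci g i j) x
  - \sum_a (Gamma g k i a x * ricci g a j x + Gamma g k j a x * ricci g i a x).

Definition nabla2_ricci (g : metric_field) (l k i j : 'I_n) (x : 'rV[R]_n) : R :=
  pd l (nabla_ricci g k i j) x
  - \sum_a (Gamma g l k a x * nabla_ricci g a i j x
            + Gamma g l i a x * nabla_ricci g k a j x
            + Gamma g l j a x * nabla_ricci g k i a x).

Definition laplace_ricci (g : metric_field) (i j : 'I_n) (x : 'rV[R]_n) : R :=
  \sum_l \sum_k ginv g l k x * nabla2_ricci g l k i j x.

(* The Euler-Lagrange equation of F_t for volume-preserving variations, for a
   homogeneous metric in dimension four. *)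
Definition Ft_critical (t : R) (U : set 'rV[R]_n) (g : metric_field) : Prop :=
  forall x, U x -> forall i j,
    - laplace_ricci g i j x
    + 2^-1 * (ricci_norm2 g x + t * scal g x ^+ 2) * g x i j
    - 2 * riem_ricci g i j x
    - 2 * t * scal g x * ricci g i j x = 0.

Definition sectional (g : metric_field) (x u v : 'rV[R]_n) : R :=
  (\sum_i \sum_j \sum_k \sum_l
     riem g i j k l x * u 0 i * v 0 j * u 0 k * v 0 l)
  / (inner g x u u * inner g x v v - inner g x u v ^+ 2).

Definition const_sectional (kappa : R) (U : set 'rV[R]_n) (g : metric_field) :
    Prop :=
  forall x, U x -> forall u v, \rank (col_mx u v) = 2%N ->
    sectional g x u v = kappa.

End RiemannianMetrics.

Section LocalIsometry.
Variable R : realType.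

(* The domain and the metric ds^2 + h of the Riemannian product of the line
   with an open subset V of R^3 carrying the metric h; the line is the first
   coordinate. *)
Definition line_prod_dom (V : set 'rV[R]_3) : set 'rV[R]_4 :=
  [set y : 'rV[R]_(1 + 3) | V (rsubmx y)].

Definition line_prod_metric (h : metric_field R 3) : metric_field R 4 :=
  fun y : 'rV[R]_(1 + 3) =>
    block_mx (1%:M : 'M[R]_1) 0 0 (h (rsubmx y)) : 'M[R]_(1 + 3).

(* Every point of (U, g) has a neighbourhood that is isometric to an open
   subset of (U', g').  The dimensions being equal, an isometric immersion is
   a local diffeomorphism. *)
Definition locally_isometric (n : nat) (U : set 'rV[R]_n) (g : metric_field R n)
    (U' : set 'rV[R]_n) (g' : metric_field R n) : Prop :=
  forall p, U p -> exists (W : set 'rV[R]_n) (phi : 'rV[R]_n -> 'rV[R]_n),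
    [/\ [/\ open W, W p & W `<=` U],
        smooth W phi,
        set_inj W phi,
        forall x, W x -> U' (phi x) &
        forall x, W x -> forall u v,
          inner g' (phi x) ('D_u phi x) ('D_v phi x) = inner g x u v].

(* N^3(kappa) is a chart domain V with a metric h of constant curvature kappa;
   being local, the condition only sees charts of N^3(kappa). *)
Definition locally_line_times_space_form (kappa : R) (U : set 'rV[R]_4)
    (g : metric_field R 4) : Prop :=
  exists (V : set 'rV[R]_3) (h : metric_field R 3),
    [/\ open V, riemannian V h, const_sectional kappa V h &
        locally_isometric U g (line_prod_dom V) (line_prod_metric h)].

End LocalIsometry.

Section LieGroups.
Variable R : realType.

(* A Lie group structure on an open subset of R^4, i.e. a four-dimensional Lie
   group written in a global chart; both simply connected groups considered
   below admit one. *)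
Record lie_group := LieGroup {
  lg_dom : set 'rV[R]_4 ;
  lg_mul : 'rV[R]_4 -> 'rV[R]_4 -> 'rV[R]_4 ;
  lg_one : 'rV[R]_4 ;
  lg_inv : 'rV[R]_4 -> 'rV[R]_4 ;
  lg_dom_open : open lg_dom ;
  lg_dom_mul : forall x y, lg_dom x -> lg_dom y -> lg_dom (lg_mul x y) ;
  lg_dom_one : lg_dom lg_one ;
  lg_dom_inv : forall x, lg_dom x -> lg_dom (lg_inv x) ;
  lg_mulA : forall x y z, lg_dom x -> lg_dom y -> lg_dom z ->
    lg_mul x (lg_mul y z) = lg_mul (lg_mul x y) z ;
  lg_mul1 : forall x, lg_dom x -> lg_mul lg_one x = x ;
  lg_mulV : forall x, lg_dom x -> lg_mul (lg_inv x) x = lg_one ;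
  lg_mul_smooth : smooth (lg_dom `*` lg_dom)
    (fun p : 'rV[R]_4 * 'rV[R]_4 => lg_mul p.1 p.2) ;
  lg_inv_smooth : smooth lg_dom lg_inv
}.

Definition SL2R : set 'M[R[i]]_2 :=
  [set A | \det A = 1 /\ forall i j, complex.Im (A i j) = 0].

Definition SU2 : set 'M[R[i]]_2 :=
  [set A | A *m map_mx (@conjc R) A^T = 1%:M /\ \det A = 1].

(* A smooth homomorphism (p, s) from G to S x R, with S a matrix group, whose
   differential is everywhere injective.  When S x R is four-dimensional this is
   a local isomorphism of Lie groups. *)
Definition local_iso_hom (G : lie_group) (S : set 'M[R[i]]_2)
    (p : 'rV[R]_4 -> 'M[R[i]]_2) (s : 'rV[R]_4 -> R) : Prop :=
  [/\ forall x, lg_dom G x -> S (p x),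
      forall x y, lg_dom G x -> lg_dom G y ->
        p (lg_mul G x y) = p x *m p y /\ s (lg_mul G x y) = s x + s y,
      forall i j, smooth (lg_dom G) (fun x => complex.Re (p x i j) : R^o) /\
                  smooth (lg_dom G) (fun x => complex.Im (p x i j) : R^o),
      smooth (lg_dom G) (s : 'rV[R]_4 -> R^o) &
      forall x v, lg_dom G x ->
        (forall i j, 'D_v (fun x => complex.Re (p x i j) : R^o) x = 0 /\
                     'D_v (fun x => complex.Im (p x i j) : R^o) x = 0) ->
        'D_v (s : 'rV[R]_4 -> R^o) x = 0 -> v = 0].

(* The universal covering group of SL(2, R) x R.  It is diffeomorphic to R^4;
   conversely a local isomorphism from a Lie group structure on the simply
   connected manifold R^4 to a connected group is its universal covering. *)
Definition is_univ_SL2R_times_R (G : lie_group) : Prop :=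
  lg_dom G = setT /\ exists p s, local_iso_hom G SL2R p s.

(* SU(2) x R, which embeds in R^4 as the open set R^4 minus the origin (the
   multiplicative group of the quaternions). *)
Definition is_SU2_times_R (G : lie_group) : Prop :=
  exists p s, local_iso_hom G SU2 p s /\
    set_bij (lg_dom G) (SU2 `*` [set: R]) (fun x => (p x, s x)).

Definition left_invariant_metric (G : lie_group) (g : metric_field R 4) : Prop :=
  riemannian (lg_dom G) g /\
  forall a x, lg_dom G a -> lg_dom G x -> forall u v,
    inner g (lg_mul G a x) ('D_u (lg_mul G a) x) ('D_v (lg_mul G a) x)
    = inner g x u v.

Definition left_invariant_field (G : lie_group) (X : 'rV[R]_4 -> 'rV[R]_4) :
    Prop :=
  smooth (lg_dom G) X /\
  forall a x, lg_dom G a -> lg_dom G x ->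
    X (lg_mul G a x) = 'D_(X x) (lg_mul G a) x.

Definition lie_bracket (X Y : 'rV[R]_4 -> 'rV[R]_4) (x : 'rV[R]_4) : 'rV[R]_4 :=
  'D_(X x) Y x - 'D_(Y x) X x.

Definition orthonormal4 (g : metric_field R 4) (x v1 v2 v3 v4 : 'rV[R]_4) :
    Prop :=
  forall i j : 'I_4,
    inner g x (nth 0 [:: v1; v2; v3; v4] i) (nth 0 [:: v1; v2; v3; v4] j)
    = (i == j)%:R.

(* An orthonormal basis of the Lie algebra of left-invariant vector fields with
   the structure constants (l1, l2, l3, k1, k2, k3). *)
Definition described_by (G : lie_group) (g : metric_field R 4)
    (l1 l2 l3 k1 k2 k3 : R) : Prop :=
  l1 * l2 * l3 != 0 /\
  exists e1 e2 e3 e4 : 'rV[R]_4 -> 'rV[R]_4,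
    [/\ [/\ left_invariant_field G e1, left_invariant_field G e2,
            left_invariant_field G e3 & left_invariant_field G e4],
        forall x, lg_dom G x -> orthonormal4 g x (e1 x) (e2 x) (e3 x) (e4 x),
        forall x, lg_dom G x ->
          [/\ lie_bracket e2 e3 x = l1 *: e1 x,
              lie_bracket e3 e1 x = l2 *: e2 x &
              lie_bracket e1 e2 x = l3 *: e3 x] &
        forall x, lg_dom G x ->
          [/\ lie_bracket e1 e4 x = (k3 * l2) *: e2 x - (k2 * l3) *: e3 x,
              lie_bracket e2 e4 x = (k1 * l3) *: e3 x - (k3 * l1) *: e1 x &
              lie_bracket e3 e4 x = (k2 * l1) *: e1 x - (k1 * l2) *: e2 x]].

End LieGroups.

(* Main.v *)
(* Both groups map to the unit sphere of a quaternion algebra (split for SL(2, R))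
   times a line, so the Maurer-Cartan forms provide a left-invariant coframe
   w1, ..., w4 with w4 closed, in which a left-invariant metric has a constant Gram
   matrix K.  Diagonalizing simultaneously the Schur complement of K and
   D = diag(eps, 1, 1) gives an orthonormal coframe with d th_i = - l_i th_j th_k and
   d th_4 = - sum b_i th_j th_k, for which the Euler-Lagrange equation is a system of
   polynomial equations in the l_i and b_i.  Its solutions satisfy b_i b_j = 0 and
   l_i^2 + b_i^2 = r l_i, i.e. the upper 3 x 3 block of K is rho D; positivity then
   excludes SL(2, R).
   On SU(2) x R such a metric is rho |dq + q a ds|^2 + c ds^2, and q exp (s a)
   untwists it to the product of a round sphere and a line.  On such a product
   R[rho] = 2 kappa rho, |rho|^2 = 12 kappa^2 and tau = 6 kappa, with rho parallel, so
   that t = - 1/3 solves the Euler-Lagrange equation, and tau determines kappa. *)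

Require Import Defs.
From mathcomp Require Import all_boot all_order all_algebra.
From mathcomp Require Import all_classical all_reals all_analysis.
From mathcomp Require Import complex ring lra.

Set Implicit Arguments.
Unset Strict Implicit.
Unset Printing Implicit Defensive.

Import Order.TTheory GRing.Theory Num.Theory.
Import numFieldNormedType.Exports.

Local Open Scope classical_set_scope.
Local Open Scope ring_scope.

(** * Smooth functions *)

(** The Lie algebra is a three-dimensional ideal plus a central line, and two inner products
    compete: [K3], the restriction to the ideal, and the Schur complement [S], which measures the
    part orthogonal to the centre. A frame adapted to [S] makes the brackets diagonal up to central
    terms, and in it [K3] becomes 1 + be be^T with be_i = b_i / l_i. This equals rho times the
    diagonalized D exactly when be_i be_j = 0 for distinct i, j and 1 + be_i^2 = rho d_i. Since l_i
    d_i is the constant 2 det T, multiplying by l_i^2 gives the two conditions drawn from the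
    polynomial system, with r = 2 rho det T. The parameter t enters that system only through u = - 2
    t tau, which is eliminated like any other unknown.

    Connections are never computed from Christoffel symbols: a candidate is guessed from a coframe
    or a product structure, checked to be metric and torsion-free, and identified by uniqueness.
    Local isometries have to be injective; this is read off from the injectivity of (q, s) on SU(2)
    x R and from an explicit inversion on a hemisphere, so that no inverse function theorem
    enters. *)

Section SmoothCalculus.
Variables (R : realType) (V : normedModType R) (U : set V).
Hypothesis oU : open U.

Lemma open_near (x : V) : U x -> \forall y \near x, U y.
Proof. by move=> Ux; apply: open_nbhs_nbhs; split. Qed.

Lemma eq_on_derive (W : normedModType R) (f h : V -> W) x v :
  (forall y, U y -> f y = h y) -> U x -> 'D_v f x = 'D_v h x.
Proof.
move=> fh Ux; apply: near_eq_derive; near=> y; apply: fh.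
by near: y; apply: open_near.
Unshelve. all: by end_near. Qed.

(** Makes differentiability a local property: two functions that agree near a point differ by one
    that vanishes there, and the zero map is a differential for such a difference. *)
Lemma near0_differentiable (W : normedModType R) (f : V -> W) x :
  (\forall y \near x, f y = 0) -> differentiable f x.
Proof.
move=> f0; have fx0 : f x = 0 := nbhs_singleton f0.
have fo : f \o shift x = cst (f x) + (\0 : {linear V -> W}) +o_ 0 id.
  apply/eqaddoP => _/posnumP[e]; rewrite fx0.
  have := f0; rewrite (near_shift 0) /= => f0'.
  near=> y.
  have -> : (f \o shift x - (cst 0 + (\0 : V -> W))) y = f (y + x).
    by rewrite !fctE /= addr0 subr0.
  suff -> : f (y + x) = 0 by rewrite normr0 mulr_ge0.
  near: y; move: f0'; apply: filterS => y /=.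
  by rewrite subr0 => ->.
have c0 : continuous (\0 : {linear V -> W}) by apply: cst_continuous.
apply/diff_locallyP; rewrite (@diff_unique _ _ _ _ (\0 : {linear V -> W})) //.
Unshelve. all: by end_near. Qed.

Lemma eq_on_differentiable (W : normedModType R) (f h : V -> W) x :
  (forall y, U y -> f y = h y) -> U x ->
  differentiable f x -> differentiable h x.
Proof.
move=> fh Ux df.
have -> : h = f + (h - f) by apply/funext => y /=; rewrite !fctE addrC subrK.
apply: differentiableD => //; apply: near0_differentiable.
near=> y; rewrite !fctE fh ?subrr //; near: y; exact: open_near.
Unshelve. all: by end_near. Qed.

Lemma eq_on_continuous (W : normedModType R) (f h : V -> W) x :
  (forall y, U y -> f y = h y) -> U x ->
  {for x, continuous f} -> {for x, continuous h}.
Proof.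
move=> fh Ux cf; have {cf} : f @ x --> f x := cf; rewrite fh // => cf.
apply: cvg_trans cf; apply: near_eq_cvg; near=> y; rewrite fh//; near: y; exact: open_near.
Unshelve. all: by end_near. Qed.

Lemma Ck_ext (W : normedModType R) k (f h : V -> W) :
  (forall y, U y -> f y = h y) -> Ck k U f -> Ck k U h.
Proof.
elim: k f h => [|k IH] f h fh /=.
  by move=> cf x Ux; apply: eq_on_continuous (fh) Ux (cf _ Ux).
move=> [df Df]; split=> [x Ux|v].
  by apply: eq_on_differentiable (fh) Ux (df _ Ux).
by apply: IH (Df v) => y Uy; apply: eq_on_derive.
Qed.

Lemma CkS (W : normedModType R) k (f : V -> W) : Ck k.+1 U f -> Ck k U f.
Proof.
elim: k f => [|k IH] f /= [df Df].
  by move=> x Ux; apply: differentiable_continuous; apply: df.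
by split=> // v; apply: IH.
Qed.

Lemma smooth_ext (W : normedModType R) (f h : V -> W) :
  (forall y, U y -> f y = h y) -> smooth U f -> smooth U h.
Proof. by move=> fh sf k; apply: Ck_ext (sf k). Qed.

Lemma smooth_differentiable (W : normedModType R) (f : V -> W) x :
  smooth U f -> U x -> differentiable f x.
Proof. by move=> sf Ux; have [df _] := sf 1%N; apply: df. Qed.

Lemma smooth_derivable (W : normedModType R) (f : V -> W) x v :
  smooth U f -> U x -> derivable f x v.
Proof. by move=> sf Ux; apply/diff_derivable/smooth_differentiable. Qed.

Lemma smooth_derive (W : normedModType R) (f : V -> W) v :
  smooth U f -> smooth U (fun x => 'D_v f x).
Proof. by move=> sf k; have [_ /(_ v)] := sf k.+1. Qed.

Lemma smooth_continuous (W : normedModType R) (f : V -> W) x :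
  smooth U f -> U x -> {for x, continuous f}.
Proof. by move=> sf Ux; exact: (sf 0%N). Qed.

Lemma Ck_cst (W : normedModType R) k (a : W) : Ck k U (fun=> a).
Proof.
elim: k a => [|k IH] a /=; first by move=> x _; apply: cst_continuous.
split=> [x Ux|v]; first exact: differentiable_cst.
by apply: (Ck_ext (f := fun=> 0)) => // y _; rewrite derive_cst.
Qed.

Lemma smooth_cst (W : normedModType R) (a : W) : smooth U (fun=> a).
Proof. by move=> k; apply: Ck_cst. Qed.

Lemma CkD (W : normedModType R) k (f h : V -> W) :
  Ck k U f -> Ck k U h -> Ck k U (fun x => f x + h x).
Proof.
elim: k f h => [|k IH] f h /=.
  by move=> cf ch x Ux; apply: continuousD; [apply: cf|apply: ch].
move=> [df Df] [dh Dh]; split=> [x Ux|v].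
  by apply: (@differentiableD _ _ _ f h); [apply: df|apply: dh].
apply: Ck_ext (IH _ _ (Df v) (Dh v)) => y Uy.
by rewrite (@deriveD _ _ _ f h) //; apply: diff_derivable; [apply: df|apply: dh].
Qed.

Lemma smoothD (W : normedModType R) (f h : V -> W) :
  smooth U f -> smooth U h -> smooth U (fun x => f x + h x).
Proof. by move=> sf sh k; apply: CkD. Qed.

Lemma CkM k (f h : V -> R^o) :
  Ck k U f -> Ck k U h -> Ck k U (fun x => f x * h x : R^o).
Proof.
elim: k f h => [|k IH] f h /=.
  by move=> cf ch x Ux; apply: (@continuousM _ _ f h); [apply: cf|apply: ch].
move=> Cf Ch; have [df Df] := Cf; have [dh Dh] := Ch; split=> [x Ux|v].
  by apply: (@differentiableM _ _ f h); [apply: df|apply: dh].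
apply: Ck_ext (CkD (IH _ _ (CkS Cf) (Dh v)) (IH _ _ (CkS Ch) (Df v))) => y Uy.
rewrite (@deriveM _ _ f h) //; apply: diff_derivable; by [apply: df|apply: dh].
Qed.

Lemma smoothM (f h : V -> R^o) :
  smooth U f -> smooth U h -> smooth U (fun x => f x * h x : R^o).
Proof. by move=> sf sh k; apply: CkM. Qed.

Lemma smoothN (f : V -> R^o) : smooth U f -> smooth U (fun x => - f x : R^o).
Proof.
move=> sf; apply: (@smooth_ext _ (fun x => (-1) * f x : R^o)).
  by move=> y _; rewrite mulN1r.
by apply: smoothM => //; apply: smooth_cst.
Qed.

Lemma smoothB (f h : V -> R^o) :
  smooth U f -> smooth U h -> smooth U (fun x => f x - h x : R^o).
Proof. by move=> sf sh; apply: smoothD => //; apply: smoothN. Qed.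

Lemma CkV k (f : V -> R^o) : (forall x, U x -> f x != 0) ->
  Ck k U f -> Ck k U (fun x => (f x)^-1 : R^o).
Proof.
move=> f0; elim: k => [|k IH] /=.
  by move=> cf x Ux; apply: (@continuousV _ _ f); [apply: f0|apply: cf].
move=> Cf; have [df Df] := Cf; split=> [x Ux|v].
  by apply: (@differentiableV _ _ f); [apply: df|apply: f0].
have CV := IH (CkS Cf).
apply: Ck_ext (CkM (Ck_cst _ (-1 : R^o)) (CkM (CkM CV CV) (Df v))) => y Uy.
rewrite (@deriveV _ _ f) ?f0 //; last by apply: diff_derivable; apply: df.
by rewrite mulN1r -expr2 exprVn scaleNr.
Qed.

Lemma smoothV (f : V -> R^o) : (forall x, U x -> f x != 0) ->
  smooth U f -> smooth U (fun x => (f x)^-1 : R^o).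
Proof. by move=> f0 sf k; apply: CkV. Qed.

Lemma Ck_sum k (I : Type) (r : seq I) (f : I -> V -> R^o) :
  (forall i, Ck k U (f i)) -> Ck k U (fun x => \sum_(i <- r) f i x : R^o).
Proof.
move=> Cf; elim: r => [|i r IHr].
  by apply: (@Ck_ext _ _ (fun=> 0 : R^o)) (Ck_cst _ _) => y _; rewrite big_nil.
apply: (@Ck_ext _ _ (fun x => f i x + \sum_(j <- r) f j x : R^o)).
  by move=> y _; rewrite big_cons.
exact: CkD.
Qed.

Lemma smooth_sum (I : Type) (r : seq I) (f : I -> V -> R^o) :
  (forall i, smooth U (f i)) -> smooth U (fun x => \sum_(i <- r) f i x : R^o).
Proof. by move=> sf k; apply: Ck_sum => i; apply: sf. Qed.

Lemma smooth_prod (I : Type) (r : seq I) (P : pred I) (f : I -> V -> R^o) :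
  (forall i, smooth U (f i)) ->
  smooth U (fun x => \prod_(i <- r | P i) f i x : R^o).
Proof.
move=> sf; elim: r => [|i r IH].
  by apply: (@smooth_ext _ (fun=> 1 : R^o)) (smooth_cst _) => y _; rewrite big_nil.
apply: (@smooth_ext _ (fun x => (if P i then f i x else 1 : R^o)
  * \prod_(j <- r | P j) f j x : R^o)).
  by move=> y _; rewrite big_cons; case: (P i); rewrite ?mul1r.
by apply: smoothM => //; case: (P i) => //; apply: smooth_cst.
Qed.

Lemma derive_comp_scalar (f : V -> R^o) (F : R -> R) x v dF :
  differentiable f x -> is_derive (f x) 1 F dF ->
  differentiable (fun y => F (f y) : R^o) x /\
  'D_v (fun y => F (f y) : R^o) x = dF * 'D_v f x.
Proof.
move=> df [DF <-].
have dFd : differentiable (F : R -> R^o) (f x) by apply/derivable1_diffP.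
have dc : differentiable ((F : R -> R^o) \o f) x by apply: differentiable_comp.
split; first exact: dc.
have -> : (fun y => F (f y) : R^o) = (F : R -> R^o) \o f by [].
rewrite (deriveE _ dc) diff_comp //= (deriveE _ df) deriveE //.
by rewrite -[in LHS](mulr1 ('d f x v)) [LHS]linearZ /= mulrC.
Qed.

(** Cosine and sine go through one induction because the derivative of each involves the other. *)
Lemma Ck_trig k (f : V -> R^o) : Ck k U f ->
  Ck k U (fun x => cos (f x) : R^o) /\ Ck k U (fun x => sin (f x) : R^o).
Proof.
elim: k => [|k IH] /=.
  move=> cf; split=> x Ux.
    by apply: (@continuous_comp _ _ _ f cos); [apply: cf|apply: continuous_cos].
  by apply: (@continuous_comp _ _ _ f sin); [apply: cf|apply: continuous_sin].
move=> Cf; have [df Df] := Cf; have [Cc Cs] := IH (CkS Cf).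
have dc x v Ux := derive_comp_scalar v (df x Ux) (is_derive_cos (f x)).
have ds x v Ux := derive_comp_scalar v (df x Ux) (is_derive_sin (f x)).
split; split=> [x Ux|v].
- by have [] := dc x 0 Ux.
- apply: Ck_ext (CkM (Ck_cst _ (-1 : R^o)) (CkM Cs (Df v))) => y Uy.
  by have [_ ->] := dc y v Uy; rewrite mulN1r mulNr.
- by have [] := ds x 0 Ux.
- apply: Ck_ext (CkM Cc (Df v)) => y Uy.
  by have [_ ->] := ds y v Uy.
Qed.

Lemma smooth_cos (f : V -> R^o) :
  smooth U f -> smooth U (fun x => cos (f x) : R^o).
Proof. by move=> sf k; have [] := Ck_trig (sf k). Qed.

Lemma smooth_sin (f : V -> R^o) :
  smooth U f -> smooth U (fun x => sin (f x) : R^o).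
Proof. by move=> sf k; have [] := Ck_trig (sf k). Qed.

End SmoothCalculus.

Lemma smooth_sub (R : realType) (V W : normedModType R) (U U' : set V) (f : V -> W) :
  U' `<=` U -> smooth U f -> smooth U' f.
Proof.
move=> UU' + k; elim: k f => [|k IH] f sf /=.
  by move=> x /UU' Ux; exact: smooth_continuous sf Ux.
split=> [x /UU' Ux|v]; first exact: smooth_differentiable sf Ux.
by apply: IH; apply: smooth_derive.
Qed.

(** * Symmetry of second derivatives *)

Section Schwarz.
Variables (R : realType) (V : normedModType R) (U : set V).

Lemma is_derive_line (f : V -> R^o) (p u : V) (s : R) :
  differentiable f (p + s *: u) ->
  is_derive s 1 (fun s : R => f (p + s *: u) : R) ('D_u f (p + s *: u)).
Proof.
move=> df.
have dl : is_diff s (fun s : R => p + s *: u) (fun s : R => s *: u).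
  by apply: is_diff_eq; rewrite add0r.
have dc : differentiable (f \o (fun s : R => p + s *: u)) s.
  by apply: differentiable_comp => //; case: dl.
apply: DeriveDef; first by apply/derivable1_diffP.
rewrite (deriveE _ df) (_ : (fun s : R => _) = f \o (fun s : R => p + s *: u)) //.
rewrite deriveE // diff_comp //.
by rewrite /= diff_val scale1r.
Qed.

(** The mean value theorem is applied twice: to the increment in direction [v] as a function of the
    parameter along [u], then to ['D_u f] along [v]. The left-hand side of the equation is unchanged
    when [u] and [v] are exchanged, which is what the symmetry of second derivatives rests on. *)
Lemma mixed_difference (f : V -> R^o) (x u v : V) (h : R) :
  0 < h -> smooth U f ->
  (forall s t, 0 <= s <= h -> 0 <= t <= h -> U (x + s *: u + t *: v)) ->
  exists s t, [/\ 0 <= s <= h, 0 <= t <= h &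
    f (x + h *: u + h *: v) - f (x + h *: u) - (f (x + h *: v) - f x)
    = h ^+ 2 * 'D_v (fun y => 'D_u f y) (x + s *: u + t *: v)].
Proof.
move=> h0 sf Uh; have hI : 0 <= h <= h by rewrite lexx ltW.
have zI : 0 <= (0 : R) <= h by rewrite lexx ltW.
have E s t : x + s *: u + t *: v = x + t *: v + s *: u by rewrite addrAC.
pose a s : R := f (x + h *: v + s *: u) - f (x + s *: u).
pose da s : R := 'D_u f (x + h *: v + s *: u) - 'D_u f (x + s *: u).
have dera s : 0 <= s <= h -> is_derive s 1 a (da s).
  move=> sI.
  suff d1 : is_derive s 1 (fun s : R => f (x + h *: v + s *: u) : R)
      ('D_u f (x + h *: v + s *: u)).
    suff d2 : is_derive s 1 (fun s : R => f (x + s *: u) : R)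
        ('D_u f (x + s *: u)) by apply: is_deriveB.
    apply: is_derive_line; apply: smooth_differentiable sf _.
    by have := Uh s 0 sI zI; rewrite scale0r addr0.
  apply: is_derive_line; apply: smooth_differentiable sf _.
  by rewrite -E; apply: Uh.
have [||s sI] := @MVT _ a da 0 h h0.
- by move=> s /[!in_itv]/= /andP[s0 sh]; apply: dera; rewrite !ltW.
- apply: derivable_within_continuous => s /[!in_itv]/= sI.
  by case: (dera s sI).
rewrite subr0 {1}/a {1}/a scale0r !addr0 (addrAC x (h *: v)) => eqa.
have {}sI : 0 <= s <= h by move: sI; rewrite in_itv /= => /andP[? ?]; rewrite !ltW.
pose b t : R := 'D_u f (x + s *: u + t *: v).
pose db t : R := 'D_v (fun y => 'D_u f y) (x + s *: u + t *: v).
have derb t : 0 <= t <= h -> is_derive t 1 b (db t).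
  move=> tI; apply: (@is_derive_line (fun y => 'D_u f y)).
  by apply: smooth_differentiable (smooth_derive u sf) _; apply: Uh.
have [||t tI] := @MVT _ b db 0 h h0.
- by move=> t /[!in_itv]/= /andP[t0 th]; apply: derb; rewrite !ltW.
- apply: derivable_within_continuous => t /[!in_itv]/= tI.
  by case: (derb t tI).
rewrite subr0 {1}/b {1}/b scale0r addr0 => eqb.
exists s, t; split; [by []| |].
  by move: tI; rewrite in_itv /= => /andP[? ?]; rewrite !ltW.
move: eqa; rewrite /da -E eqb /db => eqa.
by rewrite eqa -mulrA mulrC expr2.
Qed.

Hypothesis oU : open U.

Lemma continuous_pair_ball (A B : V -> R^o) (x : V) (e : R) :
  U x -> 0 < e -> {for x, continuous A} -> {for x, continuous B} ->
  exists2 r : R, 0 < r & forall y, ball x r y ->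
    [/\ U y, `|A x - A y| < e & `|B x - B y| < e].
Proof.
move=> Ux e0 cA cB.
have /nbhs_ballP[r r0 rB] :
    \forall y \near x, [/\ U y, `|A x - A y| < e & `|B x - B y| < e].
  near=> y; split; near: y.
  - exact: open_near.
  - by move/cvgrPdist_lt : cA; apply.
  - by move/cvgrPdist_lt : cB; apply.
by exists r.
Unshelve. all: by end_near. Qed.

(** The two second differences coincide, so the two mixed derivatives take a common value at points
    close to [x]; continuity leaves no room for a gap at [x] itself. *)
Lemma derive_comm (f : V -> R^o) (x u v : V) : smooth U f -> U x ->
  'D_u (fun y => 'D_v f y) x = 'D_v (fun y => 'D_u f y) x.
Proof.
move=> sf Ux; apply/eqP/negPn/negP => neq.
(* Half of the supposed gap: two errors smaller than [e] cannot add up to it. *)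
pose e := `|'D_u (fun y => 'D_v f y) x - 'D_v (fun y => 'D_u f y) x| / 2.
have e0 : 0 < e by rewrite divr_gt0 // normr_gt0 subr_eq0.
have c1 : {for x, continuous (fun y => 'D_u (fun y => 'D_v f y) y)}.
  by apply: smooth_continuous Ux; do 2! apply: smooth_derive.
have c2 : {for x, continuous (fun y => 'D_v (fun y => 'D_u f y) y)}.
  by apply: smooth_continuous Ux; do 2! apply: smooth_derive.
have [r r0 rB] := continuous_pair_ball Ux e0 c1 c2.
(* Keeps the whole parallelogram spanned by [h *: u] and [h *: v] inside the ball; the summand 1
   covers the case where both vectors vanish. *)
pose h := r / (2 * (`|u| + `|v| + 1)).
have d0 : 0 < `|u| + `|v| + 1 by rewrite ltr_wpDl // addr_ge0.
have h0 : 0 < h by rewrite divr_gt0 // mulr_gt0.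
have near_x s t : 0 <= s <= h -> 0 <= t <= h -> ball x r (x + s *: u + t *: v).
  move=> /andP[s0 sh] /andP[t0 th]; rewrite -ball_normE /= -addrA opprD addrA subrr.
  rewrite add0r normrN (le_lt_trans (ler_normD _ _)) // !normrZ.
  rewrite !ger0_norm //.
  apply: (@le_lt_trans _ _ (h * (`|u| + `|v|))).
    by rewrite mulrDr lerD // ler_wpM2r.
  rewrite /h mulrAC ltr_pdivrMr ?mulr_gt0 // ltr_pM2l //.
  by rewrite mulr_natl mulr2n -addrA ltrDl addr_gt0.
have near_x' s t : 0 <= s <= h -> 0 <= t <= h -> ball x r (x + s *: v + t *: u).
  by move=> sI tI; rewrite addrAC; apply: near_x.
have [s [t [sI tI eq1]]] := mixed_difference h0 sf
  (fun s t sI tI => let: And3 p _ _ := rB _ (near_x s t sI tI) in p).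
have [s' [t' [sI' tI' eq2]]] := mixed_difference h0 sf
  (fun s t sI tI => let: And3 p _ _ := rB _ (near_x' s t sI tI) in p).
have [_ _ b2] := rB _ (near_x _ _ sI tI).
have [_ b1 _] := rB _ (near_x' _ _ sI' tI').
have h2 : h ^+ 2 != 0 by rewrite expf_neq0 // gt_eqF.
have eqd : 'D_v (fun y => 'D_u f y) (x + s *: u + t *: v) =
           'D_u (fun y => 'D_v f y) (x + s' *: v + t' *: u).
  apply: (mulfI h2); apply: etrans (esym eq1) _; apply: etrans _ eq2.
  rewrite (addrAC x (h *: v)).
  by rewrite -!addrA; congr (_ + _); rewrite !opprD !opprK addrCA addrA.
move: b2; rewrite eqd => b2.
have := ltrD b1 b2; rewrite -splitr ltNge => /negP; apply.
rewrite -[in X in _ <= _ + X]normrN opprB; apply: le_trans (ler_normD _ _).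
by rewrite addrA subrK.
Qed.

End Schwarz.

(** * Calculus of matrix-valued functions *)

Section MatrixCalculus.
Variables (R : realType) (n : nat) (U : set 'rV[R]_n).
Hypothesis oU : open U.

Lemma derive_pd (f : 'rV[R]_n -> R^o) x v : differentiable f x ->
  'D_v f x = \sum_i v 0 i * pd i f x.
Proof.
move=> df; rewrite deriveE // {1}(row_sum_delta v) linear_sum /=.
by apply: eq_bigr => i _; rewrite linearZ /= /pd deriveE.
Qed.

Lemma pdE (i : 'I_n) (f : 'rV[R]_n -> R) x :
  pd i f x = 'D_(delta_mx 0 i) (f : 'rV[R]_n -> R^o) x.
Proof. by []. Qed.

Lemma eq_on_pd i (f h : 'rV[R]_n -> R) x :
  (forall y, U y -> f y = h y) -> U x -> pd i f x = pd i h x.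
Proof. by move=> fh Ux; apply: (eq_on_derive oU). Qed.

Lemma pdD i (f h : 'rV[R]_n -> R^o) x : smooth U f -> smooth U h -> U x ->
  pd i (fun y => f y + h y) x = pd i f x + pd i h x.
Proof.
by move=> sf sh Ux; apply: (@deriveD _ _ _ f h); apply: smooth_derivable Ux.
Qed.

Lemma pdM i (f h : 'rV[R]_n -> R^o) x : smooth U f -> smooth U h -> U x ->
  pd i (fun y => f y * h y) x = pd i f x * h x + f x * pd i h x.
Proof.
move=> sf sh Ux; rewrite /pd (@deriveM _ _ f h); first by rewrite addrC mulrC.
- exact: smooth_derivable Ux.
- exact: smooth_derivable Ux.
Qed.

Lemma pd_cst (i : 'I_n) (a : R) (x : 'rV[R]_n) : pd i (fun=> a) x = 0.
Proof. exact: derive_cst. Qed.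

Lemma pd_sum i (I : Type) (r : seq I) (f : I -> 'rV[R]_n -> R^o) x :
  (forall b, smooth U (f b)) -> U x ->
  pd i (fun y => \sum_(b <- r) f b y) x = \sum_(b <- r) pd i (f b) x.
Proof.
move=> sf Ux; elim: r => [|b r IH].
  rewrite big_nil -[RHS](pd_cst i 0 x); apply: eq_on_pd Ux => y _.
  by rewrite big_nil.
rewrite big_cons -IH -pdD //; last by apply: smooth_sum.
by apply: eq_on_pd Ux => y _; rewrite big_cons.
Qed.

Lemma pdC i j (f : 'rV[R]_n -> R^o) x : smooth U f -> U x ->
  pd i (pd j f) x = pd j (pd i f) x.
Proof. by move=> sf Ux; apply: (derive_comm oU). Qed.

Lemma smooth_pd i (f : 'rV[R]_n -> R^o) : smooth U f ->
  smooth U (pd i f : 'rV[R]_n -> R^o).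
Proof. by move=> sf; apply: smooth_derive. Qed.

Definition mpd (p q : nat) i (A : 'rV[R]_n -> 'M[R]_(p, q)) x :=
  \matrix_(a, b) pd i (fun y => A y a b) x.

Definition msmooth (p q : nat) (A : 'rV[R]_n -> 'M[R]_(p, q)) :=
  forall a b, smooth U (fun y => A y a b : R^o).

Lemma eq_on_mpd p q i (A B : 'rV[R]_n -> 'M[R]_(p, q)) x :
  (forall y, U y -> A y = B y) -> U x -> mpd i A x = mpd i B x.
Proof.
by move=> AB Ux; apply/matrixP => a b; rewrite !mxE; apply: eq_on_pd => // y /AB->.
Qed.

Lemma msmooth_ext p q (A B : 'rV[R]_n -> 'M[R]_(p, q)) :
  (forall y, U y -> A y = B y) -> msmooth A -> msmooth B.
Proof. by move=> AB sA a b; apply: smooth_ext (sA a b) => // y /AB->. Qed.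

Lemma mpdD p q i (A B : 'rV[R]_n -> 'M[R]_(p, q)) x :
  msmooth A -> msmooth B -> U x ->
  mpd i (fun y => A y + B y) x = mpd i A x + mpd i B x.
Proof.
move=> sA sB Ux; apply/matrixP => a b; rewrite !mxE -pdD //.
by apply: eq_on_pd Ux => y _; rewrite mxE.
Qed.

Lemma mpdM p q r i (A : 'rV[R]_n -> 'M[R]_(p, q)) (B : 'rV[R]_n -> 'M[R]_(q, r)) x :
  msmooth A -> msmooth B -> U x ->
  mpd i (fun y => A y *m B y) x = mpd i A x *m B x + A x *m mpd i B x.
Proof.
move=> sA sB Ux; apply/matrixP => a b; rewrite !mxE.
transitivity (pd i (fun y => \sum_j A y a j * B y j b) x).
  by apply: eq_on_pd Ux => y _; rewrite mxE.
rewrite pd_sum //; last by move=> j; apply: smoothM.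
rewrite -big_split; apply: eq_bigr => j _; rewrite pdM //=.
by rewrite !mxE.
Qed.

Lemma mpd_tr p q i (A : 'rV[R]_n -> 'M[R]_(p, q)) x :
  mpd i (fun y => (A y)^T) x = (mpd i A x)^T.
Proof.
apply/matrixP => a b; rewrite !mxE; congr (pd i _ x).
by apply/funext => y; rewrite mxE.
Qed.

Lemma mpd_cst p q i (A : 'M[R]_(p, q)) x : mpd i (fun=> A) x = 0.
Proof. by apply/matrixP => a b; rewrite !mxE pd_cst. Qed.

Lemma mpdZ p q i (f : 'rV[R]_n -> R^o) (A : 'rV[R]_n -> 'M[R]_(p, q)) x :
  smooth U f -> msmooth A -> U x ->
  mpd i (fun y => f y *: A y) x = pd i f x *: A x + f x *: mpd i A x.
Proof.
move=> sf sA Ux; apply/matrixP => a b; rewrite !mxE -pdM //.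
by apply: eq_on_pd Ux => y _; rewrite mxE.
Qed.

Lemma mpd_sum p q i (I : Type) (r : seq I) (A : I -> 'rV[R]_n -> 'M[R]_(p, q)) x :
  (forall b, msmooth (A b)) -> U x ->
  mpd i (fun y => \sum_(b <- r) A b y) x = \sum_(b <- r) mpd i (A b) x.
Proof.
move=> sA Ux; apply/matrixP => a b; rewrite summxE !mxE.
transitivity (pd i (fun y => \sum_(c <- r) A c y a b) x).
  by apply: eq_on_pd Ux => y _; rewrite summxE.
rewrite pd_sum //; last by move=> c; apply: sA.
by apply: eq_bigr => c _; rewrite mxE.
Qed.

Lemma mpdN p q i (A : 'rV[R]_n -> 'M[R]_(p, q)) x : msmooth A -> U x ->
  mpd i (fun y => - A y) x = - mpd i A x.
Proof.
move=> sA Ux; rewrite -scaleN1r -[RHS]add0r -(scale0r (A x)) -(pd_cst i (-1) x).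
rewrite -mpdZ //; last exact: smooth_cst.
by apply: eq_on_mpd Ux => y _; rewrite scaleN1r.
Qed.

Lemma mpdE p q i (A : 'rV[R]_n -> 'M[R]_(p, q)) x a b :
  mpd i A x a b = pd i (fun y => A y a b) x.
Proof. by rewrite mxE. Qed.

Lemma mpdC p q i j (A : 'rV[R]_n -> 'M[R]_(p, q)) x : msmooth A -> U x ->
  mpd i (mpd j A) x = mpd j (mpd i A) x.
Proof.
move=> sA Ux; apply/matrixP => a b; rewrite [LHS]mpdE [RHS]mpdE.
under eq_fun do rewrite mpdE.
under [in RHS]eq_fun do rewrite mpdE.
exact: pdC.
Qed.

Lemma msmooth_mpd p q i (A : 'rV[R]_n -> 'M[R]_(p, q)) :
  msmooth A -> msmooth (mpd i A).
Proof.
move=> sA a b; apply: smooth_ext (smooth_pd i (sA a b)) => // y _.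
by rewrite mxE.
Qed.

Lemma msmooth_cst p q (A : 'M[R]_(p, q)) : msmooth (fun=> A).
Proof. by move=> a b; apply: smooth_cst. Qed.

Lemma msmoothD p q (A B : 'rV[R]_n -> 'M[R]_(p, q)) :
  msmooth A -> msmooth B -> msmooth (fun y => A y + B y).
Proof.
move=> sA sB a b; apply: smooth_ext (smoothD oU (sA a b) (sB a b)) => // y _.
by rewrite mxE.
Qed.

Lemma msmoothZ p q (f : 'rV[R]_n -> R^o) (A : 'rV[R]_n -> 'M[R]_(p, q)) :
  smooth U f -> msmooth A -> msmooth (fun y => f y *: A y).
Proof.
move=> sf sA a b; apply: smooth_ext (smoothM oU sf (sA a b)) => // y _.
by rewrite mxE.
Qed.

Lemma msmoothN p q (A : 'rV[R]_n -> 'M[R]_(p, q)) :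
  msmooth A -> msmooth (fun y => - A y).
Proof.
move=> sA a b; apply: smooth_ext (smoothN oU (sA a b)) => // y _.
by rewrite mxE.
Qed.

Lemma msmooth_tr p q (A : 'rV[R]_n -> 'M[R]_(p, q)) :
  msmooth A -> msmooth (fun y => (A y)^T).
Proof. by move=> sA a b; apply: smooth_ext (sA b a) => // y _; rewrite mxE. Qed.

Lemma msmoothM p q r (A : 'rV[R]_n -> 'M[R]_(p, q)) (B : 'rV[R]_n -> 'M[R]_(q, r)) :
  msmooth A -> msmooth B -> msmooth (fun y => A y *m B y).
Proof.
move=> sA sB a b.
apply: (@smooth_ext _ _ _ oU _ (fun y => \sum_j A y a j * B y j b : R^o)).
  by move=> y _; rewrite mxE.
by apply: smooth_sum => // j; apply: smoothM.
Qed.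

Lemma msmooth_sum p q (I : Type) (r : seq I) (A : I -> 'rV[R]_n -> 'M[R]_(p, q)) :
  (forall b, msmooth (A b)) -> msmooth (fun y => \sum_(b <- r) A b y).
Proof.
move=> sA a b.
apply: (@smooth_ext _ _ _ oU _ (fun y => \sum_(c <- r) A c y a b : R^o)).
  by move=> y _; rewrite summxE.
by apply: smooth_sum => // c; apply: sA.
Qed.

Lemma smooth_det p (A : 'rV[R]_n -> 'M[R]_p) : msmooth A ->
  smooth U (fun y => \det (A y) : R^o).
Proof.
move=> sA; apply: smooth_sum => // s; apply: smoothM => //.
  exact: smooth_cst.
by apply: smooth_prod => // j; apply: sA.
Qed.

(** Cramer's rule: the inverse is the adjugate over the determinant, and both are polynomial in the
    entries. *)
Lemma msmooth_invmx p (A : 'rV[R]_n -> 'M[R]_p) : msmooth A ->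
  (forall x, U x -> A x \in unitmx) -> msmooth (fun y => invmx (A y)).
Proof.
move=> sA uA.
apply: (@msmooth_ext _ _ (fun y => (\det (A y))^-1 *: \adj (A y))).
  by move=> y /uA; rewrite /invmx => ->.
apply: msmoothZ.
  apply: smoothV => //; last exact: smooth_det.
  by move=> y /uA; rewrite unitmxE unitfE.
move=> a b.
apply: (@smooth_ext _ _ _ oU _
  (fun y => (-1) ^+ (b + a) * \det (row' b (col' a (A y))) : R^o)).
  by move=> y _; rewrite mxE.
apply: smoothM => //; first exact: smooth_cst.
apply: smooth_det => c d; apply: smooth_ext (sA (lift b c) (lift a d)) => // y _.
by rewrite !mxE.
Qed.

End MatrixCalculus.

#[global] Opaque pd mpd.

(** * Levi-Civita connection and curvature *)

(** The algebra behind transporting curvature through a bundle map [Th]. Here [dGj] and [dwj] are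
    derivatives in direction i, [dGi] and [dwi] in direction j, and [ddT] is the common mixed second
    derivative of [Th], which cancels on antisymmetrizing. *)
Lemma solder_algebra (R : comNzRingType) n m (dGi dGj Gi Gj : 'M[R]_n)
    (Th dTi dTj ddT : 'M[R]_(n, m)) (dwi dwj wi wj : 'M[R]_m) :
  dGj *m Th + Gj *m dTi = ddT + (dTi *m wj + Th *m dwj) ->
  dGi *m Th + Gi *m dTj = ddT + (dTj *m wi + Th *m dwi) ->
  Gi *m Th = dTi + Th *m wi -> Gj *m Th = dTj + Th *m wj ->
  (dGj - dGi + (Gj *m Gi - Gi *m Gj)) *m Th
  = Th *m (dwj - dwi + (wj *m wi - wi *m wj)).
Proof.
move=> ei ej ti tj.
have {}ei := canRL (addrK _) ei; have {}ej := canRL (addrK _) ej.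
rewrite !(mulmxDl, mulNmx) ei ej -(mulmxA Gj) -(mulmxA Gi) ti tj.
rewrite !(mulmxDr, mulmxN) !(mulmxA Gi) !(mulmxA Gj) ti tj !mulmxDl -!(mulmxA Th).
move: (dTi *m wj) (dTj *m wi) (Th *m dwj) (Th *m dwi) (Th *m (wi *m wj)).
move: (Th *m (wj *m wi)) (Gi *m dTj) (Gj *m dTi) => a b c d e f h k.
by apply/matrixP => p q; rewrite !mxE; ring.
Qed.

Section LeviCivita.
Variables (R : realType) (n : nat).
Implicit Types (g : metric_field R n) (U : set 'rV[R]_n).

Definition Gam g i x := \matrix_(j, k) Gamma g i j k x.

(** Row convention: row j of [Gam g i x] holds the components of nabla_i d_j, so connection matrices
    act from the right and the products appear in the order opposite to the usual commutator. *)
Definition Curv g i j x : 'M[R]_n :=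
  mpd i (Gam g j) x - mpd j (Gam g i) x
  + (Gam g j x *m Gam g i x - Gam g i x *m Gam g j x).

Lemma CurvE g i j x : Curv g i j x = mpd i (Gam g j) x - mpd j (Gam g i) x
  + (Gam g j x *m Gam g i x - Gam g i x *m Gam g j x).
Proof. by []. Qed.

Lemma GamijkE g i j k x : Gam g i x j k = Gamma g i j k x.
Proof. by rewrite mxE. Qed.

Lemma curvE g i j k l x : curv g i j k l x = Curv g i j x k l.
Proof.
rewrite /curv /Curv !mxE -sumrB; congr (pd i _ x - pd j _ x + _).
- by apply/funext => y; rewrite mxE.
- by apply/funext => y; rewrite mxE.
- by apply: eq_bigr => m _; rewrite !mxE.
Qed.

Lemma riemE g i j k l x : riem g i j k l x = (Curv g i j x *m g x) l k.
Proof. by rewrite mxE; apply: eq_bigr => m _; rewrite curvE. Qed.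

(** Christoffel symbols of the first kind. *)
Definition lowered g i x :=
  \matrix_(j, l) (2^-1 * (pd i (fun y => g y j l) x + pd j (fun y => g y i l) x
     - pd l (fun y => g y i j) x)).

Lemma GamE g i x : (g x)^T = g x -> Gam g i x = lowered g i x *m invmx (g x).
Proof.
move=> gT; apply/matrixP => j k; rewrite !mxE /Gamma mulr_sumr.
apply: eq_bigr => l _; rewrite !mxE /ginv.
have -> : invmx (g x) k l = invmx (g x) l k by rewrite -[in LHS]gT -trmx_inv mxE.
by rewrite mulrA mulrAC.
Qed.

(** Koszul's argument: the lowered coefficients [L] are symmetric in their first two indices, and
    the derivative of the metric is the sum of two of them; the usual alternating sum of three
    derivatives leaves twice one coefficient. Every connection found later is recognized as
    Levi-Civita through this lemma. *)
Lemma Gam_unique g x (C : 'I_n -> 'M[R]_n) :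
  (g x)^T = g x -> g x \in unitmx ->
  (forall i, mpd i g x = C i *m g x + g x *m (C i)^T) ->
  (forall i j k, C i j k = C j i k) ->
  forall i, Gam g i x = C i.
Proof.
move=> gT gu Cg Cs i; rewrite GamE // -[RHS](mulmxK gu); congr (_ *m _).
pose L i j l := (C i *m g x) j l.
have Ls a b c : L a b c = L b a c.
  by rewrite /L !mxE; apply: eq_bigr => m _; rewrite Cs.
have dg a b c : pd a (fun y => g y b c) x = L a b c + L a c b.
  have := Cg a => /matrixP/(_ b c); rewrite mpdE => ->; rewrite [LHS]mxE.
  by congr (_ + _); rewrite -[in LHS]gT -trmx_mul mxE.
apply/matrixP => j l; rewrite mxE !dg -/(L i j l).
rewrite (Ls j i l) (Ls l i j) (Ls l j i) (Ls j l i).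
set a := L i j l; lra.
Qed.

Section Riemannian.
Variables (U : set 'rV[R]_n) (g : metric_field R n).
Hypotheses (oU : open U) (rg : riemannian U g).

Lemma riemannian_sym x : U x -> (g x)^T = g x.
Proof. by case: rg => _ + _; apply. Qed.

Lemma riemannian_unit x : U x -> g x \in unitmx.
Proof.
move=> Ux; rewrite -row_free_unit; apply: inj_row_free => v v0.
case: (eqVneq v 0) => // vn0; case: rg => _ _ /(_ x Ux v vn0).
by rewrite /inner v0 mul0mx mxE ltxx.
Qed.

Lemma riemannian_smooth : msmooth U g.
Proof. by case: rg. Qed.

Lemma pd_metric_sym i j l x : U x ->
  pd l (fun y => g y i j) x = pd l (fun y => g y j i) x.
Proof.
move=> Ux; apply: (eq_on_pd oU) Ux => y Uy.
by rewrite -[in LHS](riemannian_sym Uy) mxE.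
Qed.

Lemma Gam_sym i j k x : U x -> Gam g i x j k = Gam g j x i k.
Proof.
move=> Ux; rewrite !mxE /Gamma; congr (_ * _); apply: eq_bigr => l _.
by rewrite [X in _ * (X - _)]addrC (pd_metric_sym i j l Ux).
Qed.

Lemma Gam_metric i x : U x ->
  mpd i g x = Gam g i x *m g x + g x *m (Gam g i x)^T.
Proof.
move=> Ux; have gT := riemannian_sym Ux; have gu := riemannian_unit Ux.
have -> : g x *m (Gam g i x)^T = (Gam g i x *m g x)^T by rewrite trmx_mul gT.
rewrite GamE // mulmxKV //; apply/matrixP => j l; rewrite mpdE !mxE.
rewrite (pd_metric_sym l j i Ux).
set a := pd i _ x; set b := pd j _ x; set c := pd l _ x; lra.
Qed.

Lemma msmooth_Gam i : msmooth U (Gam g i).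
Proof.
apply: (@msmooth_ext _ _ _ oU _ _ (fun x => lowered g i x *m invmx (g x))).
  by move=> y Uy; rewrite GamE // riemannian_sym.
apply: msmoothM => //; last first.
  by apply: msmooth_invmx => //; [apply: riemannian_smooth|apply: riemannian_unit].
have sg := riemannian_smooth.
move=> j l; apply: (@smooth_ext _ _ _ oU _ (fun x => 2^-1 *
  (pd i (fun y => g y j l) x + pd j (fun y => g y i l) x
     - pd l (fun y => g y i j) x) : R^o)).
  by move=> y _; rewrite mxE.
apply: smoothM => //; first exact: smooth_cst.
by apply: smoothB => //; [apply: smoothD => //|]; apply: smooth_pd.
Qed.

Lemma Curv_antisym i j x : Curv g j i x = - Curv g i j x.
Proof. by rewrite /Curv opprD opprB [in RHS]opprB. Qed.

(* [Th] identifies the tangent bundle with a trivial bundle carrying the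
   connection [om]; the connection and hence the curvature correspond. *)
Lemma Curv_solder m (Th : 'rV[R]_n -> 'M[R]_(n, m))
    (om : 'I_n -> 'rV[R]_n -> 'M[R]_m) x :
  msmooth U Th -> (forall i, msmooth U (om i)) ->
  (forall i y, U y -> Gam g i y *m Th y = mpd i Th y + Th y *m om i y) ->
  U x -> forall i j, Curv g i j x *m Th x =
    Th x *m (mpd i (om j) x - mpd j (om i) x
             + (om j x *m om i x - om i x *m om j x)).
Proof.
move=> sT so GT Ux.
have key i j : mpd i (Gam g j) x *m Th x + Gam g j x *m mpd i Th x =
    mpd i (mpd j Th) x + (mpd i Th x *m om j x + Th x *m mpd i (om j) x).
  have sG := msmooth_Gam j; have sdT := msmooth_mpd oU j sT.
  have sTo := msmoothM oU sT (so j).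
  have := eq_on_mpd oU i (GT j) Ux.
  by rewrite (mpdM oU _ sG sT Ux) (mpdD oU _ sdT sTo Ux) (mpdM oU _ sT (so j) Ux).
move=> i j; have kj := key j i; rewrite (mpdC oU j i sT Ux) in kj.
exact: solder_algebra (key i j) kj (GT i x Ux) (GT j x Ux).
Qed.

End Riemannian.
End LeviCivita.

#[global] Opaque Gam Curv.

(** [- P^T] is the connection matrix induced on the dual bundle, whose curvature is the negative
    transpose. *)
Lemma dual_curvature_algebra (R : comNzRingType) n (a b P Q : 'M[R]_n) :
  - a^T - - b^T + ((- Q^T) *m (- P^T) - (- P^T) *m (- Q^T))
  = - (a - b + (Q *m P - P *m Q))^T.
Proof.
rewrite !mulNmx !mulmxN !opprK -!trmx_mul.
by move: (P *m Q) (Q *m P) => c d; apply/matrixP => i j; rewrite !mxE; ring.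
Qed.

(** * Symmetries of the curvature tensor and constant sectional curvature *)

Section ConstantCurvature.
Variables (R : realType) (n : nat).

Definition quad_form (T : 'I_n -> 'I_n -> 'I_n -> 'I_n -> R) (a b c d : 'rV[R]_n) :=
  \sum_i \sum_j \sum_k \sum_l T i j k l * a 0 i * b 0 j * c 0 k * d 0 l.

Lemma quad_formD1 T a a' b c d :
  quad_form T (a + a') b c d = quad_form T a b c d + quad_form T a' b c d.
Proof.
do 4! (rewrite -big_split; apply: eq_bigr => ? _ /=).
by rewrite mxE; ring.
Qed.

Lemma quad_formD2 T a b b' c d :
  quad_form T a (b + b') c d = quad_form T a b c d + quad_form T a b' c d.
Proof.
do 4! (rewrite -big_split; apply: eq_bigr => ? _ /=).
by rewrite mxE; ring.
Qed.

Lemma quad_formD3 T a b c c' d :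
  quad_form T a b (c + c') d = quad_form T a b c d + quad_form T a b c' d.
Proof.
do 4! (rewrite -big_split; apply: eq_bigr => ? _ /=).
by rewrite mxE; ring.
Qed.

Lemma quad_formD4 T a b c d d' :
  quad_form T a b c (d + d') = quad_form T a b c d + quad_form T a b c d'.
Proof.
do 4! (rewrite -big_split; apply: eq_bigr => ? _ /=).
by rewrite mxE; ring.
Qed.

Lemma quad_formZ1 T r a b c d :
  quad_form T (r *: a) b c d = r * quad_form T a b c d.
Proof.
do 4! (rewrite mulr_sumr; apply: eq_bigr => ? _ /=).
by rewrite mxE; ring.
Qed.

Lemma quad_formZ2 T r a b c d :
  quad_form T a (r *: b) c d = r * quad_form T a b c d.
Proof.
do 4! (rewrite mulr_sumr; apply: eq_bigr => ? _ /=).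
by rewrite mxE; ring.
Qed.

Lemma quad_formB (S T : 'I_n -> 'I_n -> 'I_n -> 'I_n -> R) a b c d :
  quad_form (fun i j k l => S i j k l - T i j k l) a b c d
  = quad_form S a b c d - quad_form T a b c d.
Proof.
do 4! (rewrite -sumrB; apply: eq_bigr => ? _ /=).
by ring.
Qed.

Lemma quad_form_delta T i j k l : quad_form T (delta_mx 0 i) (delta_mx 0 j)
  (delta_mx 0 k) (delta_mx 0 l) = T i j k l.
Proof.
rewrite /quad_form (bigD1 i) //= [X in _ + X]big1 => [|i' ni]; last first.
  do 3! (apply: big1 => ? _); rewrite !mxE eqxx (negPf ni) /=; ring.
rewrite addr0 (bigD1 j) //= [X in _ + X]big1 => [|i' ni]; last first.
  do 2! (apply: big1 => ? _); rewrite !mxE !eqxx (negPf ni) /=; ring.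
rewrite addr0 (bigD1 k) //= [X in _ + X]big1 => [|i' ni]; last first.
  do 1! (apply: big1 => ? _); rewrite !mxE !eqxx (negPf ni) /=; ring.
rewrite addr0 (bigD1 l) //= [X in _ + X]big1 => [|i' ni]; last first.
  by rewrite !mxE !eqxx (negPf ni) /=; ring.
by rewrite addr0 !mxE !eqxx !mulr1.
Qed.

Lemma quad_form_antisym T a c d : (forall i j k l, T j i k l = - T i j k l) ->
  quad_form T a a c d = 0.
Proof.
move=> Ta; suff : quad_form T a a c d = - quad_form T a a c d by lra.
rewrite {2}/quad_form exchange_big -sumrN; apply: eq_bigr => i _.
rewrite -sumrN; apply: eq_bigr => j _.
do 2! (rewrite -sumrN; apply: eq_bigr => ? _).
by rewrite [X in _ = - (X * _ * _ * _ * _)]Ta; ring.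
Qed.

(** An algebraic curvature tensor is determined by its sectional values. Polarization and pair
    symmetry give antisymmetry under exchange of the second and fourth indices, after which the
    three terms of the Bianchi identity are equal. *)
Lemma curvature_like_eq0 T :
  (forall i j k l, T j i k l = - T i j k l) ->
  (forall i j k l, T i j l k = - T i j k l) ->
  (forall i j k l, T i j k l + T j l k i + T l i k j = 0) ->
  (forall u v, quad_form T u v u v = 0) ->
  forall i j k l, T i j k l = 0.
Proof.
move=> T12 T34 Tb Q.
(* Polarization of the vanishing form, first in [u], then in [v]. *)
have pol i j k l : T i j k l + T k j i l + T i l k j + T k l i j = 0.
  pose e := fun i : 'I_n => delta_mx 0 i : 'rV[R]_n.
  have q1 a b c d := quad_form_delta T a b c d.
  have p1 u u' v : quad_form T u v u' v + quad_form T u' v u v = 0.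
    have := Q (u + u') v; rewrite quad_formD1 !quad_formD3 !Q; lra.
  have := p1 (e i) (e k) (e j + e l).
  rewrite !quad_formD2 !quad_formD4.
  have := p1 (e i) (e k) (e j); have := p1 (e i) (e k) (e l).
  rewrite !q1; lra.
(* Pair symmetry by the octahedron argument, that is, from four instances of the Bianchi
   identity. *)
have pair i j k l : T i j k l = T k l i j.
  have := Tb i j k l; rewrite (T34 j l i k) (T12 i l k j).
  have := Tb i j l k; rewrite (T34 i j k l) (T12 k j l i) (T34 k j i l).
  rewrite (T12 i k l j) (T34 i k j l).
  have := Tb j k i l; rewrite (T12 k j i l) (T12 j l i k).
  have := Tb i k j l; rewrite (T34 k l i j) (T12 i l j k) (T34 i l k j).
  lra.
move=> i j k l.
have s1 a b c d : T a b c d = - T a d c b.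
  have := pol a b c d; rewrite (pair c b a d) (pair c d a b); lra.
have := Tb i j k l; rewrite (T12 i l k j) (s1 i l k j) (s1 j l k i) (T12 i j k l).
lra.
Qed.

Variables (U : set 'rV[R]_n) (h : metric_field R n).
Hypotheses (oU : open U) (rh : riemannian U h).

Lemma innerE (x u v : 'rV[R]_n) :
  inner h x u v = \sum_i \sum_j h x i j * u 0 i * v 0 j.
Proof.
rewrite /inner mxE; under eq_bigr do rewrite !mxE mulr_suml.
rewrite exchange_big; apply: eq_bigr => i _; apply: eq_bigr => j _.
by rewrite (mulrC (u 0 i)).
Qed.

Lemma innerDl x u u' v : inner h x (u + u') v = inner h x u v + inner h x u' v.
Proof. by rewrite /inner !mulmxDl mxE. Qed.

Lemma innerZl x r u v : inner h x (r *: u) v = r * inner h x u v.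
Proof. by rewrite /inner -!scalemxAl mxE. Qed.

Lemma innerC x u v : U x -> inner h x u v = inner h x v u.
Proof.
move=> Ux; rewrite /inner -[in RHS](riemannian_sym rh Ux).
by rewrite -[in RHS]mulmxA -trmx_mul -[v in RHS]trmxK -trmx_mul [RHS]mxE.
Qed.

Lemma inner_gt0 x u : U x -> u != 0 -> 0 < inner h x u u.
Proof. by case: rh => _ _ /[apply] /[apply]. Qed.

Lemma quad_form_metric x (u v : 'rV[R]_n) (kappa : R) :
  quad_form (fun i j k l => kappa * (h x i k * h x j l - h x i l * h x j k))
    u v u v
  = kappa * (inner h x u u * inner h x v v - inner h x u v * inner h x v u).
Proof.
have s4 (F G : 'I_n -> 'I_n -> R) : \sum_i \sum_j \sum_k \sum_l F i k * G j l
    = (\sum_i \sum_k F i k) * (\sum_j \sum_l G j l).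
  rewrite big_distrlr /=; apply: eq_bigr => i _; apply: eq_bigr => j _.
  by rewrite big_distrlr.
have E1 : \sum_i \sum_j \sum_k \sum_l (h x i k * u 0 i * u 0 k)
    * (h x j l * v 0 j * v 0 l) = inner h x u u * inner h x v v.
  by rewrite s4 !innerE.
have E2 : \sum_i \sum_j \sum_k \sum_l (h x i l * u 0 i * v 0 l)
    * (h x j k * v 0 j * u 0 k) = inner h x u v * inner h x v u.
  rewrite !innerE -s4; apply: eq_bigr => i _; apply: eq_bigr => j _.
  exact: exchange_big.
rewrite -E1 -E2 -sumrB mulr_sumr; apply: eq_bigr => i _.
do 3! (rewrite -sumrB mulr_sumr; apply: eq_bigr => ? _).
by ring.
Qed.

(** The metric itself is used as the bundle map from the tangent to the cotangent bundle: being
    parallel, it intertwines [Gam] with the dual connection [- Gam^T], hence also their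
    curvatures. *)
Lemma Curv_metric_antisym i j x : U x ->
  Curv h i j x *m h x = - (Curv h i j x *m h x)^T.
Proof.
move=> Ux.
have sG i' := msmooth_tr oU (msmooth_Gam oU rh i').
rewrite [LHS](Curv_solder (om := fun i y => - (Gam h i y)^T) oU rh
  (riemannian_smooth rh) (fun i' => msmoothN oU (sG i')) _ Ux); last first.
  by move=> i' y Uy; rewrite (Gam_metric oU rh i' Uy) mulmxN addrK.
rewrite [in RHS]trmx_mul [in RHS](riemannian_sym rh Ux) -[RHS]mulmxN; congr (_ *m _).
rewrite (mpdN oU j (sG i) Ux) (mpdN oU i (sG j) Ux) !mpd_tr CurvE.
exact: dual_curvature_algebra.
Qed.

Lemma riem_antisym12 i j k l x : riem h j i k l x = - riem h i j k l x.
Proof. by rewrite !riemE Curv_antisym mulNmx mxE. Qed.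

Lemma riem_antisym34 i j k l x : U x -> riem h i j l k x = - riem h i j k l x.
Proof.
move=> Ux; rewrite !riemE; have := Curv_metric_antisym i j Ux.
by move: (Curv h i j x *m h x) => M /matrixP/(_ k l) ->; rewrite !mxE.
Qed.

(** Torsion-freeness enters twice: the derivative terms [D] are symmetric in their last two indices
    and the quadratic terms [G] in their outer two, so that the cyclic sum cancels in pairs. *)
Lemma Curv_bianchi i j l x : U x ->
  row l (Curv h i j x) + row i (Curv h j l x) + row j (Curv h l i x) = 0.
Proof.
move=> Ux; apply/rowP => m.
have dG a b c : mpd a (Gam h b) x c m = mpd a (Gam h c) x b m.
  rewrite [LHS]mpdE [RHS]mpdE; apply: (eq_on_pd oU) Ux => y Uy.
  exact: (Gam_sym oU rh b c m Uy).
have GG a b c : (Gam h a x *m Gam h b x) c m = (Gam h c x *m Gam h b x) a m.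
  rewrite [LHS]mxE [RHS]mxE; apply: eq_bigr => p _.
  by rewrite (Gam_sym oU rh a c p Ux).
have [D [G [DC GC E]]] : exists D G : 'I_n -> 'I_n -> 'I_n -> R,
    [/\ forall a b c, D a b c = D a c b, forall a b c, G a b c = G c b a &
    forall a b c, row c (Curv h a b x) 0 m = D a b c - D b a c
      + (G b a c - G a b c)].
  exists (fun a b c => mpd a (Gam h b) x c m).
  exists (fun a b c => (Gam h a x *m Gam h b x) c m).
  split=> [a b c|a b c|a b c]; [exact: (dG a b c)|exact: (GG a b c)|].
  rewrite mxE CurvE.
  move: (mpd a _ _) (mpd b _ _) (_ *m Gam h a x) (Gam h a x *m _) => *.
  by rewrite !mxE.
move: (E i j l) (E j l i) (E l i j).
move: (row l (Curv h i j x)) (row i (Curv h j l x)) (row j (Curv h l i x)).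
move=> r1 r2 r3 e1 e2 e3; rewrite !mxE e1 e2 e3.
rewrite (DC i j l) (DC j l i) (DC l i j) (GC j i l) (GC l j i) (GC i l j).
ring.
Qed.

Lemma riem_bianchi i j k l x : U x ->
  riem h i j k l x + riem h j l k i x + riem h l i k j x = 0.
Proof.
move=> Ux; rewrite !riemE; move: (Curv_bianchi i j l Ux).
move: (Curv h i j x) (Curv h j l x) (Curv h l i x) (h x) => A B C M H.
have rE (N : 'M[R]_n) a : (N *m M) a k = (row a N *m M) 0 k.
  by rewrite -row_mul [RHS]mxE.
have DE (u v : 'rV[R]_n) : u 0 k + v 0 k = (u + v) 0 k by rewrite mxE.
by rewrite !rE !DE -!mulmxDl H mul0mx mxE.
Qed.

(** The difference [T] between the curvature and its constant curvature model has all curvature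
    symmetries, so it is enough to evaluate it on pairs [u], [v]. Dependent pairs give 0 by
    antisymmetry, independent ones by hypothesis. *)
Lemma const_sectional_riem kappa : const_sectional kappa U h ->
  forall x, U x -> forall i j k l,
    riem h i j k l x = kappa * (h x i k * h x j l - h x i l * h x j k).
Proof.
move=> ch x Ux i j k l; have hs a b : h x a b = h x b a.
  by rewrite -[in LHS](riemannian_sym rh Ux) mxE.
pose T a b c d := riem h a b c d x
  - kappa * (h x a c * h x b d - h x a d * h x b c).
suff T0 : T i j k l = 0 by apply/eqP; rewrite -subr_eq0; apply/eqP.
have T12 a b c d : T b a c d = - T a b c d.
  by rewrite /T riem_antisym12; ring.
apply: curvature_like_eq0 => [||a b c d|u v].
- exact: T12.
- by move=> a b c d; rewrite /T riem_antisym34 //; ring.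
- move: (riem_bianchi a b c d Ux); rewrite /T (hs d b) (hs d a) (hs b a).
  move: (riem h a b c d x) (riem h b d c a x) (riem h d a c b x) => r1 r2 r3 H.
  by rewrite -[RHS]H; ring.
have [->|v0] := eqVneq v 0.
  by have := quad_formZ2 T 0 u 0 u 0; rewrite scale0r mul0r.
have vv := inner_gt0 Ux v0.
(* Gram-Schmidt: [w] vanishes exactly when [u] is a multiple of [v], and otherwise the denominator
   of the sectional curvature is the product of the squared lengths of [w] and [v]. *)
pose c := inner h x u v / inner h x v v; pose w := u - c *: v.
have uE : u = w + c *: v by rewrite subrK.
have wv : inner h x w v = 0.
  rewrite /w -scaleNr innerDl innerZl /c mulNr divfK ?subrr //.
  by rewrite gt_eqF.
have [w0|w0] := eqVneq w 0.
  by rewrite uE w0 add0r quad_formZ1 quad_form_antisym ?mulr0.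
have ww := inner_gt0 Ux w0.
have uv : inner h x u v = c * inner h x v v.
  by rewrite uE innerDl innerZl wv add0r.
have uu : inner h x u u = inner h x w w + c * (c * inner h x v v).
  rewrite {1}uE innerDl innerZl (innerC v u Ux) uv; congr (_ + _).
  by rewrite (innerC w u Ux) uE innerDl innerZl (innerC v w Ux) wv mulr0 addr0.
have D0 : inner h x u u * inner h x v v - inner h x u v ^+ 2 != 0.
  rewrite uu uv gt_eqF //.
  have -> : (inner h x w w + c * (c * inner h x v v)) * inner h x v v
    - (c * inner h x v v) ^+ 2 = inner h x w w * inner h x v v by ring.
  exact: mulr_gt0.
have rk : \rank (col_mx u v) = 2%N.
  apply/eqP; rewrite -[_ == _]/(row_free (col_mx u v)).
  apply: inj_row_free => z; rewrite -[z]hsubmxK mul_row_col.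
  move: (lsubmx z) (rsubmx z) => p q.
  rewrite (mx11_scalar p) (mx11_scalar q) !mul_scalar_mx.
  move: (p 0 0) (q 0 0) => {p q} p q; rewrite uE scalerDr scalerA -addrA -scalerDl.
  move=> e; have := congr1 (fun y => inner h x y v) e.
  rewrite innerDl !innerZl wv mulr0 add0r {2}/inner !mul0mx mxE.
  rewrite -[RHS](mul0r (inner h x v v)); move/(mulIf (lt0r_neq0 vv)) => e0; move: e; rewrite e0 scale0r addr0.
  move/eqP; rewrite scaler_eq0 (negPf w0) orbF => /eqP p0.
  move: e0; rewrite p0 mul0r add0r => ->.
  by rewrite raddf0 row_mx0.
have := ch x Ux u v rk; rewrite /sectional => /(canRL (divfK D0)).
rewrite -/(quad_form (fun i j k l => riem h i j k l x) u v u v) => E.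
have := quad_form_metric x u v kappa; rewrite (innerC v u Ux) -expr2 -E => {}E.
by rewrite quad_formB E subrr.
Qed.

End ConstantCurvature.

(** * Composition and the chain rule *)

Section Composition.
Variable R : realType.

Lemma differentiable_mx (V : normedModType R) p q (M : V -> 'M[R]_(p, q)) x :
  (forall a b, differentiable (fun y => M y a b : R^o) x) -> differentiable M x.
Proof.
move=> dM.
have -> : M = \sum_a \sum_b (fun y => M y a b *: delta_mx a b).
  apply/funext => y; rewrite [LHS]matrix_sum_delta fct_sumE; apply: eq_bigr => a _.
  by rewrite fct_sumE.
apply: differentiable_sum => a; apply: differentiable_sum => b.
by apply: (@differentiableZl _ _ _ (fun y => M y a b)); apply: dM.
Qed.

Lemma differentiable_entry (V : normedModType R) p q (M : V -> 'M[R]_(p, q)) x a b :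
  differentiable M x -> differentiable (fun y => M y a b : R^o) x.
Proof.
move=> dM; apply: (@differentiable_comp _ _ _ _ M (fun N => N a b : R^o)) => //.
exact: differentiable_coord.
Qed.

Lemma derive_entry (V : normedModType R) p q (M : V -> 'M[R]_(p, q)) x v a b :
  differentiable M x -> 'D_v M x a b = 'D_v (fun y => M y a b : R^o) x.
Proof. by move=> dM; rewrite derive_mx ?mxE //; apply: diff_derivable. Qed.

Lemma smooth_mxP n (U : set 'rV[R]_n) p q (M : 'rV[R]_n -> 'M[R]_(p, q)) :
  open U -> smooth U M <-> msmooth U M.
Proof.
move=> oU; split=> [sM a b k|sM k].
  elim: k M sM => [|k IH] M sM /=.
    move=> x Ux; apply: differentiable_continuous; apply: differentiable_entry.
    exact: smooth_differentiable Ux.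
  split=> [x Ux|v].
    by apply: differentiable_entry; apply: smooth_differentiable Ux.
  apply: (Ck_ext oU) (IH _ (smooth_derive v sM)) => y Uy.
  by rewrite derive_entry //; apply: smooth_differentiable Uy.
have dM x : U x -> differentiable M x.
  by move=> Ux; apply: differentiable_mx => a b; apply: smooth_differentiable Ux.
elim: k M sM dM => [|k IH] M sM dM /=.
  by move=> x Ux; apply: differentiable_continuous; apply: dM.
split=> [x Ux|v]; first exact: dM.
have s' a b : smooth U (fun y => ('D_v M y) a b : R^o).
  apply: (smooth_ext oU) (smooth_derive v (sM a b)) => y Uy.
  by rewrite derive_entry //; apply: dM.
apply: IH => // x Ux; apply: differentiable_mx => a b.
exact: smooth_differentiable Ux.
Qed.

Variables (n m : nat) (U : set 'rV[R]_n) (V : set 'rV[R]_m).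
Variable (psi : 'rV[R]_n -> 'rV[R]_m).
Hypotheses (oU : open U) (spsi : msmooth U psi).
Hypothesis UV : forall x, U x -> V (psi x).

Lemma differentiable_psi x : U x -> differentiable psi x.
Proof.
by move=> Ux; apply: differentiable_mx => a b; apply: smooth_differentiable Ux.
Qed.

Lemma chain_rule (F : 'rV[R]_m -> R^o) x v : U x -> smooth V F ->
  'D_v (fun y => F (psi y) : R^o) x
  = \sum_b pd b F (psi x) * 'D_v (fun y => psi y 0 b : R^o) x.
Proof.
move=> Ux sF; have dF : differentiable F (psi x).
  by apply: smooth_differentiable sF _; apply: UV.
have dp := differentiable_psi Ux.
have dc : differentiable (F \o psi) x by apply: differentiable_comp.
rewrite -[LHS]/('D_v (F \o psi) x) deriveE // diff_comp //=.
rewrite -(deriveE v dp) -(deriveE _ dF) derive_pd //; apply: eq_bigr => b _.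
by rewrite derive_entry // mulrC.
Qed.

Lemma smooth_comp (F : 'rV[R]_m -> R^o) : smooth V F ->
  smooth U (fun y => F (psi y) : R^o).
Proof.
move=> + k; elim: k F => [|k IH] F sF /=.
  move=> x Ux; apply: (@continuous_comp _ _ _ psi F).
    by apply: differentiable_continuous; apply: differentiable_psi.
  by apply: smooth_continuous sF _; apply: UV.
split=> [x Ux|v].
  apply: (@differentiable_comp _ _ _ _ psi F); first exact: differentiable_psi.
  by apply: smooth_differentiable sF _; apply: UV.
apply: (@Ck_ext _ _ _ oU _ _ (fun x => \sum_b pd b F (psi x)
   * 'D_v (fun y => psi y 0 b : R^o) x : R^o)).
  by move=> y Uy; rewrite chain_rule.
apply: Ck_sum => // b; apply: CkM => //.
  exact: IH _ (smooth_pd b sF).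
exact: (smooth_derive v (spsi 0 b)).
Qed.

Lemma msmooth_comp p q (F : 'rV[R]_m -> 'M[R]_(p, q)) : msmooth V F ->
  msmooth U (fun y => F (psi y)).
Proof. by move=> sF a b; exact: (@smooth_comp (fun z => F z a b : R^o) (sF a b)). Qed.

Lemma mpd_comp p q i (F : 'rV[R]_m -> 'M[R]_(p, q)) x : U x -> msmooth V F ->
  mpd i (fun y => F (psi y)) x
  = \sum_b pd i (fun y => psi y 0 b) x *: mpd b F (psi x).
Proof.
move=> Ux sF; apply/matrixP => a b; rewrite summxE mpdE.
rewrite -[LHS]/('D_(delta_mx 0 i) (fun y => F (psi y) a b : R^o) x).
rewrite (@chain_rule (fun z => F z a b : R^o)) //; apply: eq_bigr => c _.
by rewrite mxE mpdE mulrC.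
Qed.

End Composition.

(** * Products of a line and a space form *)

(** Naturality of curvature under pull-back. [u] and [v] stand for two rows of the Jacobian of
    [psi], [w] for the mixed second derivatives of [psi], which drop out, and [D c b] for the
    derivative of [G b] in direction c. *)
Lemma pullback_curvature_algebra (R : comNzRingType) m p (u v w : 'I_m -> R)
    (G : 'I_m -> 'M[R]_p) (D : 'I_m -> 'I_m -> 'M[R]_p) :
  \sum_b (w b *: G b + v b *: \sum_c u c *: D c b)
  - \sum_b (w b *: G b + u b *: \sum_c v c *: D c b)
  + ((\sum_b v b *: G b) *m (\sum_c u c *: G c)
     - (\sum_c u c *: G c) *m (\sum_b v b *: G b))
  = \sum_c \sum_b (u c * v b) *: (D c b - D b c + (G b *m G c - G c *m G b)).
Proof.
have prod (s t : 'I_m -> R) : (\sum_b s b *: G b) *m (\sum_c t c *: G c)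
    = \sum_b \sum_c (s b * t c) *: (G b *m G c).
  rewrite mulmx_suml; apply: eq_bigr => b _; rewrite mulmx_sumr.
  by apply: eq_bigr => c _; rewrite -scalemxAl -scalemxAr scalerA.
have dbl (s t : 'I_m -> R) : \sum_b (w b *: G b + s b *: \sum_c t c *: D c b)
    = \sum_b w b *: G b + \sum_c \sum_b (t c * s b) *: D c b.
  rewrite big_split /= exchange_big; congr (_ + _); apply: eq_bigr => b _.
  by rewrite scaler_sumr; apply: eq_bigr => c _; rewrite scalerA mulrC.
rewrite !prod !dbl opprD [X in X + _]addrACA subrr add0r.
rewrite [X in _ - X + _]exchange_big [X in _ + (X - _)]exchange_big /=.
rewrite -!sumrB -big_split; apply: eq_bigr => c _ /=.
rewrite -!sumrB -big_split; apply: eq_bigr => b _ /=.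
by rewrite (mulrC (v b)) -!scalerBr -scalerDr.
Qed.

(** Leibniz rule for the product metric: if [C] sends [al] to its derivative and acts on [P] through
    a connection [w] for which the derivative of [H] is w H + H w^T, then [C] preserves [g]. *)
Lemma frame_connection_metric (R : comNzRingType) n m (al dal : 'cV[R]_n)
    (P dP : 'M[R]_(n, m)) (H w : 'M[R]_m) (C g : 'M[R]_n) :
  H^T = H -> g = al *m al^T + P *m H *m P^T ->
  C *m al = dal -> C *m P = dP + P *m w ->
  dal *m al^T + al *m dal^T
    + ((dP *m H + P *m (w *m H + H *m w^T)) *m P^T + P *m H *m dP^T)
  = C *m g + g *m C^T.
Proof.
move=> HT gE Ca CP.
have Cg : C *m g = dal *m al^T + (dP *m H *m P^T + P *m w *m H *m P^T).
  by rewrite gE mulmxDr !mulmxA Ca CP !mulmxDl.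
have gT : g^T = g by rewrite gE linearD /= !trmx_mul !trmxK HT !mulmxA.
have -> : g *m C^T = (C *m g)^T by rewrite trmx_mul gT.
rewrite Cg !linearD /= !trmx_mul !trmxK HT !mulmxA.
rewrite ?mulmxDr ?mulmxDl ?mulmxA -?addrA; congr (_ + _).
move: (al *m _) (dP *m _ *m _) (P *m w *m _ *m _) (P *m H *m w^T *m _).
move: (P *m H *m dP^T) => a b c d e.
by apply/matrixP => i j; rewrite !mxE; ring.
Qed.

Section LineTimesSpaceForm.
Variables (R : realType) (m : nat).
Local Notation n := (1 + m)%N.
Variables (U : set 'rV[R]_n) (g : metric_field R n).
Variables (V : set 'rV[R]_m) (h : metric_field R m).
Variables (f : 'rV[R]_n -> R^o) (psi : 'rV[R]_n -> 'rV[R]_m) (kappa : R).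
Hypotheses (oU : open U) (rg : riemannian U g).
Hypotheses (oV : open V) (rh : riemannian V h).
Hypothesis ch : const_sectional kappa V h.
Hypotheses (sf : smooth U f) (spsi : msmooth U psi).
Hypothesis UV : forall x, U x -> V (psi x).

Definition dline x : 'cV[R]_n := \col_i pd i f x.
Definition dpsi x : 'M[R]_(n, m) := \matrix_(i, b) pd i (fun y => psi y 0 b) x.

Hypothesis isom : forall x, U x ->
  g x = dline x *m (dline x)^T + dpsi x *m h (psi x) *m (dpsi x)^T.

Definition frame x : 'M[R]_n := row_mx (dline x) (dpsi x).
(** The Levi-Civita connection of [h] pulled back along [psi]. *)
Definition pull_om i x : 'M[R]_m := \sum_b dpsi x i b *: Gam h b (psi x).

Lemma smooth_dline : msmooth U dline.
Proof.
move=> i j; apply: (smooth_ext oU) (smooth_pd i sf) => y _.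
by rewrite mxE.
Qed.

Lemma smooth_dpsi : msmooth U dpsi.
Proof.
move=> i j; apply: (smooth_ext oU) (smooth_pd i (spsi 0 j)) => y _.
by rewrite mxE.
Qed.

Lemma smooth_pull_om i : msmooth U (pull_om i).
Proof.
apply: msmooth_sum => // b; apply: msmoothZ => //; first exact: smooth_dpsi.
exact: (msmooth_comp oU spsi UV (msmooth_Gam oV rh b)).
Qed.

Lemma frame_metric x : U x ->
  g x = frame x *m block_mx 1%:M 0 0 (h (psi x)) *m (frame x)^T.
Proof.
move=> Ux; rewrite isom // /frame tr_row_mx mul_row_block mul_row_col.
by rewrite !mulmx0 add0r addr0 mulmx1.
Qed.

Lemma frame_unit x : U x -> frame x \in unitmx.
Proof.
move=> Ux; have := riemannian_unit rg Ux; rewrite frame_metric //.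
by rewrite -!mulmxA unitmx_mul => /andP[].
Qed.

(** The candidate for the Levi-Civita connection of [g]: it is solved for from the requirements that
    the differential of [f] be parallel and that [dpsi] intertwine it with the pulled-back
    connection. *)
Definition connection i x : 'M[R]_n :=
  row_mx (mpd i dline x) (mpd i dpsi x + dpsi x *m pull_om i x)
  *m invmx (frame x).

(** The candidate is metric by [frame_connection_metric]; it is torsion-free because the Hessians of
    [f] and [psi] and the Christoffel symbols of [h] are symmetric. Uniqueness does the rest. *)
Lemma Gam_frame i x : U x ->
  Gam g i x *m frame x
  = row_mx (mpd i dline x) (mpd i dpsi x + dpsi x *m pull_om i x).
Proof.
move=> Ux; have uF := frame_unit Ux.
suff -> : Gam g i x = connection i x by rewrite /connection mulmxKV.
have CF a : connection a x *m dline x = mpd a dline x /\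
    connection a x *m dpsi x = mpd a dpsi x + dpsi x *m pull_om a x.
  have : connection a x *m frame x
      = row_mx (mpd a dline x) (mpd a dpsi x + dpsi x *m pull_om a x).
    by rewrite /connection mulmxKV.
  by rewrite /frame mul_mx_row => /eq_row_mx.
have sa := smooth_dline; have sp := smooth_dpsi.
have sh : msmooth U (fun y => h (psi y)).
  exact: (msmooth_comp oU spsi UV (riemannian_smooth rh)).
have dh a : mpd a (fun y => h (psi y)) x
    = pull_om a x *m h (psi x) + h (psi x) *m (pull_om a x)^T.
  rewrite (mpd_comp spsi UV a Ux (riemannian_smooth rh)).
  rewrite /pull_om linear_sum mulmx_suml mulmx_sumr -big_split.
  apply: eq_bigr => b _ /=; rewrite (Gam_metric oV rh b (UV Ux)) scalerDr.
  by rewrite linearZ /= -scalemxAl -scalemxAr mxE.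
apply: (Gam_unique (C := fun i => connection i x)).
- exact: riemannian_sym rg _ Ux.
- exact: riemannian_unit rg _ Ux.
- move=> a; have [C1 C2] := CF a.
  rewrite -(frame_connection_metric (riemannian_sym rh (UV Ux)) (isom Ux) C1 C2).
  rewrite (eq_on_mpd oU a isom Ux) -dh.
  have sPh := msmoothM oU sp sh; have saT := msmooth_tr oU sa.
  have spT := msmooth_tr oU sp.
  rewrite (mpdD oU a (msmoothM oU sa saT) (msmoothM oU sPh spT) Ux).
  rewrite (mpdM oU a sa saT Ux) (mpdM oU a sPh spT Ux) (mpdM oU a sp sh Ux).
  by rewrite !mpd_tr.
- have swap1 a b : row b (mpd a dline x) = row a (mpd b dline x).
    have E u v c : row v (mpd u dline x) 0 c = pd u (pd v f) x.
      rewrite mxE mpdE; apply: (eq_on_pd oU) Ux => y _.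
      by rewrite mxE.
    apply/rowP => c; apply: etrans (E a b c) _; apply: etrans _ (esym (E b a c)).
    exact: (pdC oU a b sf Ux).
  have swap2 a b : row b (mpd a dpsi x + dpsi x *m pull_om a x)
      = row a (mpd b dpsi x + dpsi x *m pull_om b x).
    have E u v c : row v (mpd u dpsi x + dpsi x *m pull_om u x) 0 c
      = pd u (pd v (fun y => psi y 0 c)) x
        + \sum_d \sum_e dpsi x u e * dpsi x v d * Gam h e (psi x) d c.
      rewrite mxE mxE mpdE; congr (_ + _).
        by apply: (eq_on_pd oU) Ux => y _; rewrite mxE.
      rewrite mxE; apply: eq_bigr => d _; rewrite summxE mulr_sumr.
      by apply: eq_bigr => e _; rewrite [X in _ * X]mxE mulrCA mulrA.
    apply/rowP => c; apply: etrans (E a b c) _; apply: etrans _ (esym (E b a c)).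
    apply: (f_equal2 (@GRing.add R)); first exact: (pdC oU a b (spsi 0 c) Ux).
    rewrite exchange_big /=; apply: eq_bigr => d _; apply: eq_bigr => e _.
    by rewrite (Gam_sym oV rh d e c (UV Ux)) (mulrC (dpsi x a d)).
  move=> a b c; have rE (M : 'M[R]_n) u v : M u v = row u M 0 v by rewrite mxE.
  by rewrite rE [RHS]rE /connection !row_mul !row_row_mx swap1 swap2.
Qed.

Lemma Gam_dline i x : U x -> Gam g i x *m dline x = mpd i dline x.
Proof. by move=> /(Gam_frame i); rewrite mul_mx_row => /eq_row_mx[]. Qed.

Lemma Gam_dpsi i x : U x ->
  Gam g i x *m dpsi x = mpd i dpsi x + dpsi x *m pull_om i x.
Proof. by move=> /(Gam_frame i); rewrite mul_mx_row => /eq_row_mx[]. Qed.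

(** [dline] is a bundle map to the trivial line bundle with the zero connection, whose curvature
    vanishes. *)
Lemma Curv_dline i j x : U x -> Curv g i j x *m dline x = 0.
Proof.
move=> Ux.
rewrite (Curv_solder (om := fun _ _ => 0) oU rg smooth_dline
  (fun _ => msmooth_cst oU 0) _ Ux); last first.
  by move=> k y Uy; rewrite mulmx0 addr0 Gam_dline.
by rewrite !mpd_cst !mulmx0 !subr0 addr0 mulmx0.
Qed.

Lemma mpd_pull_om i j x : U x -> mpd i (pull_om j) x =
  \sum_b (pd i (pd j (fun y => psi y 0 b)) x *: Gam h b (psi x)
          + dpsi x j b *: \sum_c dpsi x i c *: mpd c (Gam h b) (psi x)).
Proof.
move=> Ux; have sG b := msmooth_Gam oV rh b.
have sGp b := msmooth_comp oU spsi UV (sG b).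
have sd b : smooth U (fun y => dpsi y j b : R^o) by exact: smooth_dpsi.
rewrite (@mpd_sum _ _ _ oU _ _ i _ _
  (fun b y => dpsi y j b *: Gam h b (psi y)) x _ Ux); last first.
  by move=> b; apply: msmoothZ.
apply: eq_bigr => b _; rewrite (mpdZ oU i (sd b) (sGp b) Ux).
apply: (f_equal2 (@GRing.add _)).
  apply: (f_equal2 (@GRing.scale _ _)) => //.
  by apply: (eq_on_pd oU) Ux => y _; rewrite mxE.
apply: (f_equal2 (@GRing.scale _ _)) => //.
rewrite (mpd_comp spsi UV i Ux (sG b)); apply: eq_bigr => c _.
by apply: (f_equal2 (@GRing.scale _ _)) => //; rewrite mxE.
Qed.

Lemma Curv_dpsi i j x : U x -> Curv g i j x *m dpsi x =
  dpsi x *m \sum_c \sum_b (dpsi x i c * dpsi x j b) *: Curv h c b (psi x).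
Proof.
move=> Ux; rewrite (Curv_solder oU rg smooth_dpsi smooth_pull_om _ Ux).
  apply: (f_equal2 (@mulmx _ _ _ _)) => //.
  rewrite (mpd_pull_om i j Ux) (mpd_pull_om j i Ux).
  have -> : \sum_b (pd j (pd i (fun y => psi y 0 b)) x *: Gam h b (psi x)
      + dpsi x i b *: \sum_c dpsi x j c *: mpd c (Gam h b) (psi x))
    = \sum_b (pd i (pd j (fun y => psi y 0 b)) x *: Gam h b (psi x)
      + dpsi x i b *: \sum_c dpsi x j c *: mpd c (Gam h b) (psi x)).
    apply: eq_bigr => b _; apply: (congr1 (fun z => z *: _ + _)).
    exact: (pdC oU j i (spsi 0 b) Ux).
  rewrite /pull_om pullback_curvature_algebra.
  apply: eq_bigr => c _; apply: eq_bigr => b _.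
  by rewrite CurvE.
by move=> k y Uy; rewrite Gam_dpsi.
Qed.

(* The metric of the space form factor, seen as a degenerate form on the
   product. *)
Definition factor_metric x : 'M[R]_n := dpsi x *m h (psi x) *m (dpsi x)^T.

(** Writing [g] as the sum of its two factors, the line contributes nothing, and on the other factor
    the pulled-back curvature of [h] has the constant curvature form. *)
Lemma riem_product i j k l x : U x -> riem g i j k l x =
  kappa * (factor_metric x i k * factor_metric x j l
           - factor_metric x i l * factor_metric x j k).
Proof.
move=> Ux; rewrite riemE isom // mulmxDr !mulmxA Curv_dline // mul0mx add0r.
rewrite Curv_dpsi // -/(factor_metric x) -(mulmxA (dpsi x)) mulmx_suml.
have Vx := UV Ux; set P := dpsi x; set H := h (psi x).
pose B := P *m H.
have HT : H^T = H := riemannian_sym rh Vx.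
have E : \sum_c (\sum_b (P i c * P j b) *: Curv h c b (psi x)) *m H
    = kappa *: ((row j B)^T *m row i B - (row i B)^T *m row j B).
  apply/matrixP => q p.
  have -> : (kappa *: ((row j B)^T *m row i B - (row i B)^T *m row j B)) q p
      = kappa * (B j q * B i p - B i q * B j p).
    by rewrite !mxE !big_ord1 !mxE.
  have BE a b : B a b = \sum_c P a c * H c b by rewrite mxE.
  rewrite !BE !big_distrlr /= mulrBr [X in kappa * X - _]exchange_big.
  rewrite !mulr_sumr -sumrB summxE; apply: eq_bigr => c _.
  rewrite mulmx_suml summxE !mulr_sumr -sumrB; apply: eq_bigr => b _ /=.
  rewrite -scalemxAl mxE -riemE (const_sectional_riem oV rh ch Vx) -/H.
  by ring.
rewrite E /factor_metric -/B; clear E.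
have SE a b : (B *m P^T) a b = (P *m (row a B)^T) b 0.
  by rewrite !mxE; apply: eq_bigr => c _; rewrite !mxE mulrC.
have -> : P *m (kappa *: ((row j B)^T *m row i B - (row i B)^T *m row j B)) *m P^T
   = kappa *: ((P *m (row j B)^T) *m (P *m (row i B)^T)^T
               - (P *m (row i B)^T) *m (P *m (row j B)^T)^T).
  rewrite -scalemxAr -scalemxAl mulmxBr mulmxBl !trmx_mul !trmxK.
  by rewrite !mulmxA.
rewrite (SE i k) (SE j l) (SE i l) (SE j k).
move: (P *m (row i B)^T) (P *m (row j B)^T) => a b.
by rewrite !mxE !big_ord1 !mxE; ring.
Qed.

End LineTimesSpaceForm.

(** * Ricci tensor of a line times a space form *)

Section ProductRicci.
Variables (R : realType) (n m : nat).
Variables (U : set 'rV[R]_n) (g : metric_field R n).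
Variables (al : 'rV[R]_n -> 'cV[R]_n) (S : 'rV[R]_n -> 'M[R]_n) (kappa : R).
Hypotheses (oU : open U) (rg : riemannian U g) (sal : msmooth U al).
Hypothesis gE : forall x, U x -> g x = al x *m (al x)^T + S x.
Hypothesis par : forall i x, U x -> mpd i al x = Gam g i x *m al x.
Hypothesis riemS : forall x, U x -> forall i j k l, riem g i j k l x
  = kappa * (S x i k * S x j l - S x i l * S x j k).
Hypothesis dual : forall x, U x ->
  exists p : 'rV[R]_n, p *m al x = 1%:M /\ p *m S x = 0.
Hypothesis nE : n = m.+1.

Lemma contract_riem (A M : 'M[R]_n) (r : R) i j :
  \sum_k \sum_l r * (A i j * A k l - A i l * A k j) * M k l
  = r * (A i j * \tr (A *m M^T) - (A *m M^T *m A) i j).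
Proof.
have -> : \tr (A *m M^T) = \sum_k \sum_l A k l * M k l.
  by apply: eq_bigr => k _; rewrite mxE; apply: eq_bigr => l _; rewrite mxE.
have -> : (A *m M^T *m A) i j = \sum_k \sum_l A i l * M k l * A k j.
  rewrite mxE; apply: eq_bigr => k _; rewrite mxE mulr_suml.
  by apply: eq_bigr => l _; rewrite mxE.
rewrite mulr_sumr -sumrB mulr_sumr; apply: eq_bigr => k _.
rewrite mulr_sumr -sumrB mulr_sumr; apply: eq_bigr => l _.
by ring.
Qed.

(** With [p] dual to [al], the matrix [S x *m G] is the projection 1 - al p of corank one; hence S G
    S = S, and its trace is n - 1 = m. *)
Lemma factor_facts x : U x -> let G := invmx (g x) in
  [/\ G^T = G, S x *m G *m S x = S x & \tr (S x *m G) = m%:R].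
Proof.
move=> Ux G; have gT := riemannian_sym rg Ux; have gu := riemannian_unit rg Ux.
have [p [pa pS]] := dual Ux.
have pg : p *m g x = (al x)^T by rewrite gE // mulmxDr mulmxA pa mul1mx pS addr0.
have aG : (al x)^T *m G = p by rewrite -pg mulmxK.
have SE : S x = g x - al x *m (al x)^T by rewrite gE // addrC addKr.
have SG : S x *m G = 1%:M - al x *m p.
  by rewrite SE mulmxBl mulmxV // -mulmxA aG.
split.
- by rewrite trmx_inv gT.
- by rewrite SG mulmxBl mul1mx -mulmxA pS mulmx0 subr0.
- rewrite SG linearB /= mxtrace1 mxtrace_mulC pa mxtrace1 {1}nE.
  by rewrite -addn1 natrD addrK.
Qed.

Lemma ricci_S i j x : U x -> ricci g i j x = kappa * (m%:R - 1) * S x i j.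
Proof.
move=> Ux; have [GT SGS trS] := factor_facts Ux.
transitivity (\sum_k \sum_l kappa * (S x i j * S x k l - S x i l * S x k j)
  * invmx (g x) k l).
  by apply: eq_bigr => k _; apply: eq_bigr => l _; rewrite riemS.
by rewrite contract_riem GT trS SGS; ring.
Qed.

Lemma ricci_up_S k l x : U x ->
  ricci_up g k l x
  = kappa * (m%:R - 1) * (invmx (g x) *m S x *m invmx (g x)) k l.
Proof.
move=> Ux; have [GT SGS trS] := factor_facts Ux.
have Gs a b : invmx (g x) a b = invmx (g x) b a by rewrite -[in LHS]GT mxE.
rewrite mxE mulr_sumr /ricci_up exchange_big; apply: eq_bigr => b _.
rewrite mxE mulr_suml mulr_sumr; apply: eq_bigr => a _.
by rewrite ricci_S // /ginv (Gs l b); ring.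
Qed.

Lemma scal_S x : U x -> scal g x = kappa * (m%:R - 1) * m%:R.
Proof.
move=> Ux; have [GT SGS trS] := factor_facts Ux.
rewrite -[X in _ = _ * X]trS mulr_sumr; apply: eq_bigr => i _.
rewrite mxE mulr_sumr; apply: eq_bigr => j _.
rewrite ricci_S // /ginv.
have -> : invmx (g x) i j = invmx (g x) j i by rewrite -[in LHS]GT mxE.
by ring.
Qed.

Lemma ricci_norm2_S x : U x ->
  ricci_norm2 g x = (kappa * (m%:R - 1)) ^+ 2 * m%:R.
Proof.
move=> Ux; have [GT SGS trS] := factor_facts Ux.
have ST : (S x)^T = S x.
  have -> : S x = g x - al x *m (al x)^T by rewrite gE // addrC addKr.
  by rewrite linearB /= (riemannian_sym rg Ux) trmx_mul trmxK.
have mE : m%:R = \tr (S x *m (invmx (g x) *m S x *m invmx (g x))^T).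
  by rewrite !trmx_mul GT ST !mulmxA SGS trS.
rewrite [X in _ = _ * X]mE.
rewrite mulr_sumr; apply: eq_bigr => i _.
rewrite mxE mulr_sumr; apply: eq_bigr => j _.
rewrite ricci_S // ricci_up_S // [X in _ = _ * (_ * X)]mxE.
by ring.
Qed.

Lemma riem_ricci_S i j x : U x ->
  riem_ricci g i j x = kappa ^+ 2 * (m%:R - 1) ^+ 2 * S x i j.
Proof.
move=> Ux; have [GT SGS trS] := factor_facts Ux.
have ST : (S x)^T = S x.
  have -> : S x = g x - al x *m (al x)^T by rewrite gE // addrC addKr.
  by rewrite linearB /= (riemannian_sym rg Ux) trmx_mul trmxK.
transitivity (kappa * (m%:R - 1) *
  \sum_k \sum_l kappa * (S x i j * S x k l - S x i l * S x k j)
  * (invmx (g x) *m S x *m invmx (g x)) k l).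
  rewrite mulr_sumr; apply: eq_bigr => k _; rewrite mulr_sumr.
  by apply: eq_bigr => l _; rewrite riemS // ricci_up_S //; ring.
rewrite contract_riem !trmx_mul GT ST !mulmxA SGS trS SGS.
by ring.
Qed.

(** The Ricci tensor is a constant times [S], and [S] is parallel because [g] and [al] are. *)
Lemma nabla_ricci_S k i j x : U x -> nabla_ricci g k i j x = 0.
Proof.
move=> Ux; rewrite /nabla_ricci.
pose c := kappa * (m%:R - 1).
have sS : msmooth U (fun y => S y).
  have saa := msmoothM oU sal (msmooth_tr oU sal).
  apply: (msmooth_ext oU) (msmoothD oU (riemannian_smooth rg) (msmoothN oU saa)).
  by move=> y Uy; rewrite gE // addrC addKr.
have -> : pd k (ricci g i j) x = c * mpd k S x i j.
  rewrite (eq_on_pd oU k (h := fun y => c * S y i j) _ Ux); last first.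
    by move=> y Uy; rewrite ricci_S.
  have sc : smooth U (fun=> c : R^o) by exact: smooth_cst.
  by rewrite (pdM k sc (sS i j) Ux) pd_cst mul0r add0r mpdE.
have -> : mpd k S x = Gam g k x *m S x + S x *m (Gam g k x)^T.
  have := eq_on_mpd oU k gE Ux.
  have saT := msmooth_tr oU sal.
  rewrite (mpdD oU k (msmoothM oU sal saT) sS Ux) (mpdM oU k sal saT Ux) mpd_tr.
  rewrite (Gam_metric oU rg k Ux) par // gE // mulmxDr mulmxDl trmx_mul !mulmxA.
  rewrite addrACA; move/addrI => <-.
  by [].
rewrite 2!mxE [X in _ * (_ + X)]mxE -big_split mulr_sumr -sumrB big1 // => a _.
rewrite -!GamijkE !ricci_S //= -/c [(Gam g k x)^T a j]mxE.
by ring.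
Qed.

Lemma laplace_ricci_S i j x : U x -> laplace_ricci g i j x = 0.
Proof.
move=> Ux; rewrite /laplace_ricci big1 // => l _; rewrite big1 // => k _.
suff -> : nabla2_ricci g l k i j x = 0 by rewrite mulr0.
rewrite /nabla2_ricci (eq_on_pd oU (h := fun=> 0) l _ Ux); last first.
  by move=> y Uy; rewrite nabla_ricci_S.
rewrite pd_cst big1 ?subr0 // => a _.
by rewrite !nabla_ricci_S // !mulr0 !addr0.
Qed.

End ProductRicci.

Lemma riemannian_sub (R : realType) n (U W : set 'rV[R]_n) (g : metric_field R n) :
  open U -> W `<=` U -> riemannian U g -> riemannian W g.
Proof.
move=> oU WU [sg gT gpos]; split=> [i j|x Wx|x Wx]; last 2 first.
- by apply: gT; apply: WU.
- by apply: gpos; apply: WU.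
by apply: (smooth_sub WU); apply: sg.
Qed.

Lemma inner_line_prod (R : realType) (h : metric_field R 3) (y : 'rV[R]_4)
    (a b : 'M[R]_1) (u v : 'rV[R]_3) :
  inner (line_prod_metric h) y (row_mx a u : 'rV_(1 + 3)) (row_mx b v : 'rV_(1 + 3))
  = (a *m b^T + u *m h (rsubmx (y : 'rV_(1 + 3))) *m v^T) 0 0.
Proof.
rewrite /inner /line_prod_metric.
transitivity ((row_mx a u *m block_mx 1%:M 0 0 (h (rsubmx (y : 'rV_(1 + 3))))
  *m (row_mx b v)^T) 0 0); first by [].
rewrite tr_row_mx mul_row_block mul_row_col.
by rewrite !mulmx0 add0r addr0 mulmx1.
Qed.

Section LocalProduct.
Variables (R : realType) (U : set 'rV[R]_4) (g : metric_field R 4) (kappa : R).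
Hypotheses (oU : open U) (rg : riemannian U g).
Hypothesis lp : locally_line_times_space_form kappa U g.

(** The isometry is split into its line coordinate [f] and its other coordinates [psi], which gives
    [g] the form treated above without inverting the map. The constants are kappa (m - 1) m and
    kappa^2 (m - 1)^2 m for m = 3. *)
Lemma local_product_tensors x : U x ->
  [/\ scal g x = 6 * kappa, ricci_norm2 g x = 12 * kappa ^+ 2 &
    forall i j, laplace_ricci g i j x = 0 /\
      riem_ricci g i j x = 2 * kappa * ricci g i j x].
Proof.
move=> Ux; case: lp => V [h [oV rh ch loc]].
have [W [phi [[oW Wx WU] sphi _ phiV isom]]] := loc x Ux.
have rgW := riemannian_sub oU WU rg.
have /(smooth_mxP _ oW) msphi := sphi.
pose f (y : 'rV[R]_4) : R^o := (phi y : 'rV_(1 + 3)) 0 (lshift 3 0).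
pose psi (y : 'rV[R]_4) := rsubmx (phi y : 'rV_(1 + 3)).
have sf : smooth W f by exact: msphi.
have spsi : msmooth W psi.
  move=> a b; apply: (smooth_ext oW) (msphi a (rshift 1 b)) => y _.
  by rewrite /psi mxE.
have WV y : W y -> V (psi y) by exact: phiV.
have isom' y : W y -> g y = dline (m := 3) f y *m (dline (m := 3) f y)^T
    + dpsi (m := 3) psi y *m h (psi y) *m (dpsi (m := 3) psi y)^T.
  move=> Wy; apply/matrixP => i j.
  have dE k : 'D_(delta_mx 0 k) phi y =
      row_mx (row k (dline (m := 3) f y)) (row k (dpsi (m := 3) psi y)) :> 'rV_(1 + 3).
    have dphi : differentiable phi y by exact: smooth_differentiable Wy.
    apply/rowP => c; rewrite (derive_entry _ _ _ dphi) -(fintype.splitK c).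
    case: (fintype.split c) => d /=; rewrite ?row_mxEl ?row_mxEr !mxE.
      by rewrite pdE (ord1 d).
    rewrite pdE; apply: (congr1 (fun F : 'rV[R]_4 -> R^o => 'D_(delta_mx 0 k) F y)).
    by apply/funext => z; rewrite /psi mxE.
  have := isom y Wy (delta_mx 0 i) (delta_mx 0 j).
  have -> : inner g y (delta_mx 0 i) (delta_mx 0 j) = g y i j.
    rewrite /inner trmx_delta -rowE mxE (bigD1 j) //= big1 => [|k kj].
      by rewrite !mxE !eqxx mulr1 addr0.
    by rewrite !mxE (negPf kj) mulr0.
  move=> <-; rewrite (dE i) (dE j) inner_line_prod -/(psi y).
  move: (dline (m := 3) f y) (dpsi (m := 3) psi y) (h (psi y)) => a P H.
  have tE p (A B : 'M[R]_(4, p)) : (row i A *m (row j B)^T) 0 0 = (A *m B^T) i j.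
    by rewrite !mxE; apply: eq_bigr => k _; rewrite !mxE.
  rewrite [LHS]mxE [RHS]mxE -(row_mul i P H).
  exact: (f_equal2 (@GRing.add R) (tE _ a a) (tE _ (P *m H) P)).
have Ud y : W y -> exists p : 'rV[R]_4, p *m dline (m := 3) f y = 1%:M /\
    p *m factor_metric (m := 3) h psi y = 0.
  move=> Wy; have uF := frame_unit (m := 3) rgW isom' Wy.
  (* The first row of the inverse frame pairs to 1 with [dline] and annihilates [dpsi]. *)
  pose q : 'M[R]_(1 + 3, 4) := invmx (frame (m := 3) f psi y).
  exists (usubmx q).
  have qF : q *m (frame (m := 3) f psi y : 'M[R]_(1 + 3)) = 1%:M by exact: mulVmx.
  have : block_mx (usubmx q *m dline (m := 3) f y) (usubmx q *m dpsi (m := 3) psi y)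
    (dsubmx q *m dline (m := 3) f y) (dsubmx q *m dpsi (m := 3) psi y)
    = block_mx 1%:M 0 0 1%:M.
    by rewrite -mul_col_row vsubmxK -scalar_mx_block -qF.
  by move/eq_block_mx => [-> e _ _]; rewrite /factor_metric !mulmxA e !mul0mx.
have par i y : W y -> mpd i (dline (m := 3) f) y = Gam g i y *m dline (m := 3) f y.
  by move=> Wy; rewrite (Gam_dline oW rgW oV rh sf spsi WV isom').
have gE y : W y -> g y = dline (m := 3) f y *m (dline (m := 3) f y)^T
    + factor_metric (m := 3) h psi y by exact: isom'.
have rS y : W y -> forall i j k l, riem g i j k l y
    = kappa * (factor_metric (m := 3) h psi y i k * factor_metric (m := 3) h psi y j l
    - factor_metric (m := 3) h psi y i l * factor_metric (m := 3) h psi y j k).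
  by move=> Wy i j k l; apply: (riem_product oW rgW oV rh ch sf spsi WV isom').
have sd := smooth_dline (m := 3) oW sf.
split.
- rewrite (scal_S (m := 3) rgW gE rS Ud erefl Wx); ring.
- rewrite (ricci_norm2_S (m := 3) rgW gE rS Ud erefl Wx); ring.
move=> i j; split.
  exact: (laplace_ricci_S (m := 3) oW rgW sd gE par rS Ud erefl i j Wx).
rewrite (riem_ricci_S (m := 3) rgW gE rS Ud erefl i j Wx).
rewrite (ricci_S (m := 3) rgW gE rS Ud erefl i j Wx); ring.
Qed.

End LocalProduct.

(** * Curvature in a left-invariant coframe *)

(** With [P] and [Q] the derivatives of [T] and [A], this says that the covariant derivative of T A
    T^T can be taken on the frame components [A], with the frame connection [O] in place of [G]. *)
Lemma conj_connection_algebra (R : comNzRingType) n (T P A Q O G : 'M[R]_n) :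
  G *m T = P + T *m O ->
  (P *m A + T *m Q) *m T^T + T *m A *m P^T
    - (G *m (T *m A *m T^T) + T *m A *m T^T *m G^T)
  = T *m (Q - (O *m A + A *m O^T)) *m T^T.
Proof.
move=> GT; rewrite -(mulmxA _ T^T) -trmx_mul !mulmxA !GT.
have -> : (P + T *m O)^T = P^T + O^T *m T^T by rewrite linearD /= trmx_mul.
rewrite !mulmxDl mulmxDr mulmxBr mulmxBl mulmxDr mulmxDl !mulmxA.
move: (P *m A *m T^T) (T *m Q *m T^T) (T *m A *m P^T) => a b c.
move: (T *m O *m A *m T^T) (T *m A *m O^T *m T^T) => d e.
by apply/matrixP => k l; rewrite !mxE; ring.
Qed.

Section ConstantConnection.
Variables (R : realType) (n : nat).
Variables (U : set 'rV[R]_n) (g : metric_field R n).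
Variables (Th : 'rV[R]_n -> 'M[R]_n) (W : 'I_n -> 'M[R]_n).
Hypotheses (oU : open U) (rg : riemannian U g) (sTh : msmooth U Th).
Hypothesis gTh : forall x, U x -> g x = Th x *m (Th x)^T.
Hypothesis Wskew : forall b, (W b)^T = - W b.
Hypothesis torsion : forall x, U x -> forall i j a,
  mpd i Th x j a - mpd j Th x i a
  = - \sum_b \sum_c Th x i b * Th x j c * (W b c a - W c b a).

(** The connection form in an orthonormal coframe [Th]; its coefficients [W] are constants, as
    happens for a left-invariant coframe. *)
Definition const_om i x : 'M[R]_n := \sum_b Th x i b *: W b.

Lemma smooth_const_om i : msmooth U (const_om i).
Proof.
by apply: msmooth_sum => // b; apply: msmoothZ => //; apply: msmooth_cst.
Qed.

Lemma const_om_skew i x : (const_om i x)^T = - const_om i x.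
Proof.
rewrite /const_om linear_sum -sumrN; apply: eq_bigr => b _ /=.
by rewrite linearZ /= Wskew scalerN.
Qed.

Lemma Th_unit x : U x -> Th x \in unitmx.
Proof.
move=> Ux; have := riemannian_unit rg Ux; rewrite gTh //.
by rewrite unitmx_mul => /andP[].
Qed.

Lemma Th_const_om i j a x : (Th x *m const_om i x) j a
  = \sum_b \sum_c Th x i b * Th x j c * W b c a.
Proof.
rewrite mxE exchange_big; apply: eq_bigr => c _; rewrite summxE mulr_sumr.
by apply: eq_bigr => b _; rewrite [X in _ * X]mxE mulrCA mulrA.
Qed.

(** Cartan's first structure equation: skewness of [W] makes the connection metric, and the
    hypothesis on the exterior derivative of [Th] makes it torsion-free. *)
Lemma Gam_Th i x : U x ->
  Gam g i x *m Th x = mpd i Th x + Th x *m const_om i x.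
Proof.
move=> Ux; have uT := Th_unit Ux.
pose C i := (mpd i Th x + Th x *m const_om i x) *m invmx (Th x).
suff -> : Gam g i x = C i by rewrite /C mulmxKV.
have CT k : C k *m Th x = mpd k Th x + Th x *m const_om k x by rewrite /C mulmxKV.
apply: (Gam_unique (C := C)).
- exact: riemannian_sym rg _ Ux.
- exact: riemannian_unit rg _ Ux.
- move=> k; have sT := msmooth_tr oU sTh.
  rewrite (eq_on_mpd oU k gTh Ux) (mpdM oU k sTh sT Ux) mpd_tr.
  have -> : g x *m (C k)^T = (C k *m g x)^T.
    by rewrite [RHS]trmx_mul (riemannian_sym rg Ux).
  rewrite gTh // mulmxA CT mulmxDl linearD /= !trmx_mul !trmxK const_om_skew.
  move: (mpd k Th x *m (Th x)^T) (Th x *m (mpd k Th x)^T) => P Q.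
  rewrite mulNmx mulmxN mulmxA.
  move: (Th x *m const_om k x *m _) => S.
  by apply/matrixP => a b; rewrite !mxE; ring.
- move=> a b c.
  suff sw : row b (mpd a Th x + Th x *m const_om a x)
      = row a (mpd b Th x + Th x *m const_om b x).
    have rE (M : 'M[R]_n) u v : M u v = row u M 0 v by rewrite mxE.
    by rewrite rE [RHS]rE /C !row_mul sw.
  apply/rowP => d.
  have E u v : row v (mpd u Th x + Th x *m const_om u x) 0 d
      = mpd u Th x v d + (Th x *m const_om u x) v d by rewrite mxE mxE.
  apply: etrans (E a b) _; apply: etrans _ (esym (E b a)).
  have tor := torsion Ux a b d.
  have -> : (Th x *m const_om b x) a d
      = \sum_e \sum_f Th x a e * Th x b f * W f e d.
    rewrite Th_const_om exchange_big; apply: eq_bigr => e _.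
    by apply: eq_bigr => f _; rewrite (mulrC (Th x b f)).
  rewrite Th_const_om.
  have {}tor := canRL (subrK _) tor; apply: etrans (f_equal2 +%R tor erefl) _.
  rewrite addrAC addrC -sumrN -big_split; apply: (f_equal2 +%R erefl).
  apply: eq_bigr => e _; rewrite /= -sumrN -big_split; apply: eq_bigr => f _ /=.
  by ring.
Qed.

(** Curvature operator [nabla_b, nabla_c] - nabla_[b, c] of a frame with constant connection
    coefficients; the differences of the [W] are the structure constants of the bracket. *)
Definition lie_curv b c : 'M[R]_n :=
  W c *m W b - W b *m W c - \sum_a (W b c a - W c b a) *: W a.

Lemma Curv_Th i j x : U x -> Curv g i j x *m Th x
  = Th x *m \sum_b \sum_c (Th x i b * Th x j c) *: lie_curv b c.
Proof.
move=> Ux; rewrite (Curv_solder oU rg sTh smooth_const_om _ Ux); last first.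
  by move=> k y Uy; rewrite Gam_Th.
apply: (f_equal2 (@mulmx _ _ _ _) erefl).
have dom k l : mpd k (const_om l) x = \sum_a mpd k Th x l a *: W a.
  have sT a : smooth U (fun y => Th y l a : R^o) by exact: sTh.
  have sW a : msmooth U (fun=> W a) by exact: msmooth_cst.
  rewrite (@mpd_sum _ _ _ oU _ _ k _ _ (fun a y => Th y l a *: W a) x
    (fun a => msmoothZ oU (sT a) (sW a)) Ux).
  apply: eq_bigr => a _; rewrite (mpdZ oU k (sT a) (sW a) Ux).
  by rewrite mpd_cst scaler0 addr0 mpdE.
rewrite (dom i j) (dom j i) -sumrB.
(* As [W] is constant, only [Th] is differentiated, and its antisymmetrized derivative is the
   bracket term of [lie_curv]. *)
have -> : \sum_a (mpd i Th x j a *: W a - mpd j Th x i a *: W a)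
    = - \sum_b \sum_c (Th x i b * Th x j c) *: \sum_a (W b c a - W c b a) *: W a.
  under eq_bigr => a _.
    rewrite -scalerBl torsion // scaleNr scaler_suml.
    under eq_bigr do rewrite scaler_suml.
  over.
  rewrite sumrN exchange_big; congr (- _); apply: eq_bigr => b _.
  rewrite exchange_big; apply: eq_bigr => c _; rewrite scaler_sumr.
  by apply: eq_bigr => a _; rewrite scalerA.
have prod (s t : 'I_n -> R) : (\sum_b s b *: W b) *m (\sum_c t c *: W c)
    = \sum_b \sum_c (s b * t c) *: (W b *m W c).
  rewrite mulmx_suml; apply: eq_bigr => b _; rewrite mulmx_sumr.
  by apply: eq_bigr => c _; rewrite -scalemxAl -scalemxAr scalerA.
rewrite /const_om !prod [X in X - _]exchange_big -!sumrB addrC -sumrB.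
apply: eq_bigr => b _; rewrite -!sumrB; apply: eq_bigr => c _ /=.
by rewrite /lie_curv !scalerBr (mulrC (Th x j c)).
Qed.

(** The first and last curvature indices are split off so that contractions over the two middle ones
    become traces. *)
Definition lie_riem b q : 'M[R]_n := \matrix_(c, p) lie_curv b c p q.

Lemma riem_Th i j k l x : U x -> riem g i k j l x
  = \sum_b \sum_q Th x i b * Th x j q * (Th x *m lie_riem b q *m (Th x)^T) k l.
Proof.
move=> Ux; rewrite riemE gTh // mulmxA Curv_Th //.
move: (Th x) => T.
have -> : (T *m (\sum_b \sum_c (T i b * T k c) *: lie_curv b c) *m T^T) l j
    = \sum_b \sum_q T i b * T j q *
       (\sum_c \sum_p T k c * T l p * lie_curv b c p q).
  have E (F : 'M[R]_n) : (T *m F *m T^T) l j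
      = \sum_q \sum_p T l p * F p q * T j q.
    rewrite mxE; apply: eq_bigr => q _; rewrite mxE mulr_suml.
    by apply: eq_bigr => p _; rewrite [X in _ * X]mxE.
  rewrite mulmx_sumr mulmx_suml summxE; apply: eq_bigr => b _.
  rewrite mulmx_sumr mulmx_suml summxE.
  under eq_bigr do rewrite -scalemxAr -scalemxAl mxE E mulr_sumr.
  rewrite exchange_big; apply: eq_bigr => q _; rewrite mulr_sumr.
  apply: eq_bigr => c _; rewrite !mulr_sumr; apply: eq_bigr => p _.
  by ring.
apply: eq_bigr => b _; apply: eq_bigr => q _; congr (_ * _).
rewrite [in RHS]mxE exchange_big; apply: eq_bigr => p _ /=.
rewrite [in RHS]mxE mulr_suml; apply: eq_bigr => c _; rewrite !mxE.
by ring.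
Qed.

Lemma mxtrace_conj (T A M : 'M[R]_n) :
  \tr (T *m A *m T^T *m M^T) = \tr (A *m (T^T *m M *m T)^T).
Proof. by rewrite -!mulmxA mxtrace_mulC !trmx_mul trmxK !mulmxA. Qed.

Lemma contract_Th i j x (M : 'M[R]_n) : U x ->
  \sum_k \sum_l riem g i k j l x * M k l
  = \sum_b \sum_q Th x i b * Th x j q
     * \tr (lie_riem b q *m ((Th x)^T *m M *m Th x)^T).
Proof.
move=> Ux.
transitivity (\sum_b \sum_q Th x i b * Th x j q *
    \sum_k \sum_l (Th x *m lie_riem b q *m (Th x)^T) k l * M k l).
  transitivity (\sum_k \sum_l \sum_b \sum_q Th x i b * Th x j q *
    ((Th x *m lie_riem b q *m (Th x)^T) k l * M k l)).
    apply: eq_bigr => k _; apply: eq_bigr => l _; rewrite riem_Th // mulr_suml.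
    apply: eq_bigr => b _; rewrite mulr_suml; apply: eq_bigr => q _.
    by rewrite mulrA.
  under eq_bigr do rewrite exchange_big; rewrite exchange_big.
  apply: eq_bigr => b _.
  under eq_bigr => k _ do rewrite exchange_big; rewrite exchange_big /=.
  apply: eq_bigr => q _; rewrite mulr_sumr; apply: eq_bigr => k _.
  by rewrite mulr_sumr.
apply: eq_bigr => b _; apply: eq_bigr => q _; congr (_ * _).
transitivity (\tr (Th x *m lie_riem b q *m (Th x)^T *m M^T)).
  apply: eq_bigr => k _; rewrite mxE; apply: eq_bigr => l _.
  by congr (_ * _); rewrite [RHS]mxE.
exact: mxtrace_conj.
Qed.

Lemma double_entry (A M : 'M[R]_n) i j :
  \sum_b \sum_q A i b * A j q * M b q = (A *m M *m A^T) i j.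
Proof.
rewrite mxE exchange_big; apply: eq_bigr => q _; rewrite mxE mulr_suml.
by apply: eq_bigr => b _; rewrite mxE mulrAC.
Qed.

Lemma ginv_Th x : U x -> invmx (g x) = invmx ((Th x)^T) *m invmx (Th x).
Proof.
move=> Ux; have uT := Th_unit Ux; have uTT : (Th x)^T \in unitmx by rewrite unitmx_tr.
apply: (can_inj (mulmxK (riemannian_unit rg Ux))).
rewrite mulVmx ?(riemannian_unit rg) // gTh // -mulmxA (mulmxA (invmx (Th x))).
by rewrite mulVmx // mul1mx mulVmx.
Qed.

(** Orthonormality of the coframe. This is what turns contractions with the inverse metric into
    plain traces over frame indices. *)
Lemma Th_ginv_Th x : U x -> (Th x)^T *m invmx (g x) *m Th x = 1%:M.
Proof.
move=> Ux; have uT := Th_unit Ux; have uTT : (Th x)^T \in unitmx by rewrite unitmx_tr.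
by rewrite ginv_Th // mulmxA mulmxV // mul1mx mulVmx.
Qed.

Lemma Th_up x (A : 'M[R]_n) : U x -> (Th x)^T
  *m (invmx (g x) *m (Th x *m A *m (Th x)^T) *m invmx (g x)) *m Th x = A.
Proof.
move=> Ux; transitivity ((Th x)^T *m invmx (g x) *m Th x *m A
    *m ((Th x)^T *m invmx (g x) *m Th x)); first by rewrite !mulmxA.
by rewrite !Th_ginv_Th // mul1mx mulmx1.
Qed.

Lemma ginvT x : U x -> (invmx (g x))^T = invmx (g x).
Proof. by move=> Ux; rewrite trmx_inv (riemannian_sym rg Ux). Qed.

Definition lie_ricci : 'M[R]_n := \matrix_(b, q) \tr (lie_riem b q).

Lemma ricci_Th i j x : U x ->
  ricci g i j x = (Th x *m lie_ricci *m (Th x)^T) i j.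
Proof.
move=> Ux; apply: etrans (contract_Th i j (invmx (g x)) Ux) _.
rewrite -double_entry; apply: eq_bigr => b _; apply: eq_bigr => q _.
by rewrite Th_ginv_Th // trmx1 mulmx1 mxE.
Qed.

Lemma ricci_up_Th x : U x -> (\matrix_(k, l) ricci_up g k l x)
  = invmx (g x) *m (Th x *m lie_ricci *m (Th x)^T) *m invmx (g x).
Proof.
move=> Ux; apply/matrixP => k l; rewrite mxE.
transitivity (\sum_a \sum_b invmx (g x) k a * invmx (g x) l b *
  (Th x *m lie_ricci *m (Th x)^T) a b).
  by apply: eq_bigr => a _; apply: eq_bigr => b _; rewrite ricci_Th.
by rewrite double_entry ginvT.
Qed.

Definition lie_riem_ricci : 'M[R]_n :=
  \matrix_(b, q) \tr (lie_riem b q *m lie_ricci^T).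

Lemma riem_ricci_Th i j x : U x ->
  riem_ricci g i j x = (Th x *m lie_riem_ricci *m (Th x)^T) i j.
Proof.
move=> Ux; transitivity (\sum_k \sum_l riem g i k j l x *
    (\matrix_(k, l) ricci_up g k l x) k l).
  by apply: eq_bigr => k _; apply: eq_bigr => l _; rewrite mxE.
rewrite contract_Th // -double_entry; apply: eq_bigr => b _.
by apply: eq_bigr => q _; rewrite ricci_up_Th // Th_up // mxE.
Qed.

Lemma scal_Th x : U x -> scal g x = \tr lie_ricci.
Proof.
move=> Ux; transitivity (\tr (Th x *m lie_ricci *m (Th x)^T *m (invmx (g x))^T)).
  apply: eq_bigr => i _; rewrite mxE; apply: eq_bigr => j _.
  by rewrite ricci_Th //; congr (_ * _); rewrite [RHS]mxE.
by rewrite mxtrace_conj Th_ginv_Th // trmx1 mulmx1.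
Qed.

Lemma ricci_norm2_Th x : U x ->
  ricci_norm2 g x = \tr (lie_ricci *m lie_ricci^T).
Proof.
move=> Ux; transitivity (\tr (Th x *m lie_ricci *m (Th x)^T *m
    (\matrix_(k, l) ricci_up g k l x)^T)).
  apply: eq_bigr => i _; rewrite mxE; apply: eq_bigr => j _.
  by rewrite ricci_Th //; congr (_ * _); rewrite [RHS]mxE [RHS]mxE.
by rewrite mxtrace_conj ricci_up_Th // Th_up.
Qed.

(** The frame components of the Ricci tensor are constant, so its covariant derivative consists of
    connection terms only. *)
Definition lie_nabla c : 'M[R]_n :=
  - (W c *m lie_ricci + lie_ricci *m (W c)^T).

Definition conj_Th (A : 'rV[R]_n -> 'M[R]_n) x := Th x *m A x *m (Th x)^T.

Lemma mpd_conj_Th i (A : 'rV[R]_n -> 'M[R]_n) x : msmooth U A -> U x ->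
  mpd i (conj_Th A) x - (Gam g i x *m conj_Th A x + conj_Th A x *m (Gam g i x)^T)
  = Th x *m (mpd i A x - (const_om i x *m A x + A x *m (const_om i x)^T))
    *m (Th x)^T.
Proof.
move=> sA Ux; have sT := msmooth_tr oU sTh.
rewrite /conj_Th (mpdM oU i (msmoothM oU sTh sA) sT Ux) (mpdM oU i sTh sA Ux) mpd_tr.
exact: conj_connection_algebra (Gam_Th i Ux).
Qed.

Lemma smooth_comb k (F : 'I_n -> 'M[R]_n) :
  msmooth U (fun y => \sum_c Th y k c *: F c).
Proof.
by apply: msmooth_sum => // c; apply: msmoothZ => //; apply: msmooth_cst.
Qed.

Lemma nabla_ricci_Th k i j x : U x -> nabla_ricci g k i j x
  = conj_Th (fun y => \sum_c Th y k c *: lie_nabla c) x i j.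
Proof.
move=> Ux.
have sc : msmooth U (fun=> lie_ricci) by exact: msmooth_cst.
have E : mpd k (conj_Th (fun=> lie_ricci)) x
    - (Gam g k x *m conj_Th (fun=> lie_ricci) x
       + conj_Th (fun=> lie_ricci) x *m (Gam g k x)^T)
  = conj_Th (fun y => \sum_c Th y k c *: lie_nabla c) x.
  rewrite mpd_conj_Th // mpd_cst sub0r /conj_Th; congr (_ *m _ *m _).
  rewrite /const_om linear_sum mulmx_suml mulmx_sumr -big_split -sumrN.
  apply: eq_bigr => c _ /=.
  by rewrite linearZ /= -scalemxAl -scalemxAr -scalerDr scalerN.
rewrite -E /nabla_ricci [RHS]mxE; congr (_ + _).
  rewrite mpdE; apply: (eq_on_pd oU) Ux => y Uy.
  by rewrite ricci_Th.
rewrite [RHS]mxE; congr (- _); rewrite [RHS]mxE [X in _ = X + _]mxE.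
rewrite [X in _ = _ + X]mxE -big_split; apply: eq_bigr => a _ /=.
rewrite !ricci_Th // -!GamijkE [(Gam g k x)^T a j]mxE.
by congr (_ + _); rewrite mulrC.
Qed.

(** The last sum is the connection term of the index in which the first derivative was taken. *)
Definition lie_nabla2 d e : 'M[R]_n :=
  - (W d *m lie_nabla e + lie_nabla e *m (W d)^T) - \sum_c W d e c *: lie_nabla c.

Lemma nabla2_ricci_Th l k i j x : U x -> nabla2_ricci g l k i j x
  = conj_Th (fun y => \sum_d \sum_e (Th y l d * Th y k e) *: lie_nabla2 d e) x i j.
Proof.
move=> Ux; pose NN a y := \sum_c Th y a c *: lie_nabla c.
have sN a : msmooth U (NN a) by exact: smooth_comb.
have E : mpd l (conj_Th (NN k)) x
    - (Gam g l x *m conj_Th (NN k) x + conj_Th (NN k) x *m (Gam g l x)^T)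
    - \sum_a Gam g l x k a *: conj_Th (NN a) x
  = conj_Th (fun y => \sum_d \sum_e (Th y l d * Th y k e) *: lie_nabla2 d e) x.
  rewrite mpd_conj_Th //.
  have -> : \sum_a Gam g l x k a *: conj_Th (NN a) x
      = conj_Th (fun x => \sum_c (Gam g l x *m Th x) k c *: lie_nabla c) x.
    rewrite /conj_Th; under [in RHS]eq_bigr do rewrite mxE scaler_suml.
    rewrite exchange_big mulmx_sumr mulmx_suml; apply: eq_bigr => a _.
    rewrite scalemxAl scalemxAr; congr (_ *m _ *m _).
    by rewrite scaler_sumr; apply: eq_bigr => c _; rewrite scalerA.
  rewrite /conj_Th -mulmxBl -mulmxBr; congr (_ *m _ *m _).
  rewrite Gam_Th //.
  have -> : mpd l (NN k) x = \sum_c mpd l Th x k c *: lie_nabla c.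
    have sT a : smooth U (fun y => Th y k a : R^o) by exact: sTh.
    have sW a : msmooth U (fun=> lie_nabla a) by exact: msmooth_cst.
    rewrite (@mpd_sum _ _ _ oU _ _ l _ _ (fun a y => Th y k a *: lie_nabla a) x
      (fun a => msmoothZ oU (sT a) (sW a)) Ux).
    apply: eq_bigr => a _; rewrite (mpdZ oU l (sT a) (sW a) Ux).
    by rewrite mpd_cst scaler0 addr0 mpdE.
  have -> : \sum_c (mpd l Th x + Th x *m const_om l x) k c *: lie_nabla c
     = \sum_c mpd l Th x k c *: lie_nabla c
       + \sum_d \sum_e (Th x l d * Th x k e) *: \sum_c W d e c *: lie_nabla c.
    have -> : \sum_d \sum_e (Th x l d * Th x k e) *: (\sum_c W d e c *: lie_nabla c)
        = \sum_c (Th x *m const_om l x) k c *: lie_nabla c.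
      under [in RHS]eq_bigr do rewrite Th_const_om scaler_suml.
      rewrite [in RHS]exchange_big; apply: eq_bigr => d _.
      under [in RHS]eq_bigr do rewrite scaler_suml.
      rewrite [in RHS]exchange_big; apply: eq_bigr => e _.
      by rewrite scaler_sumr; apply: eq_bigr => c _; rewrite scalerA.
    by rewrite -big_split; apply: eq_bigr => c _; rewrite mxE scalerDl.
  (* [Z], the term with derivatives of the coframe, arises both from differentiating [NN] and from
     the connection acting on its index; the two occurrences cancel. *)
  move: (\sum_c mpd l Th x k c *: lie_nabla c) => Z.
  have cancel (B C : 'M[R]_n) : Z - B - (Z + C) = - (B + C).
    by rewrite addrAC opprD addrA subrr sub0r -opprD addrC.
  rewrite cancel /lie_nabla2 => {cancel Z}.
  transitivity (- \sum_d \sum_e (Th x l d * Th x k e) *: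
    (W d *m lie_nabla e + lie_nabla e *m (W d)^T + \sum_c W d e c *: lie_nabla c)).
    have E1 : const_om l x *m NN k x = \sum_d \sum_e (Th x l d * Th x k e) *:
        (W d *m lie_nabla e).
      rewrite mulmx_suml; apply: eq_bigr => d _; rewrite mulmx_sumr.
      by apply: eq_bigr => e _; rewrite -scalemxAl -scalemxAr scalerA.
    have E2 : NN k x *m (const_om l x)^T = \sum_d \sum_e (Th x l d * Th x k e) *:
        (lie_nabla e *m (W d)^T).
      rewrite [(const_om l x)^T](linear_sum (@trmx R n n)) mulmx_sumr.
      apply: eq_bigr => d _; rewrite linearZ /= mulmx_suml.
      apply: eq_bigr => e _; rewrite -scalemxAl -scalemxAr scalerA.
      by rewrite (mulrC (Th x k e)).
    rewrite E1 E2 -!big_split; congr (- _); apply: eq_bigr => d _ /=.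
    by rewrite -!big_split; apply: eq_bigr => e _ /=; rewrite -!scalerDr.
  rewrite -sumrN; apply: eq_bigr => d _; rewrite -sumrN; apply: eq_bigr => e _.
  by rewrite -scalerN opprD.
have EE (A B C D : 'M[R]_n) :
    (A - (B + C) - D) i j = A i j - (D i j + B i j + C i j).
  by rewrite !mxE; ring.
rewrite -E EE /nabla2_ricci.
have -> : pd l (nabla_ricci g k i j) x = mpd l (conj_Th (NN k)) x i j.
  by rewrite mpdE; apply: (eq_on_pd oU) Ux => y Uy; rewrite nabla_ricci_Th.
congr (_ - _); rewrite summxE [X in _ = _ + X + _]mxE [X in _ = _ + X]mxE.
rewrite -!big_split; apply: eq_bigr => a _ /=.
rewrite !nabla_ricci_Th // -!GamijkE [(Gam g l x)^T a j]mxE [X in _ = X + _ + _]mxE.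
by congr (_ + _); rewrite mulrC.
Qed.

Definition lie_laplace : 'M[R]_n := \sum_d lie_nabla2 d d.

Lemma laplace_ricci_Th i j x : U x ->
  laplace_ricci g i j x = conj_Th (fun=> lie_laplace) x i j.
Proof.
move=> Ux.
have tw d e : \sum_l \sum_k invmx (g x) l k * (Th x l d * Th x k e) = (d == e)%:R.
  transitivity ((1%:M : 'M[R]_n) d e); last by rewrite mxE.
  rewrite -(Th_ginv_Th Ux).
  rewrite exchange_big [RHS]mxE; apply: eq_bigr => k _; rewrite mxE mulr_suml.
  by apply: eq_bigr => l _; rewrite [(Th x)^T d l]mxE; ring.
have CE (I : finType) (r : I -> R) (M : I -> 'M[R]_n) :
    conj_Th (fun=> \sum_s r s *: M s) x i j = \sum_s r s * conj_Th (fun=> M s) x i j.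
  rewrite /conj_Th mulmx_sumr mulmx_suml summxE; apply: eq_bigr => s _.
  by rewrite -scalemxAr -scalemxAl mxE.
transitivity (\sum_d \sum_e (\sum_l \sum_k invmx (g x) l k * (Th x l d * Th x k e))
    * conj_Th (fun=> lie_nabla2 d e) x i j).
  transitivity (\sum_l \sum_k \sum_d \sum_e invmx (g x) l k * (Th x l d * Th x k e)
     * conj_Th (fun=> lie_nabla2 d e) x i j).
    apply: eq_bigr => l _; apply: eq_bigr => k _; rewrite nabla2_ricci_Th //.
    have -> : conj_Th (fun y => \sum_d \sum_e (Th y l d * Th y k e) *: lie_nabla2 d e) x i j
       = \sum_d \sum_e (Th x l d * Th x k e) * conj_Th (fun=> lie_nabla2 d e) x i j.
      rewrite /conj_Th mulmx_sumr mulmx_suml summxE; apply: eq_bigr => d _.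
      exact: CE.
    rewrite mulr_sumr; apply: eq_bigr => d _; rewrite mulr_sumr.
    by apply: eq_bigr => e _; rewrite mulrA.
  under eq_bigr do rewrite exchange_big; rewrite exchange_big.
  apply: eq_bigr => d _.
  under eq_bigr => l _ do rewrite exchange_big; rewrite exchange_big /=.
  apply: eq_bigr => e _; rewrite mulr_suml; apply: eq_bigr => l _.
  by rewrite mulr_suml.
under eq_bigr => d _.
  under eq_bigr do rewrite tw.
  rewrite (bigD1 d) //= eqxx mul1r big1 ?addr0 => [|e ne]; last first.
    by rewrite eq_sym (negPf ne) mul0r.
over.
rewrite /conj_Th /lie_laplace mulmx_sumr mulmx_suml summxE.
exact: eq_bigr.
Qed.

Definition lie_EL t : 'M[R]_n :=
  - lie_laplace + (2^-1 * (\tr (lie_ricci *m lie_ricci^T) + t * (\tr lie_ricci) ^+ 2))%:M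
  - 2 *: lie_riem_ricci - (2 * t * \tr lie_ricci) *: lie_ricci.

(** At a single point the Euler-Lagrange tensor is Th E Th^T with a constant matrix E and invertible
    [Th x], so the differential equation reduces to E = 0. *)
Lemma critical_lie_EL t x : U x -> Ft_critical t U g -> lie_EL t = 0.
Proof.
move=> Ux crit; have uT := Th_unit Ux; have uTT : (Th x)^T \in unitmx by rewrite unitmx_tr.
suff E : conj_Th (fun=> lie_EL t) x = 0.
  have := congr1 (fun M => invmx (Th x) *m M *m invmx (Th x)^T) E.
  by rewrite mulmx0 mul0mx /conj_Th !mulmxA mulVmx // mul1mx mulmxK.
apply/matrixP => i j; rewrite [RHS]mxE -(crit x Ux i j).
rewrite laplace_ricci_Th // riem_ricci_Th // ricci_Th // scal_Th // ricci_norm2_Th //.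
rewrite gTh // /conj_Th /lie_EL mulmxBr mulmxBl mulmxBr mulmxBl mulmxDr mulmxDl.
rewrite mul_mx_scalar -!scalemxAr -!scalemxAl mulmxN mulNmx.
move: (Th x *m lie_laplace *m _) (Th x *m lie_riem_ricci *m _).
move: (Th x *m lie_ricci *m _) (Th x *m (Th x)^T) => A B C D.
by rewrite !mxE.
Qed.

End ConstantConnection.

(** * The critical polynomial system *)

Section CriticalSystem.
Variable R : realFieldType.
Implicit Types x y z X Y Z u : R.

(* Multiples of the diagonal entries of the Euler-Lagrange tensor, where
   [u = - 2 t tau] and [X], [Y], [Z] are the squares of the [b_i]. *)
Definition base_entry x y z X Y Z u :=
  15 * x ^+ 4 - 12 * x ^+ 3 * (y + z) + 2 * x ^+ 2 * (y + z) ^+ 2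
  + 4 * x * (y + z) * (y - z) ^+ 2
  - 9 * y ^+ 4 + 12 * y ^+ 3 * z - 6 * y ^+ 2 * z ^+ 2 + 12 * y * z ^+ 3 - 9 * z ^+ 4
  + 18 * x ^+ 2 * X - 4 * x * (y + z) * X + 4 * x * (y * Y + z * Z)
  - 18 * (y ^+ 2 * Y + z ^+ 2 * Z) + 12 * y * z * (Y + Z)
  + 3 * X ^+ 2 - 6 * X * (Y + Z) - 9 * (Y + Z) ^+ 2
  + u * (5 * x ^+ 2 - 2 * x * (y + z) - 3 * (y - z) ^+ 2 + X - 3 * (Y + Z)).

Definition fibre_entry x y z X Y Z u :=
  3 * (x ^+ 4 + y ^+ 4 + z ^+ 4)
  - 4 * (x ^+ 3 * (y + z) + y ^+ 3 * (z + x) + z ^+ 3 * (x + y))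
  + 2 * (x ^+ 2 * y ^+ 2 + y ^+ 2 * z ^+ 2 + z ^+ 2 * x ^+ 2)
  + 4 * x * y * z * (x + y + z)
  + 18 * (x ^+ 2 * X + y ^+ 2 * Y + z ^+ 2 * Z)
  - 12 * (x * y * (X + Y) + y * z * (Y + Z) + z * x * (Z + X))
  + 15 * (X + Y + Z) ^+ 2
  + u * (x ^+ 2 + y ^+ 2 + z ^+ 2 - 2 * (x * y + y * z + z * x)
         + 5 * (X + Y + Z)).

(** This and the next polynomial are what remains of the off-diagonal Euler-Lagrange entries once
    the factors b_i b_j and b_i l_i are taken out. Both are linear in [u], which makes them the
    means of eliminating it. *)
Definition mixed_entry x y z X Y Z u :=
  u + 3 * (x ^+ 2 + y ^+ 2 + X + Y + Z) + x * y - 2 * z * (x + y).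

Definition mixed_fibre_entry x y z X Y Z u :=
  u + 3 * (x ^+ 2 + X + Y + Z) - 2 * x * (y + z).

(** The two mixed equations give z = 3/2 (x + y) and u = 5 x y - 3 (A + B). The other three then
    become relations between x + y, x y, A + B and x A + y B, and their only solutions have A + B
    not positive. *)
Lemma no_two_nonzero x y z a b u : x != 0 -> y != 0 -> z != 0 -> a != 0 -> b != 0 ->
  base_entry z x y 0 (a ^+ 2) (b ^+ 2) u = 0 ->
  base_entry x y z (a ^+ 2) (b ^+ 2) 0 u = base_entry y z x (b ^+ 2) 0 (a ^+ 2) u ->
  fibre_entry x y z (a ^+ 2) (b ^+ 2) 0 u = 0 ->
  mixed_entry x y z (a ^+ 2) (b ^+ 2) 0 u = 0 ->
  mixed_fibre_entry x y z (a ^+ 2) (b ^+ 2) 0 u = 0 -> False.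
Proof.
move=> x0 y0 z0 a0 b0.
have A0 : 0 < a ^+ 2 by rewrite lt0r sqrf_eq0 a0 sqr_ge0.
have B0 : 0 < b ^+ 2 by rewrite lt0r sqrf_eq0 b0 sqr_ge0.
move: (a ^+ 2) (b ^+ 2) A0 B0 => A B A0 B0.
rewrite /base_entry /fibre_entry /mixed_entry /mixed_fibre_entry.
move=> e3 e12 e4 em ef.
have zE : z = 3 / 2 * (x + y).
  have : y * (3 * (x + y) - 2 * z) = 0 by lra.
  by move=> /eqP; rewrite mulf_eq0 (negPf y0) /= => /eqP; lra.
have uE : u = 5 * (x * y) - 3 * (A + B).
  have -> : u = - 3 * (x ^+ 2 + A + B + 0) + 2 * x * (y + z) by lra.
  by rewrite zE; field.
have s0 : x + y != 0 by apply/eqP => s0; move: z0; rewrite zE s0 mulr0 eqxx.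
subst z u.
have f4 : 51 * (x + y) ^+ 4 + 148 * (x * y) * (x + y) ^+ 2 - 64 * (x * y) ^+ 2
    = (A + B) * (12 * (x + y) ^+ 2 - 112 * (x * y)) by lra.
have [xy|xy] := eqVneq x y.
  subst y.
  have : x ^+ 2 * (21 * x ^+ 2 + (A + B)) = 0 by lra.
  move=> /eqP; rewrite mulf_eq0 sqrf_eq0 (negPf x0) /= => /eqP.
  have := sqr_ge0 x; lra.
have f12 : 3 * (x + y) * (A + B) + 3 * (x * A + y * B)
    = (x + y) * (21 / 4 * (x + y) ^+ 2 + 9 * (x * y)).
  have : (x - y) * (3 * (x + y) * (A + B) + 3 * (x * A + y * B)
    - (x + y) * (21 / 4 * (x + y) ^+ 2 + 9 * (x * y))) = 0 by lra.
  by move=> /eqP; rewrite mulf_eq0 subr_eq0 (negPf xy) /= => /eqP; lra.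
(* The relation is raised to degree four so that x A + y B can be eliminated linearly between it and
   the third diagonal equation. *)
have f12s : (x + y) * (3 * (x + y) * (A + B) + 3 * (x * A + y * B))
    = (x + y) * ((x + y) * (21 / 4 * (x + y) ^+ 2 + 9 * (x * y))) by rewrite f12.
have f3 : 255 * (x + y) ^+ 4 + 228 * (x * y) * (x + y) ^+ 2 + 192 * (x * y) ^+ 2
    = (A + B) * (60 * (x + y) ^+ 2 + 336 * (x * y)) by lra.
have BE : A + B = 17 / 4 * (x + y) ^+ 2 + 7 * (x * y).
  have : (x + y) ^+ 2 * (A + B - (17 / 4 * (x + y) ^+ 2 + 7 * (x * y))) = 0 by lra.
  by move=> /eqP; rewrite mulf_eq0 sqrf_eq0 (negPf s0) /= => /eqP; lra.
have : (x * y) * (3 / 4 * (x + y) ^+ 2 + x * y) = 0.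
  by move: f4; rewrite BE; lra.
move=> /eqP; rewrite !mulf_eq0 (negPf x0) (negPf y0) /= => /eqP pE.
(* Here x y = - 3/4 (x + y)^2, and [BE] turns into A + B = - (x + y)^2, against positivity. *)
have := sqr_ge0 (x + y); lra.
Qed.

(** The mixed equation gives [u]. For x = y the remaining equations factor and leave the claimed
    value of b^2. For distinct x and y, division by x - y yields b^2 = (2 (x + y) + z) (x + y - z)
    with x + y = 0 or x + y = z, that is, b^2 = - z^2 or b^2 = 0. *)
Lemma one_nonzero x y z b u : x != 0 -> y != 0 -> z != 0 -> b != 0 ->
  base_entry z x y (b ^+ 2) 0 0 u = 0 ->
  base_entry x y z 0 0 (b ^+ 2) u = base_entry y z x 0 (b ^+ 2) 0 u ->
  fibre_entry x y z 0 0 (b ^+ 2) u = 0 ->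
  mixed_fibre_entry z x y (b ^+ 2) 0 0 u = 0 ->
  x = y /\ b ^+ 2 = z * (x - z).
Proof.
move=> x0 y0 z0 b0.
have B0 : 0 < b ^+ 2 by rewrite lt0r sqrf_eq0 b0 sqr_ge0.
move: (b ^+ 2) B0 => B B0.
rewrite /base_entry /fibre_entry /mixed_fibre_entry => e3 e12 e4 ef.
have uE : u = 2 * z * (x + y) - 3 * (z ^+ 2 + B) by lra.
subst u; have [xy|xy] := eqVneq x y.
  split=> //; subst y.
  have : (x * z) * (B - z * (x - z)) = 0 by lra.
  by move=> /eqP; rewrite !mulf_eq0 (negPf x0) (negPf z0) /= => /eqP; lra.
exfalso; have d0 : x - y != 0 by rewrite subr_eq0.
have f1 : (x + y) ^+ 3 + 2 * (x + y) * (x - y) ^+ 2 - z * (x - y) ^+ 2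
    - 4 * z ^+ 2 * (x + y) - 3 * B * (x + y) + 2 * z ^+ 3 + 2 * z * B = 0.
  have : (x - y) * ((x + y) ^+ 3 + 2 * (x + y) * (x - y) ^+ 2 - z * (x - y) ^+ 2
    - 4 * z ^+ 2 * (x + y) - 3 * B * (x + y) + 2 * z ^+ 3 + 2 * z * B) = 0 by lra.
  by move=> /eqP; rewrite mulf_eq0 (negPf d0) /= => /eqP.
have f34 : 3 * B = 2 * (x + y) ^+ 2 + (x - y) ^+ 2 - 3 * z ^+ 2.
  have : (x - y) ^+ 2 * (3 * B - (2 * (x + y) ^+ 2 + (x - y) ^+ 2 - 3 * z ^+ 2)) = 0.
    by lra.
  by move=> /eqP; rewrite mulf_eq0 sqrf_eq0 (negPf d0) /= => /eqP; lra.
have : z * (x + y) * (- (x - y) ^+ 2 - z * (x + y) + 2 * z ^+ 2 + 2 * B) = 0 by lra.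
move=> /eqP; rewrite !mulf_eq0 (negPf z0) /= => /orP[/eqP s0|/eqP dE].
  have yE : y = - x by lra.
  subst y; have : z * (- (x - - x) ^+ 2 + 2 * z ^+ 2 + 2 * B) = 0 by lra.
  move=> /eqP; rewrite mulf_eq0 (negPf z0) /= => /eqP dE.
  have := sqr_ge0 z; move: f34; rewrite s0; lra.
have BE : B = (2 * (x + y) + z) * (x + y - z) by lra.
have : (x + y) ^+ 2 * (x + y - z) = 0.
  have d2 : (x - y) ^+ 2 = (x + y) * (4 * (x + y) - 3 * z) by lra.
  by move: f1; rewrite BE d2; lra.
move=> /eqP; rewrite mulf_eq0 sqrf_eq0 => /orP[/eqP s0|/eqP sz].
  by move: BE; rewrite s0; have := sqr_ge0 z; lra.
by move: BE; rewrite sz mulr0 => BE; move: B0; rewrite BE ltxx.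
Qed.

(** If two of the values agree, [two] forces the third to agree as well. If they are pairwise
    distinct, successive divided differences of the diagonal equations determine [u] and lead to x y
    z = 0. *)
Lemma none_nonzero x y z u : x != 0 -> y != 0 -> z != 0 ->
  base_entry x y z 0 0 0 u = 0 -> base_entry y z x 0 0 0 u = 0 ->
  base_entry z x y 0 0 0 u = 0 -> fibre_entry x y z 0 0 0 u = 0 ->
  x = y /\ y = z.
Proof.
have two x' z' u' : x' != 0 -> z' != 0 -> base_entry x' x' z' 0 0 0 u' = 0 ->
    base_entry z' x' x' 0 0 0 u' = 0 ->
    fibre_entry x' x' z' 0 0 0 u' = 0 -> x' = z'.
  rewrite /base_entry /fibre_entry => x0 z0 e1 e3 e4.
  apply/eqP/negPn/negP => xz; have d0 : x' - z' != 0 by rewrite subr_eq0.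
  have uE : u' = 2 * x' * z' - 3 * z' ^+ 2.
    have : (x' - z') * z' * (u' - (2 * x' * z' - 3 * z' ^+ 2)) = 0 by lra.
    by move=> /eqP; rewrite !mulf_eq0 (negPf d0) (negPf z0) /= => /eqP; lra.
  have : x' * z' ^+ 3 = 0 by move: e4; rewrite uE; lra.
  by move=> /eqP; rewrite mulf_eq0 expf_eq0 (negPf x0) (negPf z0).
move=> x0 y0 z0 e1 e2 e3 e4.
have [xy|xy] := eqVneq x y.
  by subst y; split=> //; apply: (two x z u) => //; move: e1 e2 e3 e4;
    rewrite /base_entry /fibre_entry; lra.
have [yz|yz] := eqVneq y z.
  subst z; suff : y = x by move=> E; move: xy; rewrite E eqxx.
  by apply: (two y x u) => //; move: e1 e2 e3 e4;
    rewrite /base_entry /fibre_entry; lra.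
have [xz|xz] := eqVneq x z.
  subst z; suff : x = y by move=> E; move: xy; rewrite E eqxx.
  by apply: (two x y u) => //; move: e1 e2 e3 e4;
    rewrite /base_entry /fibre_entry; lra.
exfalso; move: e1 e2 e3 e4; rewrite /base_entry /fibre_entry => e1 e2 e3 e4.
have cubic v w r (Q : R) : v - w != 0 -> (v - w) * Q = r -> r = 0 -> Q = 0.
  by move=> d0 <- /eqP; rewrite mulf_eq0 (negPf d0) /= => /eqP.
have dxy : x - y != 0 by rewrite subr_eq0.
have dyz : y - z != 0 by rewrite subr_eq0.
have dxz : x - z != 0 by rewrite subr_eq0.
(* [Q] is a divided difference of two diagonal entries, written in the variable that is left over
   and in the elementary symmetric functions [e] and [p], so the same cubic serves for several
   pairs. *)
pose Q (a e p : R) := 4 * a ^+ 3 - 4 * e * a ^+ 2 + (12 * p - 4 * e ^+ 2 - 2 * u) * a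
  + (3 * e ^+ 3 - 8 * e * p + u * e).
pose e := x + y + z; pose p := x * y + y * z + z * x.
have Qz : Q z e p = 0.
  have : (x - y) * Q z e p = 0 by rewrite /Q /e /p; lra.
  by move=> /eqP; rewrite mulf_eq0 (negPf dxy) /= => /eqP.
have Qx : Q x e p = 0.
  have : (y - z) * Q x e p = 0 by rewrite /Q /e /p; lra.
  by move=> /eqP; rewrite mulf_eq0 (negPf dyz) /= => /eqP.
(* The divided difference of [Q] itself, which is linear in [u]. *)
have uE : u = 4 * p - 2 * e ^+ 2.
  have : (x - z) * (u - (4 * p - 2 * e ^+ 2)) = 0.
    by move: Qz Qx; rewrite /Q /e /p; lra.
  by move=> /eqP; rewrite mulf_eq0 (negPf dxz) /= => /eqP; lra.
have e3E : e ^+ 3 - 4 * e * p + 4 * (x * y * z) = 0.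
  by move: Qz; rewrite /Q uE /e /p; lra.
have : e ^+ 2 * (4 * p - e ^+ 2) = 0.
  have e3E' : e * (e ^+ 3 - 4 * e * p + 4 * (x * y * z)) = 0 by rewrite e3E mulr0.
  by move: e4 e3E'; rewrite uE /e /p; lra.
move=> /eqP; rewrite mulf_eq0 sqrf_eq0 => H.
have : x * y * z = 0.
  case/orP: H => /eqP H; first by move: e3E; rewrite H; lra.
  have H' : e * (4 * p - e ^+ 2) = 0 by rewrite H mulr0.
  by move: e3E H'; lra.
by move=> /eqP; rewrite !mulf_eq0 (negPf x0) (negPf y0) (negPf z0).
Qed.

Definition critical_system x y z a b c u :=
  [/\ base_entry x y z (a ^+ 2) (b ^+ 2) (c ^+ 2) u = 0,
      base_entry y z x (b ^+ 2) (c ^+ 2) (a ^+ 2) u = 0,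
      base_entry z x y (c ^+ 2) (a ^+ 2) (b ^+ 2) u = 0 &
      fibre_entry x y z (a ^+ 2) (b ^+ 2) (c ^+ 2) u = 0] /\
  [/\ a * b * mixed_entry x y z (a ^+ 2) (b ^+ 2) (c ^+ 2) u = 0,
      b * c * mixed_entry y z x (b ^+ 2) (c ^+ 2) (a ^+ 2) u = 0 &
      c * a * mixed_entry z x y (c ^+ 2) (a ^+ 2) (b ^+ 2) u = 0] /\
  [/\ a * x * mixed_fibre_entry x y z (a ^+ 2) (b ^+ 2) (c ^+ 2) u = 0,
      b * y * mixed_fibre_entry y z x (b ^+ 2) (c ^+ 2) (a ^+ 2) u = 0 &
      c * z * mixed_fibre_entry z x y (c ^+ 2) (a ^+ 2) (b ^+ 2) u = 0].

Lemma critical_system_cycle x y z a b c u :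
  critical_system x y z a b c u -> critical_system y z x b c a u.
Proof.
move=> [[e1 e2 e3 e4] [[m1 m2 m3] [f1 f2 f3]]]; do !split=> //.
by rewrite -[RHS]e4 /fibre_entry; ring.
Qed.

(** Two nonzero coefficients together with a vanishing third are excluded above. If none of the
    three vanishes, subtracting the mixed equations in pairs gives 3 (x + y) = 2 z and its cyclic
    images, a linear system with only the zero solution. *)
Lemma critical_system_pair x y z a b c u : x != 0 -> y != 0 -> z != 0 ->
  critical_system x y z a b c u -> a * b = 0.
Proof.
move=> x0 y0 z0 [[e1 e2 e3 e4] [[m1 m2 m3] [f1 f2 f3]]].
apply/eqP/negPn/negP; rewrite mulf_eq0 negb_or => /andP[a0 b0].
have nz (p q r : R) : p != 0 -> q != 0 -> p * q * r = 0 -> r = 0.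
  by move=> p0 q0 /eqP; rewrite !mulf_eq0 (negPf p0) (negPf q0) /= => /eqP.
have {}m1 := nz _ _ _ a0 b0 m1; have {}f1 := nz _ _ _ a0 x0 f1.
have [c0|c0] := eqVneq c 0.
  subst c; rewrite expr0n /= in e1 e2 e3 e4 m1 f1.
  apply: (no_two_nonzero x0 y0 z0 a0 b0 e3 _ e4 m1 f1).
  by rewrite e1 e2.
have {}m2 := nz _ _ _ b0 c0 m2; have {}f2 := nz _ _ _ b0 y0 f2.
have {}m3 := nz _ _ _ c0 a0 m3; have {}f3 := nz _ _ _ c0 z0 f3.
move: m1 m2 m3 f1 f2 f3; rewrite /mixed_entry /mixed_fibre_entry.
move: (a ^+ 2) (b ^+ 2) (c ^+ 2) => A B C m1 m2 m3 f1 f2 f3.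
have nz1 (p r : R) : p != 0 -> p * r = 0 -> r = 0.
  by move=> p0 /eqP; rewrite mulf_eq0 (negPf p0) /= => /eqP.
have g1 : 3 * (x + y) - 2 * z = 0 by apply: (nz1 y) => //; lra.
have g2 : 3 * (y + z) - 2 * x = 0 by apply: (nz1 z) => //; lra.
have g3 : 3 * (z + x) - 2 * y = 0 by apply: (nz1 x) => //; lra.
by move/eqP: x0; apply; lra.
Qed.

Lemma critical_system_one x y z c u : x != 0 -> y != 0 -> z != 0 -> c != 0 ->
  critical_system x y z 0 0 c u ->
  exists r, [/\ x ^+ 2 = r * x, y ^+ 2 = r * y & z ^+ 2 + c ^+ 2 = r * z].
Proof.
move=> x0 y0 z0 c0 [[e1 e2 e3 e4] [_ [_ _ f3]]].
rewrite expr0n /= in e1 e2 e3 e4 f3.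
have {}f3 : mixed_fibre_entry z x y (c ^+ 2) 0 0 u = 0.
  by move: f3 => /eqP; rewrite !mulf_eq0 (negPf c0) (negPf z0) /= => /eqP.
have e12 : base_entry x y z 0 0 (c ^+ 2) u = base_entry y z x 0 (c ^+ 2) 0 u.
  by rewrite e1 e2.
have [xy cE] := one_nonzero x0 y0 z0 c0 e3 e12 e4 f3.
by exists x; rewrite -xy cE; split; ring.
Qed.

(** At most one of [a], [b], [c] survives, and the cyclic symmetry moves it to the last place. There
    r = x = y and c^2 = z (r - z); with none surviving, r is the common value of x, y and z. *)
Lemma critical_system_round x y z a b c u : x != 0 -> y != 0 -> z != 0 ->
  critical_system x y z a b c u ->
  [/\ a * b = 0, b * c = 0, c * a = 0 & exists r,
    [/\ x ^+ 2 + a ^+ 2 = r * x, y ^+ 2 + b ^+ 2 = r * y &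
        z ^+ 2 + c ^+ 2 = r * z]].
Proof.
move=> x0 y0 z0 S; have S' := critical_system_cycle S.
have S'' := critical_system_cycle S'.
have ab := critical_system_pair x0 y0 z0 S.
have bc := critical_system_pair y0 z0 x0 S'.
have ca := critical_system_pair z0 x0 y0 S''.
split=> //.
have [c0|c0] := eqVneq c 0; last first.
  have a0 : a = 0 by apply/eqP; move/eqP: ca; rewrite mulf_eq0 (negPf c0).
  have b0 : b = 0 by apply/eqP; move/eqP: bc; rewrite mulf_eq0 (negPf c0) orbF.
  subst a b; have [r [r1 r2 r3]] := critical_system_one x0 y0 z0 c0 S.
  by exists r; rewrite expr0n /= !addr0.
have [b0|b0] := eqVneq b 0; last first.
  have a0 : a = 0 by apply/eqP; move/eqP: ab; rewrite mulf_eq0 (negPf b0) orbF.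
  subst a c; have [r [r1 r2 r3]] := critical_system_one z0 x0 y0 b0 S''.
  by exists r; rewrite expr0n /= !addr0.
have [a0|a0] := eqVneq a 0; last first.
  subst b c; have [r [r1 r2 r3]] := critical_system_one y0 z0 x0 a0 S'.
  by exists r; rewrite expr0n /= !addr0.
subst a b c; case: S => [[e1 e2 e3 e4] _]; rewrite expr0n /= in e1 e2 e3 e4.
have [xy yz] := none_nonzero x0 y0 z0 e1 e2 e3 e4.
by exists x; rewrite -yz -xy expr0n /= addr0 expr2.
Qed.

End CriticalSystem.

(** * The Euler-Lagrange tensor of the bracket *)

Section UnimodularTimesLine.
Variables (R : realType) (l1 l2 l3 b1 b2 b3 : R).

(* [lie_struct i j k] is the coefficient of f_k in the bracket of f_i and f_j for
   [f_1, f_2] = l3 f_3 + b3 f_4 and cyclic permutations, with f_4 central. *)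
Definition lie_struct (i j k : 'I_4) : R :=
  match i : nat, j : nat, k : nat with
  | 0, 1, 2 => l3 | 1, 0, 2 => - l3 | 0, 1, 3 => b3 | 1, 0, 3 => - b3
  | 1, 2, 0 => l1 | 2, 1, 0 => - l1 | 1, 2, 3 => b1 | 2, 1, 3 => - b1
  | 2, 0, 1 => l2 | 0, 2, 1 => - l2 | 2, 0, 3 => b2 | 0, 2, 3 => - b2
  | _, _, _ => 0
  end.

(** Koszul formula in an orthonormal frame of left-invariant fields. *)
Definition lie_conn (b : 'I_4) : 'M[R]_4 := \matrix_(c, a)
  (2^-1 * (lie_struct b c a - lie_struct c a b + lie_struct a b c)).

(** The Ricci tensor in closed form, tabulated so that the Euler-Lagrange entries can be expanded
    without nested curvature sums. *)
Definition ricci_tab (i j : 'I_4) : R :=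
  match i : nat, j : nat with
  | 0, 0 => (l1 ^+ 2 - (l2 - l3) ^+ 2 - b2 ^+ 2 - b3 ^+ 2) / 2
  | 1, 1 => (l2 ^+ 2 - (l3 - l1) ^+ 2 - b3 ^+ 2 - b1 ^+ 2) / 2
  | 2, 2 => (l3 ^+ 2 - (l1 - l2) ^+ 2 - b1 ^+ 2 - b2 ^+ 2) / 2
  | 3, 3 => (b1 ^+ 2 + b2 ^+ 2 + b3 ^+ 2) / 2
  | 0, 1 | 1, 0 => b1 * b2 / 2
  | 1, 2 | 2, 1 => b2 * b3 / 2
  | 0, 2 | 2, 0 => b1 * b3 / 2
  | 0, 3 | 3, 0 => l1 * b1 / 2
  | 1, 3 | 3, 1 => l2 * b2 / 2
  | 2, 3 | 3, 2 => l3 * b3 / 2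
  | _, _ => 0
  end.

Lemma ord4_ind (P : 'I_4 -> Prop) :
  P (@Ordinal 4 0 isT) -> P (@Ordinal 4 1 isT) -> P (@Ordinal 4 2 isT) ->
  P (@Ordinal 4 3 isT) -> forall i, P i.
Proof.
move=> p0 p1 p2 p3 [[|[|[|[|//]]]] ij]; by rewrite (bool_irrelevance ij isT).
Qed.

Lemma sum_ord4 (F : 'I_4 -> R) : \sum_i F i =
  F (@Ordinal 4 0 isT) + F (@Ordinal 4 1 isT) + F (@Ordinal 4 2 isT)
  + F (@Ordinal 4 3 isT).
Proof.
rewrite !big_ord_recl big_ord0 addr0 !addrA.
by congr (F _ + F _ + F _ + F _); apply: val_inj.
Qed.

(** Scalar versions of the connection, curvature and derivative terms with all sums over four
    indices written out, in a shape that can be normalized one entry at a time. *)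
Let cn b c a :=
  2^-1 * (lie_struct b c a - lie_struct c a b + lie_struct a b c).

Let sum4 (F : 'I_4 -> R) := F (@Ordinal 4 0 isT) + F (@Ordinal 4 1 isT)
  + F (@Ordinal 4 2 isT) + F (@Ordinal 4 3 isT).

Let cv b c p q := sum4 (fun k => cn c p k * cn b k q - cn b p k * cn c k q
  - (cn b c k - cn c b k) * cn k p q).

Let nb c i j := - sum4 (fun k => cn c i k * ricci_tab k j + ricci_tab i k * cn c j k).

Let el t i j := sum4 (fun d => sum4 (fun k => cn d i k * nb d k j
    + nb d i k * cn d j k + cn d d k * nb k i j
    - 2 * cv i d k j * ricci_tab d k
    + (2^-1 * ricci_tab d k ^+ 2) *+ (i == j)))
  + (2^-1 * t * (sum4 (fun k => ricci_tab k k)) ^+ 2) *+ (i == j)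
  - 2 * t * sum4 (fun k => ricci_tab k k) * ricci_tab i j.

Let sum4E F : sum4 F = \sum_i F i.
Proof. by rewrite sum_ord4. Qed.

Lemma lie_connE b c a : lie_conn b c a = cn b c a.
Proof. by rewrite mxE. Qed.

Lemma lie_curvE b c p q : lie_curv lie_conn b c p q = cv b c p q.
Proof.
rewrite /cv sum4E /lie_curv !mxE summxE -!sumrB; apply: eq_bigr => a _.
by rewrite !mxE.
Qed.

Lemma lie_ricci_tab i j : lie_ricci lie_conn i j = ricci_tab i j.
Proof.
have -> : lie_ricci lie_conn i j = \sum_c cv i c c j.
  by rewrite mxE; apply: eq_bigr => c _; rewrite mxE lie_curvE.
rewrite sum_ord4.
elim/ord4_ind: i; elim/ord4_ind: j;
  rewrite /cv /sum4 /cn /lie_struct /ricci_tab /=; field.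
all: by rewrite ?pnatr_eq0.
Qed.

Lemma lie_nablaE c i j : lie_nabla lie_conn c i j = nb c i j.
Proof.
rewrite /nb sum4E /lie_nabla [LHS]mxE; congr (- _); rewrite [LHS]mxE.
rewrite mxE [X in _ + X]mxE -big_split; apply: eq_bigr => k _ /=.
by rewrite !lie_ricci_tab [X in _ + _ * X]mxE !lie_connE.
Qed.

Lemma lie_ELE t i j : lie_EL lie_conn t i j = el t i j.
Proof.
have tE : \tr (lie_ricci lie_conn) = \sum_k ricci_tab k k.
  by apply: eq_bigr => k _; rewrite lie_ricci_tab.
have nE : \tr (lie_ricci lie_conn *m (lie_ricci lie_conn)^T)
    = \sum_d \sum_k ricci_tab d k ^+ 2.
  apply: eq_bigr => d _; rewrite mxE; apply: eq_bigr => k _.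
  by rewrite [X in _ * X]mxE lie_ricci_tab expr2.
have rE : lie_riem_ricci lie_conn i j
    = \sum_d \sum_k cv i d k j * ricci_tab d k.
  rewrite mxE; apply: eq_bigr => d _; rewrite mxE; apply: eq_bigr => k _.
  by rewrite [X in X * _]mxE [X in _ * X]mxE lie_ricci_tab lie_curvE.
have lE : lie_laplace lie_conn i j = - \sum_d \sum_k (cn d i k * nb d k j
    + nb d i k * cn d j k + cn d d k * nb k i j).
  rewrite summxE -sumrN; apply: eq_bigr => d _; rewrite /lie_nabla2.
  have E (A B C : 'M[R]_4) : (- (A + B) - C) i j = - (A i j + B i j + C i j).
    by rewrite !mxE; ring.
  rewrite E summxE [X in X + _ + _]mxE [X in _ + X + _]mxE -!big_split.
  congr (- _); apply: eq_bigr => k _ /=.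
  rewrite [(lie_conn d)^T k j]mxE [X in _ + _ + X]mxE !lie_connE.
  by rewrite !lie_nablaE.
have E (A B C : 'M[R]_4) (r s : R) : (- A + r%:M - 2 *: B - s *: C) i j
    = - A i j + r *+ (i == j) - 2 * B i j - s * C i j by rewrite !mxE.
rewrite /lie_EL E {E} tE nE lE rE lie_ricci_tab opprK /el !sum4E.
congr (_ - _); rewrite mulrDr mulrnDl mulrA addrA [LHS]addrAC; congr (_ + _).
rewrite addrAC !mulr_sumr -sumrMnl -sumrB -big_split; apply: eq_bigr => d _ /=.
rewrite sum4E !mulr_sumr -sumrMnl -sumrB -big_split; apply: eq_bigr => k _ /=.
by rewrite mulrA.
Qed.

Let B1 := b1 ^+ 2. Let B2 := b2 ^+ 2. Let B3 := b3 ^+ 2.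

Definition lie_u t := t * (l1 ^+ 2 + l2 ^+ 2 + l3 ^+ 2
  - 2 * (l1 * l2 + l2 * l3 + l3 * l1) + B1 + B2 + B3).

(** The factor 8 on the diagonal, and 2 off it, makes the entry a polynomial with integer
    coefficients. *)
Lemma lie_EL00 t : 8 * lie_EL lie_conn t (@Ordinal 4 0 isT) (@Ordinal 4 0 isT) =
  base_entry l1 l2 l3 B1 B2 B3 (lie_u t).
Proof.
rewrite lie_ELE /el /nb /cv /sum4 /cn /lie_struct /ricci_tab /=.
rewrite /base_entry /lie_u /B1 /B2 /B3; field.
all: by rewrite ?pnatr_eq0.
Qed.

Lemma lie_EL11 t : 8 * lie_EL lie_conn t (@Ordinal 4 1 isT) (@Ordinal 4 1 isT) =
  base_entry l2 l3 l1 B2 B3 B1 (lie_u t).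
Proof.
rewrite lie_ELE /el /nb /cv /sum4 /cn /lie_struct /ricci_tab /=.
rewrite /base_entry /lie_u /B1 /B2 /B3; field.
all: by rewrite ?pnatr_eq0.
Qed.

Lemma lie_EL22 t : 8 * lie_EL lie_conn t (@Ordinal 4 2 isT) (@Ordinal 4 2 isT) =
  base_entry l3 l1 l2 B3 B1 B2 (lie_u t).
Proof.
rewrite lie_ELE /el /nb /cv /sum4 /cn /lie_struct /ricci_tab /=.
rewrite /base_entry /lie_u /B1 /B2 /B3; field.
all: by rewrite ?pnatr_eq0.
Qed.

Lemma lie_EL33 t : 8 * lie_EL lie_conn t (@Ordinal 4 3 isT) (@Ordinal 4 3 isT) =
  fibre_entry l1 l2 l3 B1 B2 B3 (lie_u t).
Proof.
rewrite lie_ELE /el /nb /cv /sum4 /cn /lie_struct /ricci_tab /=.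
rewrite /fibre_entry /lie_u /B1 /B2 /B3; field.
all: by rewrite ?pnatr_eq0.
Qed.

Lemma lie_EL01 t : 2 * lie_EL lie_conn t (@Ordinal 4 0 isT) (@Ordinal 4 1 isT) =
  b1 * b2 * mixed_entry l1 l2 l3 B1 B2 B3 (lie_u t).
Proof.
rewrite lie_ELE /el /nb /cv /sum4 /cn /lie_struct /ricci_tab /=.
rewrite /mixed_entry /lie_u /B1 /B2 /B3; field.
all: by rewrite ?pnatr_eq0.
Qed.

Lemma lie_EL12 t : 2 * lie_EL lie_conn t (@Ordinal 4 1 isT) (@Ordinal 4 2 isT) =
  b2 * b3 * mixed_entry l2 l3 l1 B2 B3 B1 (lie_u t).
Proof.
rewrite lie_ELE /el /nb /cv /sum4 /cn /lie_struct /ricci_tab /=.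
rewrite /mixed_entry /lie_u /B1 /B2 /B3; field.
all: by rewrite ?pnatr_eq0.
Qed.

Lemma lie_EL20 t : 2 * lie_EL lie_conn t (@Ordinal 4 2 isT) (@Ordinal 4 0 isT) =
  b3 * b1 * mixed_entry l3 l1 l2 B3 B1 B2 (lie_u t).
Proof.
rewrite lie_ELE /el /nb /cv /sum4 /cn /lie_struct /ricci_tab /=.
rewrite /mixed_entry /lie_u /B1 /B2 /B3; field.
all: by rewrite ?pnatr_eq0.
Qed.

Lemma lie_EL03 t : 2 * lie_EL lie_conn t (@Ordinal 4 0 isT) (@Ordinal 4 3 isT) =
  b1 * l1 * mixed_fibre_entry l1 l2 l3 B1 B2 B3 (lie_u t).
Proof.
rewrite lie_ELE /el /nb /cv /sum4 /cn /lie_struct /ricci_tab /=.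
rewrite /mixed_fibre_entry /lie_u /B1 /B2 /B3; field.
all: by rewrite ?pnatr_eq0.
Qed.

Lemma lie_EL13 t : 2 * lie_EL lie_conn t (@Ordinal 4 1 isT) (@Ordinal 4 3 isT) =
  b2 * l2 * mixed_fibre_entry l2 l3 l1 B2 B3 B1 (lie_u t).
Proof.
rewrite lie_ELE /el /nb /cv /sum4 /cn /lie_struct /ricci_tab /=.
rewrite /mixed_fibre_entry /lie_u /B1 /B2 /B3; field.
all: by rewrite ?pnatr_eq0.
Qed.

Lemma lie_EL23 t : 2 * lie_EL lie_conn t (@Ordinal 4 2 isT) (@Ordinal 4 3 isT) =
  b3 * l3 * mixed_fibre_entry l3 l1 l2 B3 B1 B2 (lie_u t).
Proof.
rewrite lie_ELE /el /nb /cv /sum4 /cn /lie_struct /ricci_tab /=.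
rewrite /mixed_fibre_entry /lie_u /B1 /B2 /B3; field.
all: by rewrite ?pnatr_eq0.
Qed.

Lemma lie_EL_eq0 t : l1 != 0 -> l2 != 0 -> l3 != 0 -> lie_EL lie_conn t = 0 ->
  [/\ b1 * b2 = 0, b2 * b3 = 0, b3 * b1 = 0 & exists r,
    [/\ l1 ^+ 2 + b1 ^+ 2 = r * l1, l2 ^+ 2 + b2 ^+ 2 = r * l2 &
        l3 ^+ 2 + b3 ^+ 2 = r * l3]].
Proof.
move=> l10 l20 l30 E0.
have E i j : lie_EL lie_conn t i j = 0 by rewrite E0 mxE.
apply: (@critical_system_round _ _ _ _ _ _ _ (lie_u t)) => //.
do !split; rewrite -?lie_EL00 -?lie_EL11 -?lie_EL22 -?lie_EL33 -?lie_EL01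
  -?lie_EL12 -?lie_EL20 -?lie_EL03 -?lie_EL13 -?lie_EL23 ?E ?mulr0 //.
Qed.

End UnimodularTimesLine.

(** * Round metrics *)

Section RoundChart.
Variables (R : realType) (n : nat) (r : R).
Hypothesis r0 : 0 < r.

Lemma msmooth_id (U : set 'rV[R]_n) : open U -> msmooth U id.
Proof.
move=> oU a b k; have D v y : 'D_v (fun z : 'rV[R]_n => z a b : R^o) y = v a b.
  by rewrite -(@derive_entry _ _ _ _ id) ?derive_id //; apply: ex_diff.
have df y : differentiable (fun z : 'rV[R]_n => z a b : R^o) y.
  exact: differentiable_coord.
case: k => [|k] /=; first by move=> x _; apply: differentiable_continuous.
split=> [//|v]; apply: (@Ck_ext _ _ _ oU _ k (fun=> v a b : R^o)).
  by move=> y _; rewrite D.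
exact: Ck_cst.
Qed.

Lemma pd_coord (i j : 'I_n) (y : 'rV[R]_n) :
  pd i (fun z => z 0 j) y = (i == j)%:R.
Proof.
rewrite pdE -(@derive_entry _ _ _ _ id) ?derive_id; last exact: ex_diff.
by rewrite mxE eqxx eq_sym.
Qed.

Definition norm2 (y : 'rV[R]_n) : R := \sum_i y 0 i * y 0 i.

Definition unit_ball : set 'rV[R]_n := [set y | norm2 y < 1].

(* The round sphere of radius [r] (a hemisphere of it), in the coordinates given
   by the orthogonal projection to the equatorial hyperplane, rescaled. *)
Definition round_metric (y : 'rV[R]_n) : 'M[R]_n :=
  \matrix_(i, j) (r ^+ 2 * ((i == j)%:R + y 0 i * y 0 j / (1 - norm2 y))).

Lemma smooth_norm2 (U : set 'rV[R]_n) : open U -> smooth U (norm2 : _ -> R^o).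
Proof.
by move=> oU; apply: smooth_sum => // i; apply: smoothM => //; apply: msmooth_id.
Qed.

Lemma open_unit_ball : open unit_ball.
Proof.
have cN : continuous (norm2 : 'rV[R]_n -> R^o).
  move=> y; apply: (smooth_continuous (U := setT)) => //.
  exact: smooth_norm2 openT.
have -> : unit_ball = (norm2 : 'rV[R]_n -> R^o) @^-1` [set x : R^o | x < 1] by [].
apply: open_comp => [y _|]; first exact: cN.
exact: open_lt.
Qed.

Let V := unit_ball.
Let w (y : 'rV[R]_n) : R := (1 - norm2 y)^-1.
Let H (y : 'rV[R]_n) i j := (i == j)%:R + y 0 i * y 0 j * w y.

Let oV : open V := open_unit_ball.

Lemma gap_neq0 y : V y -> 1 - norm2 y != 0.
Proof. by move=> Vy; rewrite subr_eq0 gt_eqF. Qed.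

Lemma smooth_w : smooth V (w : _ -> R^o).
Proof.
apply: smoothV => //; first exact: gap_neq0.
by apply: smoothB => //; [apply: smooth_cst|apply: smooth_norm2].
Qed.

Lemma pd_norm2 i y : V y -> pd i norm2 y = 2 * y 0 i.
Proof.
move=> Vy; have sc j : smooth V (fun z : 'rV[R]_n => z 0 j : R^o).
  exact: msmooth_id.
rewrite /norm2 (pd_sum oV i _ (fun j => smoothM oV (sc j) (sc j)) Vy).
rewrite (bigD1 i) //= big1 => [|j ji].
  by rewrite (pdM i (sc i) (sc i) Vy) pd_coord eqxx /=; ring.
by rewrite (pdM i (sc j) (sc j) Vy) pd_coord eq_sym (negPf ji) /=; ring.
Qed.

Lemma pd_w i y : V y -> pd i w y = 2 * y 0 i * w y ^+ 2.
Proof.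
move=> Vy; have sN := smooth_norm2 oV.
have s1N : smooth V (fun y => 1 - norm2 y : R^o).
  by apply: smoothB => //; apply: smooth_cst.
have E : pd i (fun y => w y * (1 - norm2 y)) y = 0.
  rewrite -(pd_cst i 1 y); apply: (eq_on_pd oV) Vy => z Vz.
  by rewrite /w mulVf // gap_neq0.
have d1N : pd i (fun y => 1 - norm2 y) y = - (2 * y 0 i).
  have s1 : smooth V (fun=> 1 : R^o) by exact: smooth_cst.
  have sM : smooth V (fun y => (-1) * norm2 y : R^o).
    by apply: smoothM => //; apply: smooth_cst.
  transitivity (pd i (fun y => 1 + (-1) * norm2 y) y).
    by apply: (eq_on_pd oV) Vy => z _; rewrite mulN1r.
  have sm1 : smooth V (fun=> -1 : R^o) by exact: smooth_cst.
  by rewrite (pdD i s1 sM Vy) (pdM i sm1 sN Vy) !pd_cst pd_norm2 //; ring.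
rewrite (pdM i smooth_w s1N Vy) d1N in E.
have wE : w y * (1 - norm2 y) = 1 by rewrite /w mulVf // gap_neq0.
have {}E : pd i w y * (1 - norm2 y) * w y = 2 * y 0 i * w y ^+ 2.
  have -> : pd i w y * (1 - norm2 y) = w y * (2 * y 0 i) by lra.
  by ring.
by rewrite -E -mulrA (mulrC _ (w y)) wE mulr1.
Qed.

Lemma round_metricE y i j : round_metric y i j = r ^+ 2 * H y i j.
Proof. by rewrite mxE. Qed.

Lemma smooth_H i j : smooth V (fun y => H y i j : R^o).
Proof.
apply: smoothD => //; first exact: smooth_cst.
by apply: smoothM => //; [apply: smoothM => //; apply: msmooth_id|exact: smooth_w].
Qed.

Lemma HC y i j : H y i j = H y j i.
Proof. by rewrite /H eq_sym; ring. Qed.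

Lemma pd_H i j l y : V y ->
  pd i (fun y => H y j l) y = w y * (H y i j * y 0 l + H y i l * y 0 j).
Proof.
move=> Vy; have sc k : smooth V (fun z : 'rV[R]_n => z 0 k : R^o).
  exact: msmooth_id.
have sjl := smoothM oV (sc j) (sc l).
have scst : smooth V (fun=> (j == l)%:R : R^o) by exact: smooth_cst.
rewrite /H (pdD i scst (smoothM oV sjl smooth_w) Vy) pd_cst.
rewrite (pdM i sjl smooth_w Vy) (pdM i (sc j) (sc l) Vy) !pd_coord pd_w //.
by ring.
Qed.

Lemma smooth_round : msmooth V round_metric.
Proof.
move=> i j; apply: (@smooth_ext _ _ _ oV _ (fun y => r ^+ 2 * H y i j : R^o)).
  by move=> y _; rewrite round_metricE.
by apply: smoothM => //; [apply: smooth_cst|apply: smooth_H].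
Qed.

Lemma riemannian_round : riemannian V round_metric.
Proof.
split.
- exact: smooth_round.
- by move=> y Vy; apply/matrixP => i j; rewrite mxE !round_metricE HC.
- move=> y Vy u u0.
  have -> : inner round_metric y u u
      = r ^+ 2 * (norm2 u + (\sum_i y 0 i * u 0 i) ^+ 2 * w y).
    rewrite innerE [X in _ + X * _]expr2 big_distrlr /= mulr_suml.
    rewrite /norm2 -big_split mulr_sumr; apply: eq_bigr => i _ /=.
    have -> : u 0 i * u 0 i = \sum_j (i == j)%:R * u 0 i * u 0 j.
      rewrite (bigD1 i) //= eqxx /= [X in _ + X]big1 => [|j ji]; first by ring.
      by rewrite eq_sym (negPf ji) /=; ring.
    rewrite mulr_suml -big_split mulr_sumr; apply: eq_bigr => j _ /=.
    by rewrite round_metricE /H; ring.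
  apply: mulr_gt0; first exact: exprn_gt0.
  apply: ltr_pwDl; last first.
    by rewrite mulr_ge0 ?sqr_ge0 // invr_ge0 subr_ge0 ltW.
  rewrite lt_def sumr_ge0 ?andbT => [|i _]; last exact: sqr_ge0.
  apply: contra u0 => /eqP; rewrite /norm2 => e.
  have /psumr_eq0P e' : forall i, true -> 0 <= u 0 i * u 0 i.
    by move=> i _; rewrite -expr2 sqr_ge0.
  apply/eqP/rowP => i; rewrite mxE; apply/eqP.
  by rewrite -sqrf_eq0 expr2 e'.
Qed.

(** Geodesics of the unit sphere satisfy c'' = - |c'|^2 c, and the projection to the hyperplane is
    linear; hence the Christoffel symbols H_ij y_k, which rescaling by the radius does not
    change. *)
Let C i (y : 'rV[R]_n) : 'M[R]_n := \matrix_(j, k) (H y i j * y 0 k).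

Lemma sum_H y l : V y -> \sum_k y 0 k * H y k l = y 0 l * w y.
Proof.
move=> Vy; rewrite /H; under eq_bigr do rewrite mulrDr.
rewrite big_split /= (bigD1 l) //= eqxx /= big1 => [|k kl]; last first.
  by rewrite (negPf kl) mulr0.
have -> : \sum_k y 0 k * (y 0 k * y 0 l * w y) = norm2 y * (y 0 l * w y).
  by rewrite /norm2 mulr_suml; apply: eq_bigr => k _; ring.
by rewrite /w; field; apply: gap_neq0.
Qed.

Lemma Gam_round i y : V y -> Gam round_metric i y = C i y.
Proof.
move=> Vy; apply: (Gam_unique (C := fun i => C i y)).
- exact: riemannian_sym riemannian_round _ Vy.
- exact: riemannian_unit riemannian_round _ Vy.
- move=> {}i; apply/matrixP => j l; rewrite mpdE.
  have CH a b : (C i y *m round_metric y) a b = r ^+ 2 * (H y i a * (y 0 b * w y)).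
    rewrite mxE -sum_H // mulr_sumr mulr_sumr; apply: eq_bigr => k _.
    by rewrite mxE round_metricE; ring.
  have -> : round_metric y *m (C i y)^T = (C i y *m round_metric y)^T.
    by rewrite trmx_mul (riemannian_sym riemannian_round Vy).
  rewrite [RHS]mxE [X in _ = _ + X]mxE !CH.
  transitivity (pd i (fun y => r ^+ 2 * H y j l) y).
    by apply: (eq_on_pd oV) Vy => z _; rewrite round_metricE.
  have sr : smooth V (fun=> r ^+ 2 : R^o) by exact: smooth_cst.
  rewrite (pdM i sr (smooth_H j l) Vy) pd_cst pd_H //.
  by ring.
- by move=> a b c; rewrite !mxE HC.
Qed.

Lemma Curv_round i j y k l : V y -> Curv round_metric i j y k l
  = H y j k * (i == l)%:R - H y i k * (j == l)%:R.
Proof.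
move=> Vy; rewrite CurvE !Gam_round //.
have dC a b : mpd a (Gam round_metric b) y k l
    = w y * (H y a b * y 0 k + H y a k * y 0 b) * y 0 l + H y b k * (a == l)%:R.
  rewrite mpdE; transitivity (pd a (fun y => H y b k * y 0 l) y).
    by apply: (eq_on_pd oV) Vy => z Vz; rewrite Gam_round // mxE.
  have sc : smooth V (fun z : 'rV[R]_n => z 0 l : R^o) by exact: msmooth_id.
  by rewrite (pdM a (smooth_H b k) sc Vy) pd_H // pd_coord.
have CC a b : (C a y *m C b y) k l = H y a k * (y 0 b * w y) * y 0 l.
  rewrite mxE -sum_H // mulr_sumr mulr_suml; apply: eq_bigr => m _.
  by rewrite !mxE (HC y b); ring.
have E (A B D F : 'M[R]_n) : (A - B + (D - F)) k l
    = A k l - B k l + (D k l - F k l) by rewrite !mxE.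
pose sb (a b : R) := a - b.
apply: etrans (E _ _ _ _) _.
apply: etrans (f_equal2 +%R (f_equal2 sb (dC i j) (dC j i))
  (f_equal2 sb (CC j i) (CC i j))) _.
rewrite /sb (HC y j i).
move: (H y i j) (H y j k) (H y i k) (w y) (y 0 k) (y 0 l) => *.
by ring.
Qed.

Lemma const_sectional_round : const_sectional (r ^+ 2)^-1 V round_metric.
Proof.
move=> y Vy u v rk.
have rr : r ^+ 2 != 0 by rewrite expf_neq0 // gt_eqF.
have rE : (fun i j k l => riem round_metric i j k l y) =
    (fun i j k l => (r ^+ 2)^-1 * (round_metric y i k * round_metric y j l
      - round_metric y i l * round_metric y j k)).
  apply/funext => i; apply/funext => j; apply/funext => k; apply/funext => l.
  have hs a b : round_metric y a b = round_metric y b a.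
    by rewrite !round_metricE HC.
  have HE a b : H y a b = (r ^+ 2)^-1 * round_metric y a b.
    by rewrite round_metricE mulKf.
  rewrite riemE mxE.
  transitivity (\sum_m (H y j l * ((i == m)%:R * round_metric y m k)
    - H y i l * ((j == m)%:R * round_metric y m k))).
    by apply: eq_bigr => m _; rewrite Curv_round //; ring.
  have pick a : \sum_m (a == m)%:R * round_metric y m k = round_metric y a k.
    rewrite (bigD1 a) //= eqxx /= [X in _ + X]big1 ?addr0 ?mul1r // => m ma.
    by rewrite eq_sym (negPf ma) /= mul0r.
  by rewrite sumrB -!mulr_sumr !pick !HE; ring.
have rg := riemannian_round.
(* The Gram determinant, nonzero because it is the product of the squared lengths of [v] and of the
   part of [u] orthogonal to [v]. *)
pose D := inner round_metric y u u * inner round_metric y v v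
  - inner round_metric y u v ^+ 2.
suff D0 : D != 0.
  have -> : sectional round_metric y u v
    = quad_form (fun i j k l => riem round_metric i j k l y) u v u v / D by [].
  rewrite rE.
  by rewrite quad_form_metric (innerC rg v u Vy) -expr2 -/D mulfK.
have free (a b : R) : a *: u + b *: v = 0 -> a = 0 /\ b = 0.
  move=> e; have /row_free_inj inj : row_free (col_mx u v) by rewrite /row_free rk.
  have : row_mx a%:M b%:M = 0 :> 'rV[R]_(1 + 1).
    apply: inj; rewrite mul0mx mul_row_col !mul_scalar_mx.
    exact: e.
  rewrite -row_mx0 => /eq_row_mx[/matrixP/(_ 0 0) ea /matrixP/(_ 0 0) eb].
  by move: ea eb; rewrite !mxE !mulr1n.
have v0 : v != 0.
  apply/eqP => v0; have e01 : 0 *: u + 1 *: v = 0 by rewrite v0 scaler0 scale0r addr0.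
  by have [_ /eqP] := free 0 1 e01; rewrite oner_eq0.
have vv := inner_gt0 rg Vy v0.
pose c := inner round_metric y u v / inner round_metric y v v.
have w0 : u - c *: v != 0.
  apply/eqP => e; have e1c : 1 *: u + (- c) *: v = 0 by rewrite scale1r scaleNr.
  by have [/eqP] := free 1 (- c) e1c; rewrite oner_eq0.
have ww := inner_gt0 rg Vy w0.
have DE : D = inner round_metric y (u - c *: v) (u - c *: v)
    * inner round_metric y v v.
  rewrite -scaleNr innerDl innerZl.
  rewrite (innerC rg u (_ + _) Vy) (innerC rg v (_ + _) Vy) !innerDl !innerZl.
  rewrite (innerC rg v u Vy) /D /c; field.
  by rewrite gt_eqF.
by rewrite DE gt_eqF // mulr_gt0.
Qed.

End RoundChart.

(** * Quaternionic charts and the Maurer-Cartan coframe *)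

Section QuaternionCharts.
Variables (R : realType) (eps : R).

(* [q0, q1, q2, q3] are the coordinates of a homomorphism to the elements of norm
   1 of the quaternion algebra with i^2 = -1, j^2 = k^2 = -eps, ij = k, jk = eps i
   and ki = j: for eps = 1 these form SU(2), for eps = -1 they form SL(2, R). *)
Record quaternion_chart (U : set 'rV[R]_4) (m : 'rV[R]_4 -> 'rV[R]_4 -> 'rV[R]_4)
    (q0 q1 q2 q3 s : 'rV[R]_4 -> R^o) : Prop := {
  qc_eps : eps ^+ 2 = 1 ;
  qc_smooth : [/\ smooth U q0, smooth U q1, smooth U q2, smooth U q3 & smooth U s] ;
  qc_norm : forall x, U x ->
    q0 x ^+ 2 + q1 x ^+ 2 + eps * (q2 x ^+ 2 + q3 x ^+ 2) = 1 ;
  qc_mul0 : forall x y, U x -> U y ->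
    q0 (m x y) = q0 x * q0 y - q1 x * q1 y - eps * (q2 x * q2 y + q3 x * q3 y) ;
  qc_mul1 : forall x y, U x -> U y ->
    q1 (m x y) = q0 x * q1 y + q1 x * q0 y + eps * (q2 x * q3 y - q3 x * q2 y) ;
  qc_mul2 : forall x y, U x -> U y ->
    q2 (m x y) = q0 x * q2 y + q2 x * q0 y + q3 x * q1 y - q1 x * q3 y ;
  qc_mul3 : forall x y, U x -> U y ->
    q3 (m x y) = q0 x * q3 y + q3 x * q0 y + q1 x * q2 y - q2 x * q1 y ;
  qc_muls : forall x y, U x -> U y -> s (m x y) = s x + s y ;
  qc_immersion : forall x v, U x -> 'D_v q0 x = 0 -> 'D_v q1 x = 0 ->
    'D_v q2 x = 0 -> 'D_v q3 x = 0 -> 'D_v s x = 0 -> v = 0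
}.

Definition quaternion_inj (U : set 'rV[R]_4) (q0 q1 q2 q3 s : 'rV[R]_4 -> R^o) :=
  forall x y, U x -> U y ->
  q0 x = q0 y -> q1 x = q1 y -> q2 x = q2 y -> q3 x = q3 y -> s x = s y -> x = y.

End QuaternionCharts.

Section MatrixGroups.
Variable R : realType.

Lemma det2 (S : comNzRingType) (A : 'M[S]_2) :
  \det A = A 0 0 * A 1 1 - A 0 1 * A 1 0.
Proof.
rewrite (expand_det_row _ 0) !big_ord_recl big_ord0 /cofactor !det_mx11 !mxE /=.
rewrite (_ : lift 0 0 = 1); last exact: val_inj.
rewrite (_ : lift 1 0 = 0); last exact: val_inj.
by rewrite addr0 expr0 expr1 mul1r mulN1r mulrN.
Qed.

Lemma mulmx2 (S : pzSemiRingType) (A B : 'M[S]_2) i j :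
  (A *m B) i j = A i 0 * B 0 j + A i 1 * B 1 j.
Proof.
by rewrite mxE !big_ord_recl big_ord0 addr0; congr (_ + A i _ * B _ j); exact: val_inj.
Qed.

Lemma forall_ord2 (P : 'I_2 -> Prop) : P 0 -> P 1 -> forall i, P i.
Proof.
by move=> P0 P1 [[|[|//]] lt];
  [rewrite (_ : Ordinal _ = 0); last exact: val_inj
  |rewrite (_ : Ordinal _ = 1); last exact: val_inj].
Qed.

(** A special unitary matrix is determined by its first row, which carries the four quaternion
    coordinates. *)
Lemma SU2_entries (A : 'M[R[i]]_2) : SU2 A ->
  A 1 1 = (A 0 0)^*%C /\ A 1 0 = - (A 0 1)^*%C.
Proof.
move=> [/matrixP AA]; rewrite det2 => dA.
have := AA 0 0; have := AA 1 0.
rewrite !mulmx2 !mxE /= => e10 e00; split.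
  move: dA e10 e00; move: (A 0 0) (A 0 1) (A 1 0) (A 1 1) => a b c d.
  move: (a^*)%C (b^*)%C => a' b' dA e10 e00.
  (* The combination equals d - a' once the unitarity and determinant relations are inserted, and it
     vanishes identically when expanded. The other entry is handled in the same way. *)
  apply/eqP; rewrite -subr_eq0; apply/eqP; transitivity
    (d * (a * a' + b * b') - a' * (a * d - b * c) - b * (c * a' + d * b')).
    by rewrite dA e00 e10; ring.
  by ring.
move: dA e10 e00; move: (A 0 0) (A 0 1) (A 1 0) (A 1 1) => a b c d.
move: (a^*)%C (b^*)%C => a' b' dA e10 e00.
apply/eqP; rewrite -subr_eq0; apply/eqP; transitivity
    (c * (a * a' + b * b') + b' * (a * d - b * c) - a * (c * a' + d * b')).
  by rewrite dA e00 e10; ring.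
by ring.
Qed.

Lemma ReD (x y : R[i]) : complex.Re (x + y) = complex.Re x + complex.Re y.
Proof. by case: x; case: y. Qed.
Lemma ImD (x y : R[i]) : complex.Im (x + y) = complex.Im x + complex.Im y.
Proof. by case: x; case: y. Qed.
Lemma ReM (x y : R[i]) : complex.Re (x * y)
  = complex.Re x * complex.Re y - complex.Im x * complex.Im y.
Proof. by case: x; case: y. Qed.
Lemma ImM (x y : R[i]) : complex.Im (x * y)
  = complex.Re x * complex.Im y + complex.Im x * complex.Re y.
Proof. by case: x; case: y. Qed.
Lemma ReN (x : R[i]) : complex.Re (- x) = - complex.Re x.
Proof. by case: x. Qed.
Lemma ImN (x : R[i]) : complex.Im (- x) = - complex.Im x.
Proof. by case: x. Qed.
Lemma ReJ (x : R[i]) : complex.Re (x^*)%C = complex.Re x.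
Proof. by case: x. Qed.
Lemma ImJ (x : R[i]) : complex.Im (x^*)%C = - complex.Im x.
Proof. by case: x. Qed.

Let reim := (ReD, ImD, ReM, ImM, ReN, ImN, ReJ, ImJ).

(** The first row of the matrix is (q0 + i q1, q2 + i q3); the determinant becomes the quaternion
    norm and the matrix product the quaternion product. *)
Lemma SU2_quaternion_chart (G : lie_group R) p s : local_iso_hom G (@SU2 R) p s ->
  quaternion_chart 1 (lg_dom G) (lg_mul G)
    (fun x => complex.Re (p x 0 0)) (fun x => complex.Im (p x 0 0))
    (fun x => complex.Re (p x 0 1)) (fun x => complex.Im (p x 0 1)) s.
Proof.
set U := lg_dom G; move=> [pS pM ps ss imm].
have oU : open U := @lg_dom_open _ G.
have E x : U x -> p x 1 1 = (p x 0 0)^*%C /\ p x 1 0 = - (p x 0 1)^*%C.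
  by move=> /pS/SU2_entries.
split => //.
- by rewrite expr1n.
- by have [? ?] := ps 0 0; have [? ?] := ps 0 1; split.
- move=> x Ux; have [e11 e10] := E x Ux; have [_] := pS x Ux.
  rewrite det2 e11 e10 => /(f_equal (@complex.Re R)); rewrite !reim /= => e.
  by rewrite -[RHS]e; ring.
- move=> x y Ux Uy; have [-> _] := pM x y Ux Uy; have [e11 e10] := E y Uy.
  by rewrite mulmx2 e10 !reim; ring.
- move=> x y Ux Uy; have [-> _] := pM x y Ux Uy; have [e11 e10] := E y Uy.
  by rewrite mulmx2 e10 !reim; ring.
- move=> x y Ux Uy; have [-> _] := pM x y Ux Uy; have [e11 e10] := E y Uy.
  by rewrite mulmx2 e11 !reim; ring.
- move=> x y Ux Uy; have [-> _] := pM x y Ux Uy; have [e11 e10] := E y Uy.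
  by rewrite mulmx2 e11 !reim; ring.
- by move=> x y Ux Uy; have [_ ->] := pM x y Ux Uy.
move=> x v Ux d0 d1 d2 d3 d4; apply: (imm x v Ux) => //.
have [r00 i00] := ps 0 0; have [r01 i01] := ps 0 1.
have DN (f : 'rV[R]_4 -> R^o) : smooth U f -> 'D_v f x = 0 ->
  'D_v (fun y => - f y : R^o) x = 0.
  by move=> sf f0; rewrite (@deriveN _ _ _ f) ?f0 ?oppr0 //; apply: smooth_derivable Ux.
apply: forall_ord2; apply: forall_ord2; first by split.
- by split.
- split.
    apply: etrans (DN _ r01 d2); apply: (eq_on_derive oU _ _ Ux) => y Uy.
    by have [_ ->] := E y Uy; rewrite !reim.
  apply: etrans d3; apply: (eq_on_derive oU _ _ Ux) => y Uy.
  by have [_ ->] := E y Uy; rewrite !reim opprK.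
split.
  apply: etrans d0; apply: (eq_on_derive oU _ _ Ux) => y Uy.
  by have [-> _] := E y Uy; rewrite !reim.
apply: etrans (DN _ i00 d1); apply: (eq_on_derive oU _ _ Ux) => y Uy.
by have [-> _] := E y Uy; rewrite !reim.
Qed.

Lemma SU2_quaternion_inj (G : lie_group R) p s : local_iso_hom G (@SU2 R) p s ->
  set_bij (lg_dom G) (@SU2 R `*` [set: R]) (fun x => (p x, s x)) ->
  quaternion_inj (lg_dom G)
    (fun x => complex.Re (p x 0 0)) (fun x => complex.Im (p x 0 0))
    (fun x => complex.Re (p x 0 1)) (fun x => complex.Im (p x 0 1)) s.
Proof.
move=> [pS _ _ _ _] [_ inj _] x y Ux Uy e0 e1 e2 e3 es.
apply: inj; rewrite ?inE //; congr pair => //.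
have a00 : p x 0 0 = p y 0 0.
  by move: e0 e1; case: (p x 0 0) => a b; case: (p y 0 0) => c d /= -> ->.
have a01 : p x 0 1 = p y 0 1.
  by move: e2 e3; case: (p x 0 1) => a b; case: (p y 0 1) => c d /= -> ->.
have [x11 x10] := SU2_entries (pS x Ux); have [y11 y10] := SU2_entries (pS y Uy).
apply/matrixP; apply: forall_ord2; apply: forall_ord2 => //.
  by rewrite x10 y10 a01.
by rewrite x11 y11 a00.
Qed.

(** The matrix has rows (q0 + q2, q1 - q3) and (- q1 - q3, q0 - q2), with determinant q0^2 + q1^2 -
    q2^2 - q3^2; the sign of q3 is the one for which ij = k. *)
Lemma SL2R_quaternion_chart (G : lie_group R) p s : local_iso_hom G (@SL2R R) p s ->
  quaternion_chart (-1) (lg_dom G) (lg_mul G)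
    (fun x => 2^-1 * (complex.Re (p x 0 0) + complex.Re (p x 1 1)))
    (fun x => 2^-1 * (complex.Re (p x 0 1) - complex.Re (p x 1 0)))
    (fun x => 2^-1 * (complex.Re (p x 0 0) - complex.Re (p x 1 1)))
    (fun x => - 2^-1 * (complex.Re (p x 0 1) + complex.Re (p x 1 0))) s.
Proof.
set U := lg_dom G; move=> [pS pM ps ss imm].
have oU : open U := @lg_dom_open _ G.
have rr i j : smooth U (fun x => complex.Re (p x i j) : R^o) by have [] := ps i j.
have i0 x i j : U x -> complex.Im (p x i j) = 0 by move=> /pS[].
have sZ (a : R) (f : 'rV[R]_4 -> R^o) : smooth U f -> smooth U (fun x => a * f x : R^o).
  by move=> sf; apply: smoothM => //; apply: smooth_cst.
have mulE x y i j : U x -> U y -> complex.Re (p (lg_mul G x y) i j)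
    = complex.Re (p x i 0) * complex.Re (p y 0 j)
    + complex.Re (p x i 1) * complex.Re (p y 1 j).
  move=> Ux Uy; have [-> _] := pM x y Ux Uy.
  by rewrite mulmx2 !reim !i0 // !mul0r !subr0.
split => //.
- by rewrite sqrrN expr1n.
- split => //; apply: sZ.
  + exact: smoothD.
  + exact: smoothB.
  + exact: smoothB.
  + exact: smoothD.
- move=> x Ux; have [] := pS x Ux.
  rewrite det2 => /(f_equal (@complex.Re R)); rewrite !reim !i0 //= => e _.
  by rewrite -[RHS]e; field.
- by move=> x y Ux Uy; rewrite !mulE //; field.
- by move=> x y Ux Uy; rewrite !mulE //; field.
- by move=> x y Ux Uy; rewrite !mulE //; field.
- by move=> x y Ux Uy; rewrite !mulE //; field.
- by move=> x y Ux Uy; have [_ ->] := pM x y Ux Uy.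
move=> x v Ux d0 d1 d2 d3 d4; apply: (imm x v Ux) => // i j.
split; last first.
  transitivity ('D_v (fun=> 0 : R^o) x); last by rewrite derive_cst.
  by apply: (eq_on_derive oU _ _ Ux) => y Uy; rewrite i0.
have DZ (a : R) (f : 'rV[R]_4 -> R^o) : smooth U f ->
    'D_v (fun y => a * f y : R^o) x = a * 'D_v f x.
  by move=> sf; apply: (@deriveZ _ _ _ f); apply: smooth_derivable Ux.
have DD (f h : 'rV[R]_4 -> R^o) : smooth U f -> smooth U h ->
    'D_v (fun y => f y + h y : R^o) x = 'D_v f x + 'D_v h x.
  by move=> sf sh; apply: (@deriveD _ _ _ f h); apply: smooth_derivable Ux.
have DB (f h : 'rV[R]_4 -> R^o) : smooth U f -> smooth U h ->
    'D_v (fun y => f y - h y : R^o) x = 'D_v f x - 'D_v h x.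
  by move=> sf sh; apply: (@deriveB _ _ _ f h); apply: smooth_derivable Ux.
have sD i1 j1 i2 j2 := smoothD oU (rr i1 j1) (rr i2 j2).
have sB i1 j1 i2 j2 := smoothB oU (rr i1 j1) (rr i2 j2).
have {d0} := d0; rewrite (DZ _ _ (sD 0 0 1 1)) (DD _ _ (rr 0 0) (rr 1 1)) => d0.
have {d1} := d1; rewrite (DZ _ _ (sB 0 1 1 0)) (DB _ _ (rr 0 1) (rr 1 0)) => d1.
have {d2} := d2; rewrite (DZ _ _ (sB 0 0 1 1)) (DB _ _ (rr 0 0) (rr 1 1)) => d2.
have {d3} := d3; rewrite (DZ _ _ (sD 0 1 1 0)) (DD _ _ (rr 0 1) (rr 1 0)) => d3.
have H (a b : R) : 2^-1 * (a + b) = 0 -> 2^-1 * (a - b) = 0 -> a = 0 /\ b = 0.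
  by move=> e f; split; clear -e f; lra.
have [a0 b0] := H _ _ d0 d2.
have /H/(_ d1)[c0 e0] : 2^-1 * ('D_v (fun x => complex.Re (p x 0 1) : R^o) x
    + 'D_v (fun x => complex.Re (p x 1 0) : R^o) x) = 0.
  by apply: oppr_inj; rewrite oppr0 -mulNr.
move: i j; apply: forall_ord2; apply: forall_ord2; assumption.
Qed.

(** Puts both groups on the same footing. Injectivity is tied to a positive [eps], since the
    universal covering of SL(2, R) x R is not injective. *)
Lemma quaternion_chart_exists (G : lie_group R) :
  is_univ_SL2R_times_R G \/ is_SU2_times_R G ->
  exists (eps : R) (q0 q1 q2 q3 s : 'rV[R]_4 -> R^o),
    quaternion_chart eps (lg_dom G) (lg_mul G) q0 q1 q2 q3 s /\
    (0 < eps -> eps = 1 /\ quaternion_inj (lg_dom G) q0 q1 q2 q3 s).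
Proof.
case=> [[_ [p [s iso]]]|[p [s [iso bij]]]].
  exists (-1); do 5 eexists; split; first exact: SL2R_quaternion_chart iso.
  by rewrite ltr0N1.
exists 1; do 5 eexists; split; first exact: SU2_quaternion_chart iso.
by move=> _; split=> //; apply: SU2_quaternion_inj iso bij.
Qed.

End MatrixGroups.

(** * The Maurer-Cartan form *)

Section MaurerCartan.
Variable R : realType.

Lemma derive_compE (V W Z : normedModType R) (f : V -> W) (h : W -> Z) x v :
  differentiable f x -> differentiable h (f x) ->
  'D_v (h \o f) x = 'D_('D_v f x) h (f x).
Proof.
move=> df dh; have dc : differentiable (h \o f) x by apply: differentiable_comp.
by rewrite (deriveE _ dc) diff_comp //= (deriveE _ df) (deriveE _ dh).
Qed.

Lemma derive_comb4 (V : normedModType R) (c0 c1 c2 c3 : R) (f0 f1 f2 f3 : V -> R^o) x v :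
  derivable f0 x v -> derivable f1 x v -> derivable f2 x v -> derivable f3 x v ->
  'D_v (fun y => c0 * f0 y + c1 * f1 y + c2 * f2 y + c3 * f3 y : R^o) x
  = c0 * 'D_v f0 x + c1 * 'D_v f1 x + c2 * 'D_v f2 x + c3 * 'D_v f3 x.
Proof.
move=> d0 d1 d2 d3.
have dZ c f : derivable f x v -> derivable (c *: f : V -> R^o) x v.
  by move=> df; apply: derivableZ.
rewrite -[LHS]/('D_v (c0 *: f0 + c1 *: f1 + c2 *: f2 + c3 *: f3) x).
have D01 := derivableD (dZ c0 _ d0) (dZ c1 _ d1).
have D012 := derivableD D01 (dZ c2 _ d2).
rewrite (deriveD D012 (dZ c3 _ d3)) (deriveD D01 (dZ c2 _ d2)).
by rewrite (deriveD (dZ c0 _ d0) (dZ c1 _ d1)) !deriveZ.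
Qed.

Variables (eps : R) (U : set 'rV[R]_4) (m : 'rV[R]_4 -> 'rV[R]_4 -> 'rV[R]_4).
Variables q0 q1 q2 q3 s : 'rV[R]_4 -> R^o.
Hypotheses (oU : open U) (qc : quaternion_chart eps U m q0 q1 q2 q3 s).

(** One imaginary component of conj a times d for quaternions a and d; cyclic rearrangement of the
    last three coordinates gives the other two, with [e] accounting for the square of the units. *)
Definition mc_entry (e a0 a1 a2 a3 d0 d1 d2 d3 : R) :=
  a0 * d1 - a1 * d0 - e * (a2 * d3 - a3 * d2).

(* The imaginary part of [conj q * dq], and ds. *)
Definition mc_coef (i c : 'I_4) (x : 'rV[R]_4) : R :=
  match c : nat with
  | 0 => mc_entry eps (q0 x) (q1 x) (q2 x) (q3 x)
           (pd i q0 x) (pd i q1 x) (pd i q2 x) (pd i q3 x)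
  | 1 => mc_entry 1 (q0 x) (q2 x) (q3 x) (q1 x)
           (pd i q0 x) (pd i q2 x) (pd i q3 x) (pd i q1 x)
  | 2 => mc_entry 1 (q0 x) (q3 x) (q1 x) (q2 x)
           (pd i q0 x) (pd i q3 x) (pd i q1 x) (pd i q2 x)
  | _ => pd i s x
  end.

Definition maurer_cartan (x : 'rV[R]_4) : 'M[R]_4 := \matrix_(i, c) mc_coef i c x.

Let s0 : smooth U q0. Proof. by case: (qc_smooth qc). Qed.
Let s1 : smooth U q1. Proof. by case: (qc_smooth qc). Qed.
Let s2 : smooth U q2. Proof. by case: (qc_smooth qc). Qed.
Let s3 : smooth U q3. Proof. by case: (qc_smooth qc). Qed.
Let ss : smooth U s. Proof. by case: (qc_smooth qc). Qed.

Lemma smooth_mc_entry e (f0 f1 f2 f3 h0 h1 h2 h3 : 'rV[R]_4 -> R^o) :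
  smooth U f0 -> smooth U f1 -> smooth U f2 -> smooth U f3 ->
  smooth U h0 -> smooth U h1 -> smooth U h2 -> smooth U h3 ->
  smooth U (fun x => mc_entry e (f0 x) (f1 x) (f2 x) (f3 x)
    (h0 x) (h1 x) (h2 x) (h3 x) : R^o).
Proof.
move=> *; apply: smoothB => //; first by apply: smoothB => //; apply: smoothM.
by apply: smoothM => //; [apply: smooth_cst|apply: smoothB => //; apply: smoothM].
Qed.

Lemma msmooth_maurer_cartan : msmooth U maurer_cartan.
Proof.
move=> i c.
have sp (f : 'rV[R]_4 -> R^o) : smooth U f -> smooth U (pd i f : _ -> R^o).
  exact: smooth_pd.
move: c; apply: ord4_ind;
  (apply: (smooth_ext oU); first by [move=> y _; rewrite mxE; reflexivity]) => /=.
- by apply: smooth_mc_entry => //; apply: sp.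
- by apply: smooth_mc_entry => //; apply: sp.
- by apply: smooth_mc_entry => //; apply: sp.
exact: sp.
Qed.

Lemma mulmx_maurer_cartan x v c : U x -> (v *m maurer_cartan x) 0 c =
  match c : nat with
  | 0 => mc_entry eps (q0 x) (q1 x) (q2 x) (q3 x)
           ('D_v q0 x) ('D_v q1 x) ('D_v q2 x) ('D_v q3 x)
  | 1 => mc_entry 1 (q0 x) (q2 x) (q3 x) (q1 x)
           ('D_v q0 x) ('D_v q2 x) ('D_v q3 x) ('D_v q1 x)
  | 2 => mc_entry 1 (q0 x) (q3 x) (q1 x) (q2 x)
           ('D_v q0 x) ('D_v q3 x) ('D_v q1 x) ('D_v q2 x)
  | _ => 'D_v s x
  end.
Proof.
move=> Ux; have dp (f : 'rV[R]_4 -> R^o) : smooth U f ->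
    'D_v f x = \sum_i v 0 i * pd i f x.
  by move=> sf; apply: derive_pd; apply: smooth_differentiable sf Ux.
have S (a0 a1 a2 a3 e : R) (f0 f1 f2 f3 : 'I_4 -> R) :
  \sum_i v 0 i * mc_entry e a0 a1 a2 a3 (f0 i) (f1 i) (f2 i) (f3 i)
  = mc_entry e a0 a1 a2 a3 (\sum_i v 0 i * f0 i) (\sum_i v 0 i * f1 i)
    (\sum_i v 0 i * f2 i) (\sum_i v 0 i * f3 i).
  by rewrite !sum_ord4 /mc_entry; ring.
rewrite mxE (dp _ s0) (dp _ s1) (dp _ s2) (dp _ s3) (dp _ ss).
by move: c; apply: ord4_ind => /=; rewrite -?S; apply: eq_bigr => i _; rewrite mxE.
Qed.

(** The real part of conj q dq is half the derivative of the norm, which is constant; the three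
    imaginary components therefore determine dq. *)
Lemma derive_norm_quaternion x v : U x ->
  q0 x * 'D_v q0 x + q1 x * 'D_v q1 x + eps * (q2 x * 'D_v q2 x + q3 x * 'D_v q3 x) = 0.
Proof.
move=> Ux.
pose N (y : 'rV[R]_4) : R^o := q0 y * q0 y + q1 y * q1 y + eps * (q2 y * q2 y + q3 y * q3 y).
have d (f : 'rV[R]_4 -> R^o) : smooth U f -> derivable f x v.
  by move=> sf; apply: smooth_derivable sf Ux.
have N0 : 'D_v N x = 0.
  transitivity ('D_v (fun=> 1 : R^o) x); last by rewrite derive_cst.
  by apply: (eq_on_derive oU _ _ Ux) => y Uy; rewrite -[RHS](qc_norm qc Uy) /N; ring.
have sM (f : 'rV[R]_4 -> R^o) : smooth U f -> smooth U (fun y => f y * f y : R^o).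
  by move=> sf; apply: smoothM.
have DM (f : 'rV[R]_4 -> R^o) : smooth U f ->
    'D_v (fun y => f y * f y : R^o) x = 2 * (f x * 'D_v f x).
  by move=> sf; rewrite (@deriveM _ _ f f); [rewrite mulr_natl mulr2n|exact: d|exact: d].
have e : N = (fun y => 1 * (q0 y * q0 y) + 1 * (q1 y * q1 y) + eps * (q2 y * q2 y)
    + eps * (q3 y * q3 y) : R^o) by apply/funext => y; rewrite /N; ring.
move: N0; rewrite e (@derive_comb4 _ 1 1 eps eps (fun y => q0 y * q0 y : R^o)
  (fun y => q1 y * q1 y : R^o) (fun y => q2 y * q2 y : R^o)
  (fun y => q3 y * q3 y : R^o)); [|exact: d (sM _ _)..].
rewrite (DM _ s0) (DM _ s1) (DM _ s2) (DM _ s3).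
move: ('D_v q0 x) ('D_v q1 x) ('D_v q2 x) ('D_v q3 x) => d0 d1 d2 d3.
move: (q0 x) (q1 x) (q2 x) (q3 x) => a0 a1 a2 a3; rewrite /GRing.scale /= => H.
apply: (mulfI (_ : 2 != 0)); first by rewrite pnatr_eq0.
by rewrite mulr0 -[RHS]H; ring.
Qed.

(* dq = q * (conj q * dq) *)
Lemma derive_quaternion x v : U x ->
  let w1 := mc_entry eps (q0 x) (q1 x) (q2 x) (q3 x)
           ('D_v q0 x) ('D_v q1 x) ('D_v q2 x) ('D_v q3 x) in
  let w2 := mc_entry 1 (q0 x) (q2 x) (q3 x) (q1 x)
           ('D_v q0 x) ('D_v q2 x) ('D_v q3 x) ('D_v q1 x) in
  let w3 := mc_entry 1 (q0 x) (q3 x) (q1 x) (q2 x)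
           ('D_v q0 x) ('D_v q3 x) ('D_v q1 x) ('D_v q2 x) in
  [/\ 'D_v q0 x = - q1 x * w1 - eps * (q2 x * w2 + q3 x * w3),
      'D_v q1 x = q0 x * w1 + eps * (q2 x * w3 - q3 x * w2),
      'D_v q2 x = q0 x * w2 + q3 x * w1 - q1 x * w3 &
      'D_v q3 x = q0 x * w3 + q1 x * w2 - q2 x * w1].
Proof.
move=> Ux; have N0 := derive_norm_quaternion v Ux; have N1 := qc_norm qc Ux.
have E2 := qc_eps qc.
move: N0 N1; move: ('D_v q0 x) ('D_v q1 x) ('D_v q2 x) ('D_v q3 x) => d0 d1 d2 d3.
move: (q0 x) (q1 x) (q2 x) (q3 x) => a0 a1 a2 a3 N0 N1 /=; rewrite /mc_entry.
have H (d a X : R) : d * (a0 ^+ 2 + a1 ^+ 2 + eps * (a2 ^+ 2 + a3 ^+ 2))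
    - a * (a0 * d0 + a1 * d1 + eps * (a2 * d2 + a3 * d3)) - X = 0 -> d = X.
  by rewrite N0 N1 mulr1 mulr0 subr0 => /subr0_eq.
have e1 : eps * eps = 1 by rewrite -expr2.
split; [apply: (H _ a0)|apply: (H _ a1)|apply: (H _ a2)|apply: (H _ a3)];
  ring: e1.
Qed.

(** A vector in the kernel makes conj q dq and ds vanish, hence dq = q (conj q dq) as well, and the
    immersion property applies. *)
Lemma maurer_cartan_unit x : U x -> maurer_cartan x \in unitmx.
Proof.
move=> Ux; rewrite -row_free_unit -kermx_eq0; apply/eqP/row_matrixP => i.
rewrite row0; set v := row i _.
have v0 : v *m maurer_cartan x = 0.
  by rewrite /v -row_mul mulmx_ker row0.
have [d0 d1 d2 d3] := derive_quaternion v Ux.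
have w c := mulmx_maurer_cartan v c Ux.
have := w (@Ordinal 4 0 isT); have := w (@Ordinal 4 1 isT).
have := w (@Ordinal 4 2 isT); have := w (@Ordinal 4 3 isT).
rewrite v0 !mxE /= => w3 w2 w1 w0.
move: d0 d1 d2 d3; rewrite -w0 -w1 -w2 => d0 d1 d2 d3.
apply: (qc_immersion qc Ux); first by rewrite d0; ring.
- by rewrite d1; ring.
- by rewrite d2; ring.
- by rewrite d3; ring.
by [].
Qed.

(** Left invariance: conj (a q) d(a q) = conj q (conj a a) dq, and a has norm 1. *)
Lemma maurer_cartan_translate a x v : U a -> U x -> U (m a x) ->
  differentiable (m a) x ->
  'D_v (m a) x *m maurer_cartan (m a x) = v *m maurer_cartan x.
Proof.
move=> Ua Ux Uax dm; set u := 'D_v (m a) x.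
have D (f : 'rV[R]_4 -> R^o) : smooth U f ->
    'D_u f (m a x) = 'D_v (fun y => f (m a y) : R^o) x.
  by move=> sf; exact: esym (derive_compE v dm (smooth_differentiable sf Uax)).
have E (f h : 'rV[R]_4 -> R^o) : smooth U f ->
    (forall y, U y -> f (m a y) = h y) -> 'D_u f (m a x) = 'D_v h x.
  move=> sf fh; apply: etrans (D f sf) _.
  by apply: (eq_on_derive oU _ _ Ux) => y Uy; exact: fh.
have d (f : 'rV[R]_4 -> R^o) : smooth U f -> derivable f x v.
  by move=> sf; apply: smooth_derivable sf Ux.
have L c0 c1 c2 c3 := derive_comb4 c0 c1 c2 c3 (d _ s0) (d _ s1) (d _ s2) (d _ s3).
have D0 := etrans (E q0 _ s0 _) (L (q0 a) (- q1 a) (- (eps * q2 a)) (- (eps * q3 a))).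
have D1 := etrans (E q1 _ s1 _) (L (q1 a) (q0 a) (- (eps * q3 a)) (eps * q2 a)).
have D2 := etrans (E q2 _ s2 _) (L (q2 a) (q3 a) (q0 a) (- q1 a)).
have D3 := etrans (E q3 _ s3 _) (L (q3 a) (- q2 a) (q1 a) (q0 a)).
have {}D0 := D0 ltac:(move=> y Uy; rewrite (qc_mul0 qc) //; ring).
have {}D1 := D1 ltac:(move=> y Uy; rewrite (qc_mul1 qc) //; ring).
have {}D2 := D2 ltac:(move=> y Uy; rewrite (qc_mul2 qc) //; ring).
have {}D3 := D3 ltac:(move=> y Uy; rewrite (qc_mul3 qc) //; ring).
have Ds : 'D_u s (m a x) = 'D_v s x.
  rewrite (E s (fun y => s a + s y : R^o) ss); last by move=> y Uy; exact: qc_muls qc _ _ Ua Uy.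
  rewrite (@deriveD _ _ _ (fun=> s a) s) ?derive_cst ?add0r //; first exact: d ss.
apply/rowP => c; rewrite !mulmx_maurer_cartan // D0 D1 D2 D3 Ds.
rewrite (qc_mul0 qc Ua Ux) (qc_mul1 qc Ua Ux) (qc_mul2 qc Ua Ux) (qc_mul3 qc Ua Ux).
have := qc_norm qc Ua.
move: ('D_v q0 x) ('D_v q1 x) ('D_v q2 x) ('D_v q3 x) ('D_v s x) => d0 d1 d2 d3 d4.
move: (q0 x) (q1 x) (q2 x) (q3 x) (q0 a) (q1 a) (q2 a) (q3 a).
move=> b0 b1 b2 b3 a0 a1 a2 a3 N.
have e1 : eps * eps = 1 by rewrite -expr2 (qc_eps qc).
have H (X Y : R) : X = (a0 ^+ 2 + a1 ^+ 2 + eps * (a2 ^+ 2 + a3 ^+ 2)) * Y -> X = Y.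
  by rewrite N mul1r.
by move: c; apply: ord4_ind => //=; apply: H; rewrite /mc_entry; ring: e1.
Qed.

(** Exterior derivative of f0 df1 - f1 df0 - e (f2 df3 - f3 df2); the second derivatives cancel by
    symmetry. *)
Lemma mc_entry_torsion i j x e (f0 f1 f2 f3 : 'rV[R]_4 -> R^o) :
  smooth U f0 -> smooth U f1 -> smooth U f2 -> smooth U f3 -> U x ->
  pd i (fun y => mc_entry e (f0 y) (f1 y) (f2 y) (f3 y)
    (pd j f0 y) (pd j f1 y) (pd j f2 y) (pd j f3 y)) x
  - pd j (fun y => mc_entry e (f0 y) (f1 y) (f2 y) (f3 y)
    (pd i f0 y) (pd i f1 y) (pd i f2 y) (pd i f3 y)) x
  = 2 * (pd i f0 x * pd j f1 x - pd j f0 x * pd i f1 x)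
    - 2 * e * (pd i f2 x * pd j f3 x - pd j f2 x * pd i f3 x).
Proof.
move=> sf0 sf1 sf2 sf3 Ux.
have E k l : pd k (fun y => mc_entry e (f0 y) (f1 y) (f2 y) (f3 y)
    (pd l f0 y) (pd l f1 y) (pd l f2 y) (pd l f3 y)) x =
    mc_entry e (f0 x) (f1 x) (f2 x) (f3 x)
      (pd k (pd l f0) x) (pd k (pd l f1) x) (pd k (pd l f2) x) (pd k (pd l f3) x)
    + mc_entry e (pd k f0 x) (pd k f1 x) (pd k f2 x) (pd k f3 x)
      (pd l f0 x) (pd l f1 x) (pd l f2 x) (pd l f3 x).
  have sp (f : 'rV[R]_4 -> R^o) : smooth U f -> smooth U (pd l f : _ -> R^o) by exact: smooth_pd.
  have P (f h : 'rV[R]_4 -> R^o) (sf : smooth U f) (sh : smooth U h) :=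
    pdM k sf (sp h sh) Ux.
  have sP (f h : 'rV[R]_4 -> R^o) : smooth U f -> smooth U h ->
      smooth U (fun y => f y * pd l h y : R^o).
    by move=> sf sh; apply: smoothM => //; apply: sp.
  have sN (c : R) (f : 'rV[R]_4 -> R^o) : smooth U f -> smooth U (fun y => c * f y : R^o).
    by move=> sf; apply: smoothM => //; apply: smooth_cst.
  have PN (c : R) (f : 'rV[R]_4 -> R^o) : smooth U f -> pd k (fun y => c * f y) x = c * pd k f x.
    move=> sf; rewrite (pdM k (smooth_cst oU (c : R^o)) sf Ux) pd_cst.
    by rewrite mul0r add0r.
  transitivity (pd k (fun y => (f0 y * pd l f1 y + (-1) * (f1 y * pd l f0 y))
     + (- e * (f2 y * pd l f3 y) + e * (f3 y * pd l f2 y))) x).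
    apply: (f_equal (fun h : _ -> R => pd k h x)); apply/funext => y.
    by rewrite /mc_entry; ring.
  have a1 := sP _ _ sf0 sf1; have a2 := sP _ _ sf1 sf0.
  have a3 := sP _ _ sf2 sf3; have a4 := sP _ _ sf3 sf2.
  have b2 := sN (-1) _ a2; have b3 := sN (- e) _ a3; have b4 := sN e _ a4.
  rewrite (pdD k (smoothD oU a1 b2) (smoothD oU b3 b4) Ux).
  rewrite (pdD k a1 b2 Ux) (pdD k b3 b4 Ux) (PN _ _ a2) (PN _ _ a3) (PN _ _ a4).
  rewrite (P _ _ sf0 sf1) (P _ _ sf1 sf0) (P _ _ sf2 sf3) (P _ _ sf3 sf2).
  move: (pd k (pd l f0) x) (pd k (pd l f1) x) (pd k (pd l f2) x) (pd k (pd l f3) x).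
  move: (pd k f0 x) (pd k f1 x) (pd k f2 x) (pd k f3 x).
  move: (pd l f0 x) (pd l f1 x) (pd l f2 x) (pd l f3 x).
  by move: (f0 x) (f1 x) (f2 x) (f3 x) => *; rewrite /mc_entry; ring.
rewrite (E i j) (E j i) (pdC oU i j sf0 Ux) (pdC oU i j sf1 Ux).
rewrite (pdC oU i j sf2 Ux) (pdC oU i j sf3 Ux).
move: (pd j (pd i f0) x) (pd j (pd i f1) x) (pd j (pd i f2) x) (pd j (pd i f3) x).
move: (pd i f0 x) (pd i f1 x) (pd i f2 x) (pd i f3 x).
move: (pd j f0 x) (pd j f1 x) (pd j f2 x) (pd j f3 x).
by move: (f0 x) (f1 x) (f2 x) (f3 x) => *; rewrite /mc_entry; ring.
Qed.

(** The Maurer-Cartan equation. The constants come from [j, k] = 2 eps i, [k, i] = 2 j and [i, j] =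
    2 k, and ds is closed. *)
Lemma maurer_cartan_torsion x : U x -> forall i j a,
  mpd i maurer_cartan x j a - mpd j maurer_cartan x i a
  = - \sum_b \sum_c maurer_cartan x i b * maurer_cartan x j c
      * lie_struct (2 * eps) 2 2 0 0 0 b c a.
Proof.
move=> Ux i j.
have dq k := derive_quaternion (delta_mx 0 k) Ux.
have W k c : maurer_cartan x k c = ((delta_mx 0 k : 'rV_4) *m maurer_cartan x) 0 c.
  by rewrite -rowE [RHS]mxE.
pose o0 := @Ordinal 4 0 isT; pose o1 := @Ordinal 4 1 isT.
pose o2 := @Ordinal 4 2 isT.
have {dq} dq k : [/\ pd k q0 x = - q1 x * maurer_cartan x k o0
      - eps * (q2 x * maurer_cartan x k o1 + q3 x * maurer_cartan x k o2),
    pd k q1 x = q0 x * maurer_cartan x k o0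
      + eps * (q2 x * maurer_cartan x k o2 - q3 x * maurer_cartan x k o1),
    pd k q2 x = q0 x * maurer_cartan x k o1 + q3 x * maurer_cartan x k o0
      - q1 x * maurer_cartan x k o2 &
    pd k q3 x = q0 x * maurer_cartan x k o2 + q1 x * maurer_cartan x k o1
      - q2 x * maurer_cartan x k o0].
  by have := dq k; rewrite !W !mulmx_maurer_cartan // !pdE.
have [i0 i1 i2 i3] := dq i; have [j0 j1 j2 j3] := dq j.
have e1 : eps * eps = 1 by rewrite -expr2 (qc_eps qc).
have N := qc_norm qc Ux.
(* After substituting dq = q (conj q dq), the left-hand side is quadratic in q while the right-hand
   side is free of it; the factor of norm 1 restores homogeneity. *)
have H (X Y : R) : X = (q0 x ^+ 2 + q1 x ^+ 2 + eps * (q2 x ^+ 2 + q3 x ^+ 2)) * Y -> X = Y.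
  by rewrite N mul1r.
have T (A B A' B' X : R) : A' = A -> B' = B -> A - B = X -> A' - B' = X.
  by move=> -> ->.
have M k l a : mpd k maurer_cartan x l a = pd k (mc_coef l a) x.
  rewrite mpdE; apply: (f_equal (fun h => pd k h x)); apply/funext => y.
  by rewrite mxE.
move=> a; apply: T (M i j a) (M j i a) _; move: a; apply: ord4_ind.
- apply: etrans (mc_entry_torsion i j eps s0 s1 s2 s3 Ux) _.
  rewrite i0 i1 i2 i3 j0 j1 j2 j3 !sum_ord4 /o0 /o1 /o2 /lie_struct /=.
  move: (maurer_cartan x) => O; apply: H; ring: e1.
- apply: etrans (mc_entry_torsion i j 1 s0 s2 s3 s1 Ux) _.
  rewrite i0 i1 i2 i3 j0 j1 j2 j3 !sum_ord4 /o0 /o1 /o2 /lie_struct /=.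
  move: (maurer_cartan x) => O; apply: H; ring: e1.
- apply: etrans (mc_entry_torsion i j 1 s0 s3 s1 s2 Ux) _.
  rewrite i0 i1 i2 i3 j0 j1 j2 j3 !sum_ord4 /o0 /o1 /o2 /lie_struct /=.
  move: (maurer_cartan x) => O; apply: H; ring: e1.
apply: etrans (etrans (f_equal (fun z => z - _) (pdC oU i j ss Ux)) (subrr _)) _.
by rewrite !sum_ord4 /lie_struct /=; ring.
Qed.

End MaurerCartan.

(** * Left-invariant fields and metrics *)

Section LieGroupCalculus.
Variables (R : realType) (G : lie_group R).
Notation U := (lg_dom G).
Let oU : open U := @lg_dom_open _ G.

Lemma lg_mulrV x : U x -> lg_mul G x (lg_inv G x) = lg_one G.
Proof.
move=> Ux; have Ui := lg_dom_inv Ux; have Uii := lg_dom_inv Ui.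
have Up := lg_dom_mul Ux Ui.
rewrite -{1}(lg_mul1 Up) -{1}(lg_mulV Ui) -(lg_mulA Uii Ui Up) (lg_mulA Ui Ux Ui).
by rewrite lg_mulV // lg_mul1 // lg_mulV.
Qed.

Lemma lg_mulr1 x : U x -> lg_mul G x (lg_one G) = x.
Proof.
move=> Ux; have Ui := lg_dom_inv Ux.
by rewrite -{1}(lg_mulV Ux) (lg_mulA Ux Ui Ux) lg_mulrV // lg_mul1.
Qed.

Lemma differentiable_lg_mul a x : U a -> U x -> differentiable (lg_mul G a) x.
Proof.
move=> Ua Ux.
have dm : differentiable (fun p : 'rV[R]_4 * 'rV[R]_4 => lg_mul G p.1 p.2) (a, x).
  by apply: (smooth_differentiable (@lg_mul_smooth _ G)).
by apply: (@differentiable_comp _ _ _ _ (fun y => (a, y)) (fun p => lg_mul G p.1 p.2)).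
Qed.

Lemma derive_mpd n p q (V : set 'rV[R]_n) (Y : 'rV[R]_n -> 'M[R]_(p, q)) x v :
  open V -> smooth V Y -> V x -> 'D_v Y x = \sum_i v 0 i *: mpd i Y x.
Proof.
move=> oV sY Vx; apply/matrixP => a b; rewrite summxE.
rewrite derive_entry; last exact: smooth_differentiable sY Vx.
rewrite derive_pd; last first.
  by apply: differentiable_entry; apply: smooth_differentiable sY Vx.
by apply: eq_bigr => i _; rewrite mxE mpdE.
Qed.

Variables (Th : 'rV[R]_4 -> 'M[R]_4) (S : 'I_4 -> 'I_4 -> 'I_4 -> R).
Hypothesis sTh : msmooth U Th.
Hypothesis torsion : forall x, U x -> forall i j a,
  mpd i Th x j a - mpd j Th x i a = - \sum_b \sum_c Th x i b * Th x j c * S b c a.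

(** Cartan's formula: when th(X) and th(Y) are constant, th([X, Y]) = - dth(X, Y), and the exterior
    derivative is given by the constants [S]. *)
Lemma lie_bracket_coframe (X Y : 'rV[R]_4 -> 'rV[R]_4) (u v : 'rV[R]_4) x c :
  smooth U X -> smooth U Y ->
  (forall y, U y -> X y *m Th y = u) -> (forall y, U y -> Y y *m Th y = v) -> U x ->
  (lie_bracket X Y x *m Th x) 0 c = \sum_b \sum_d u 0 b * v 0 d * S b d c.
Proof.
move=> sX sY Xu Yv Ux.
have F r (A : 'rV[R]_4) (B : 'M[R]_4) :
    (r *: - (A *m B)) 0 c = - \sum_j r * A 0 j * B j c.
  by rewrite !mxE mulrN mulr_sumr; congr (- _); apply: eq_bigr => j _; rewrite mulrA.
have H (Z Z' : 'rV[R]_4 -> 'rV[R]_4) (w : 'rV[R]_4) : smooth U Z -> smooth U Z' ->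
    (forall y, U y -> Z y *m Th y = w) ->
    ('D_(Z' x) Z x *m Th x) 0 c = - \sum_i \sum_j Z' x 0 i * Z x 0 j * mpd i Th x j c.
  move=> sZ sZ' Zw; rewrite (derive_mpd _ oU sZ Ux).
  have mZ : msmooth U Z by apply/(smooth_mxP _ oU).
  rewrite mulmx_suml summxE -sumrN; apply: eq_bigr => i _.
  (* Differentiating the constancy of Z Th trades derivatives of the field for derivatives of the
     coframe. *)
  have e : mpd i Z x *m Th x + Z x *m mpd i Th x = 0.
    rewrite -(mpdM oU i mZ sTh Ux) -(mpd_cst i w x).
    exact: (eq_on_mpd oU i Zw Ux).
  have {}e : mpd i Z x *m Th x = - (Z x *m mpd i Th x).
    by apply/eqP; rewrite -addr_eq0 e.
  by rewrite -scalemxAl e F.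
have E (A B : 'rV[R]_4) : ((A - B) *m Th x) 0 c = (A *m Th x) 0 c - (B *m Th x) 0 c.
  by rewrite mulmxBl !mxE.
rewrite /lie_bracket E (H _ _ _ sY sX Yv) (H _ _ _ sX sY Xu).
rewrite opprK [X in _ + X]exchange_big /= addrC -sumrB.
transitivity (\sum_i \sum_j X x 0 i * Y x 0 j
    * \sum_b \sum_d Th x i b * Th x j d * S b d c).
  apply: eq_bigr => i _; rewrite -sumrB; apply: eq_bigr => j _.
  have t := f_equal -%R (torsion Ux i j c); rewrite opprK in t; rewrite -{}t.
  by move: (mpd i Th x j c) (mpd j Th x i c) => *; ring.
rewrite -(Xu x Ux) -(Yv x Ux).
transitivity (\sum_i \sum_j \sum_b \sum_d
   X x 0 i * Y x 0 j * (Th x i b * Th x j d * S b d c)).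
  by do 2! [apply: eq_bigr => ? _]; rewrite mulr_sumr; apply: eq_bigr => b _; rewrite mulr_sumr.
transitivity (\sum_i \sum_b \sum_j \sum_d
   X x 0 i * Y x 0 j * (Th x i b * Th x j d * S b d c)).
  by apply: eq_bigr => i _; rewrite exchange_big.
rewrite exchange_big; apply: eq_bigr => b _.
transitivity (\sum_i \sum_d \sum_j
   X x 0 i * Y x 0 j * (Th x i b * Th x j d * S b d c)).
  by apply: eq_bigr => i _; rewrite exchange_big.
rewrite exchange_big; apply: eq_bigr => d _.
rewrite !mxE !mulr_suml; apply: eq_bigr => i _.
by rewrite mulr_sumr mulr_suml; apply: eq_bigr => j _; ring.
Qed.

End LieGroupCalculus.

Section LeftInvariant.
Variables (R : realType) (G : lie_group R) (eps : R).
Variables q0 q1 q2 q3 s : 'rV[R]_4 -> R^o.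
Notation U := (lg_dom G).
Hypothesis qc : quaternion_chart eps U (lg_mul G) q0 q1 q2 q3 s.
Let oU : open U := @lg_dom_open _ G.
Notation Om := (maurer_cartan eps q0 q1 q2 q3 s).

Lemma maurer_cartan_left a v : U a ->
  'D_v (lg_mul G a) (lg_one G) *m Om a = v *m Om (lg_one G).
Proof.
move=> Ua; have U1 := @lg_dom_one _ G.
have := maurer_cartan_translate oU qc v Ua U1 (lg_dom_mul Ua U1)
  (differentiable_lg_mul Ua U1).
by rewrite lg_mulr1.
Qed.

Lemma left_invariant_field_coframe X : left_invariant_field G X -> forall x, U x ->
  X x *m Om x = X (lg_one G) *m Om (lg_one G).
Proof.
move=> [_ LX] x Ux; rewrite -(maurer_cartan_left _ Ux).
by rewrite -(LX x) ?lg_mulr1 //; apply: lg_dom_one.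
Qed.

Lemma eq_mx_form n (A B : 'M[R]_n) :
  (forall u v : 'rV[R]_n, (u *m A *m v^T) 0 0 = (u *m B *m v^T) 0 0) -> A = B.
Proof.
move=> AB; apply/matrixP => i j; have := AB (delta_mx 0 i) (delta_mx 0 j).
by rewrite -!rowE trmx_delta -!colE !mxE.
Qed.

(** [K] is the metric at the identity expressed in the coframe; left translations carry metric and
    coframe along together. *)
Lemma left_invariant_gram g : left_invariant_metric G g ->
  exists K : 'M[R]_4, [/\ K^T = K, (forall u : 'rV[R]_4, u != 0 -> 0 < (u *m K *m u^T) 0 0) &
    forall x, U x -> g x = Om x *m K *m (Om x)^T].
Proof.
move=> [rg Lg]; have U1 := @lg_dom_one _ G.
have u1 := maurer_cartan_unit oU qc U1; set O1 := Om (lg_one G) in u1.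
exists (invmx O1 *m g (lg_one G) *m (invmx O1)^T); split.
- by rewrite !trmx_mul trmxK (riemannian_sym rg U1) mulmxA.
- move=> u u0; have v0 : u *m invmx O1 != 0.
    by apply: contraNneq u0 => e; rewrite -(mulmxKV u1 u) e mul0mx.
  by have := inner_gt0 rg U1 v0; rewrite /inner trmx_mul !mulmxA.
move=> x Ux; apply: eq_mx_form => u v; have ux := maurer_cartan_unit oU qc Ux.
(* Identifies the tangent vector at the identity that left translation by [x] carries to [w]. *)
have D w : 'D_(w *m Om x *m invmx O1) (lg_mul G x) (lg_one G) = w.
  apply: (can_inj (mulmxK ux)).
  by apply: etrans (maurer_cartan_left _ Ux) _; rewrite mulmxKV.
have := Lg x _ Ux U1 (u *m Om x *m invmx O1) (v *m Om x *m invmx O1).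
rewrite lg_mulr1 // !D /inner => ->.
by rewrite !trmx_mul !mulmxA.
Qed.

End LeftInvariant.

(** * Adapted frames *)

Section SimultaneousDiagonalization.
Variable R : realType.

Definition posdef n (A : 'M[R]_n) :=
  forall u : 'rV[R]_n, u != 0 -> 0 < (u *m A *m u^T) 0 0.

Lemma form_sym n (A : 'M[R]_n) (u v : 'rV[R]_n) : A^T = A ->
  (u *m A *m v^T) 0 0 = (v *m A *m u^T) 0 0.
Proof.
by move=> sA; rewrite -{2}sA -mulmxA -[v in RHS]trmxK -!trmx_mul [RHS]mxE mulmxA.
Qed.

(* A complex root z of det (B - z A) has an eigenvector x + i y; comparing the
   two expressions of x B y^T gives Im z (x A x^T + y A y^T) = 0. *)
Lemma relative_eigenvector n (A B : 'M[R]_n.+1) : A^T = A -> posdef A -> B^T = B ->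
  exists a (v : 'rV[R]_n.+1), v != 0 /\ v *m B = a *: (v *m A).
Proof.
move=> sA pA sB.
have uA : A \in unitmx.
  rewrite -row_free_unit -kermx_eq0; apply: contraT => /rowV0Pn[v].
  by move=> /sub_kermxP vA /pA; rewrite vA mul0mx mxE ltxx.
pose M := map_mx (real_complex R) (B *m invmx A).
have [z /eigenvalueP[w wM w0]] := eigenvalue_closed M (ltn0Sn n).
pose x := map_mx (@complex.Re R) w; pose y := map_mx (@complex.Im R) w.
have Resum (I : Type) (r : seq I) (F : I -> R[i]) :
  complex.Re (\sum_(i <- r) F i) = \sum_(i <- r) complex.Re (F i).
  by apply: (big_morph (@complex.Re R)) => // -[? ?] [? ?].
have Imsum (I : Type) (r : seq I) (F : I -> R[i]) :
  complex.Im (\sum_(i <- r) F i) = \sum_(i <- r) complex.Im (F i).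
  by apply: (big_morph (@complex.Im R)) => // -[? ?] [? ?].
have ReZ (c : R[i]) (r : R) : complex.Re (c * r%:C%C) = complex.Re c * r.
  by case: c => a b /=; rewrite mulr0 subr0.
have ImZ (c : R[i]) (r : R) : complex.Im (c * r%:C%C) = complex.Im c * r.
  by case: c => a b /=; rewrite mulr0 add0r.
have xB : x *m B = (complex.Re z *: x - complex.Im z *: y) *m A.
  rewrite -[LHS](mulmxKV uA); congr (_ *m A); apply/rowP => j.
  rewrite -mulmxA; transitivity (complex.Re ((w *m M) 0 j)).
    by rewrite [in RHS]mxE Resum mxE; apply: eq_bigr => k _; rewrite !mxE ReZ.
  by rewrite wM !mxE; case: z (w 0 j) {wM} => a b [c d].
have yB : y *m B = (complex.Im z *: x + complex.Re z *: y) *m A.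
  rewrite -[LHS](mulmxKV uA); congr (_ *m A); apply/rowP => j.
  rewrite -mulmxA; transitivity (complex.Im ((w *m M) 0 j)).
    by rewrite [in RHS]mxE Imsum mxE; apply: eq_bigr => k _; rewrite !mxE ImZ.
  by rewrite wM !mxE; case: z (w 0 j) {wM xB} => a b [c d] /=; rewrite addrC.
have xy0 : (x != 0) || (y != 0).
  rewrite -negb_and; apply: contra w0 => /andP[/eqP x0 /eqP y0]; apply/eqP/rowP => j.
  have := congr1 (fun u : 'rV[R]_n.+1 => u 0 j) x0.
  have := congr1 (fun u : 'rV[R]_n.+1 => u 0 j) y0.
  by rewrite !mxE; case: (w 0 j) => a b /= -> ->.
have nn (u : 'rV[R]_n.+1) : 0 <= (u *m A *m u^T) 0 0.
  by have [->|u0] := eqVneq u 0; [rewrite !mul0mx mxE|rewrite ltW // pA].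
have P : 0 < (x *m A *m x^T) 0 0 + (y *m A *m y^T) 0 0.
  by case/orP: xy0 => /pA p; [rewrite ltr_wpDr|rewrite ltr_wpDl].
have z0 : complex.Im z = 0.
  have L (a b : R) (u v t : 'rV[R]_n.+1) : ((a *: u + b *: v) *m A *m t^T) 0 0
      = a * (u *m A *m t^T) 0 0 + b * (v *m A *m t^T) 0 0.
    by rewrite !mulmxDl -!scalemxAl !mxE.
  have e := form_sym x y sB; move: e; rewrite xB yB -scaleNr !L (form_sym y x sA) => e.
  have /eqP : complex.Im z * ((x *m A *m x^T) 0 0 + (y *m A *m y^T) 0 0) = 0.
    by move: e; move: ((x *m A *m y^T) 0 0) => c e; rewrite mulrDr; lra.
  by rewrite mulf_eq0 (gt_eqF P) orbF => /eqP.
exists (complex.Re z); case/orP: xy0 => n0.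
  by exists x; rewrite xB z0 scale0r subr0 scalemxAl.
by exists y; rewrite yB z0 scale0r add0r scalemxAl.
Qed.

Lemma congr_sym m n (A : 'M[R]_n) (T : 'M[R]_(m, n)) : A^T = A ->
  (T *m A *m T^T)^T = T *m A *m T^T.
Proof. by move=> sA; rewrite !trmx_mul trmxK sA mulmxA. Qed.

Lemma congr_posdef n (A T : 'M[R]_n) : T \in unitmx -> posdef A ->
  posdef (T *m A *m T^T).
Proof.
move=> uT pA u u0; have /pA : u *m T != 0.
  by apply: contraNneq u0 => e; rewrite -(mulmxK uT u) e mul0mx.
by rewrite trmx_mul !mulmxA.
Qed.

(** Induction on the size. A relative eigenvector as first basis vector makes the first row of [B1]
    a multiple of that of [A1], so a single elimination step splits off the first coordinate in both
    matrices. *)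
Lemma simultaneous_diag n (A B : 'M[R]_n) : A^T = A -> posdef A -> B^T = B ->
  exists (T : 'M[R]_n) (d : 'rV[R]_n),
    [/\ T \in unitmx, T *m A *m T^T = 1%:M & T *m B *m T^T = diag_mx d].
Proof.
elim: n A B => [|n IH] A B sA pA sB.
  exists 1%:M, 0; split; first exact: unitmx1.
    by apply/matrixP => -[].
  by apply/matrixP => -[].
have [a [v [v0 vB]]] := relative_eigenvector sA pA sB.
(* An invertible matrix whose first row is proportional to [v]. *)
pose T1 : 'M[R]_(1 + n) := row_ebase v.
have u1 : T1 \in unitmx by apply: row_ebase_unit.
pose A1 : 'M[R]_(1 + n) := T1 *m A *m T1^T; pose B1 : 'M[R]_(1 + n) := T1 *m B *m T1^T.
have sA1 : A1^T = A1 by apply: congr_sym.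
have sB1 : B1^T = B1 by apply: congr_sym.
have pA1 : posdef A1 by apply: congr_posdef.
have e1 : usubmx B1 = a *: usubmx A1.
  have vE : v = col_ebase v 0 0 *: usubmx T1.
    have pT (T : 'M[R]_(1 + n)) : (pid_mx 1 : 'M[R]_(1, 1 + n)) *m T = usubmx T.
      by rewrite -[T in LHS]vsubmxK pid_mx_row mul_row_col mul0mx addr0 mul1mx.
    rewrite -[LHS]mulmx_ebase rank_rV v0 {1}[col_ebase v]mx11_scalar.
    by rewrite -mulmxA mul_scalar_mx -pT.
  have c0 : col_ebase v 0 0 != 0.
    by apply: contraNneq v0 => e; rewrite vE e scale0r.
  move: vB; rewrite vE -!scalemxAl scalerA mulrC -scalerA => /(scalerI c0) e.
  rewrite /A1 /B1 -[T1]vsubmxK; move: (dsubmx T1) (usubmx T1) e => t2 t1 e.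
  by rewrite !mul_col_mx !col_mxKu e -scalemxAl.
pose b := ursubmx A1; pose d := drsubmx A1; pose d' := drsubmx B1.
pose al := ulsubmx A1 0 0.
have A1E : A1 = block_mx al%:M b b^T d.
  by rewrite -[LHS]submxK /b /al -mx11_scalar trmx_ursub sA1.
have B1E : B1 = block_mx (a * al)%:M (a *: b) (a *: b^T) d'.
  have ul : ulsubmx B1 = a *: ulsubmx A1 by rewrite /ulsubmx e1 linearZ.
  have ur : ursubmx B1 = a *: b by rewrite /b /ursubmx e1 linearZ.
  rewrite -[LHS]submxK ul ur -[dlsubmx B1]trmxK -/d'.
  rewrite trmx_dlsub sB1 ur [ulsubmx A1]mx11_scalar -/al scale_scalar_mx.
  by rewrite linearZ.
have al0 : 0 < al.
  have n0 : (row_mx 1%:M 0 : 'rV[R]_(1 + n)) != 0.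
    apply/eqP; rewrite -[RHS]row_mx0 => /eq_row_mx[/matrixP/(_ 0 0) /eqP].
    by rewrite !mxE oner_eq0.
  have := pA1 _ n0; rewrite A1E mul_row_block !mul1mx !mul0mx !addr0.
  by rewrite tr_row_mx mul_row_col trmx1 trmx0 mulmx1 mulmx0 addr0 mxE mulr1n.
(* Elimination coefficients for [A1]; they clear the first row and column of [B1] too, as these are
   [a] times those of [A1]. *)
pose c := al^-1 *: b^T.
have cT : c^T = al^-1 *: b by rewrite /c linearZ /= trmxK.
pose T2 : 'M[R]_(1 + n) := block_mx 1%:M 0 (- c) 1%:M.
have T2T : T2^T = block_mx 1%:M (- c^T) 0 1%:M.
  by rewrite tr_block_mx !trmx1 trmx0 linearN.
have u2 : T2 \in unitmx.
  by rewrite unitmxE det_lblock !det1 mulr1 unitr1.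
pose A2 := d - c *m b; pose B2 := d' - a *: (c *m b).
have elim (k : R) (D : 'M[R]_n) : T2 *m block_mx (k * al)%:M (k *: b) (k *: b^T) D *m T2^T
    = block_mx (k * al)%:M 0 0 (D - k *: (c *m b)).
  have kc : (k * al) *: c = k *: b^T.
    by rewrite /c scalerA mulfK ?gt_eqF.
  have kcT : (k * al) *: c^T = k *: b.
    by rewrite cT scalerA mulfK ?gt_eqF.
  rewrite T2T !mulmx_block !mul1mx !mul0mx !addr0 !mulmx1 !mulmx0 !addr0 ?add0r.
  rewrite !mulNmx mul_mx_scalar kc addNr mul0mx add0r.
  rewrite mulmxN mul_scalar_mx kcT addNr.
  by rewrite -scalemxAr addrC.
have A12 : T2 *m A1 *m T2^T = block_mx al%:M 0 0 A2.
  by have := elim 1 d; rewrite mul1r !scale1r -A1E.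
have B12 : T2 *m B1 *m T2^T = block_mx (a * al)%:M 0 0 B2.
  by rewrite -elim -B1E.
have dr (p : nat) (k : 'M[R]_1) (D : 'M[R]_p) : drsubmx (block_mx k 0 0 D) = D.
  by rewrite block_mxKdr.
have sA2 : A2^T = A2.
  by rewrite -[A2](dr _ al%:M) -A12 trmx_drsub congr_sym.
have sB2 : B2^T = B2.
  by rewrite -[B2](dr _ (a * al)%:M) -B12 trmx_drsub congr_sym.
have pA2 : posdef A2.
  move=> u u0; have n0 : (row_mx 0 u : 'rV[R]_(1 + n)) != 0.
    apply: contraNneq u0 => e; have := e; rewrite -[RHS]row_mx0.
    by move=> /eq_row_mx[_ ->].
  have := congr_posdef u2 pA1 n0; rewrite A12 mul_row_block !mul0mx mulmx0 !add0r.
  by rewrite tr_row_mx mul_row_col mul0mx add0r.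
have [T3 [dd [u3 A3 B3]]] := IH _ _ sA2 pA2 sB2.
pose r := (Num.sqrt al)^-1.
have rr : r * al * r = 1.
  have s0 : Num.sqrt al != 0 by rewrite gt_eqF // sqrtr_gt0.
  rewrite -[al in LHS]sqr_sqrtr ?ltW // /r; field.
  exact: s0.
pose T4 : 'M[R]_(1 + n) := block_mx r%:M 0 0 T3.
have T4T : T4^T = block_mx r%:M 0 0 T3^T by rewrite tr_block_mx tr_scalar_mx !trmx0.
have u4 : T4 \in unitmx.
  rewrite unitmxE det_ublock unitrM -!unitmxE u3 andbT unitmxE det_scalar1.
  by rewrite unitfE invr_eq0 gt_eqF // sqrtr_gt0.
exists (T4 *m T2 *m T1), (row_mx a%:M dd : 'rV_(1 + n)); split.
- by rewrite !unitmx_mul u1 u2 u4.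
- transitivity (T4 *m (T2 *m A1 *m T2^T) *m T4^T).
    by rewrite /A1 !trmx_mul !mulmxA.
  rewrite A12 T4T !mulmx_block !mul0mx !mulmx0 !addr0 !add0r !mul0mx A3.
  by rewrite -!scalar_mxM rr; exact: esym (@scalar_mx_block _ 1 n 1).
transitivity (T4 *m (T2 *m B1 *m T2^T) *m T4^T).
  by rewrite /B1 !trmx_mul !mulmxA.
rewrite B12 T4T !mulmx_block !mul0mx !mulmx0 !addr0 !add0r !mul0mx B3.
rewrite -!scalar_mxM (_ : r * (a * al) * r = a); last first.
  by rewrite mulrCA -mulrA rr mulr1.
apply: etrans _ (esym (@diag_mx_row _ n 1 a%:M dd)).
congr block_mx; apply/matrixP => i j; by rewrite !ord1 !mxE eqxx.
Qed.

End SimultaneousDiagonalization.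

Section AdaptedFrame.
Variables (R : realType) (eps : R).
Hypothesis eps2 : eps ^+ 2 = 1.

Definition base_form : 'M[R]_3 := diag_mx (\row_j (if j == 0 then eps else 1)).

Lemma base_form_tr : base_form^T = base_form. Proof. exact: tr_diag_mx. Qed.

(** Multiply the diagonalization by the adjugate of [T]. Cofactor rows are cross products of rows of
    [T], so a basis that diagonalizes D also diagonalizes the bracket built from D and the cross
    product. *)
Lemma cofactor_diag (T : 'M[R]_3) (d : 'rV[R]_3) i j :
  T *m base_form *m T^T = diag_mx d ->
  cofactor T i j * d 0 i = \det T * base_form j j * T i j.
Proof.
move=> TD; have e : \adj T *m diag_mx d = \det T *: (base_form *m T^T).
  by rewrite -TD !mulmxA mul_adj_mx -!mulmxA mul_scalar_mx.
have := congr1 (fun M : 'M[R]_3 => M j i) e.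
rewrite mul_mx_diag !mxE => ->; rewrite -mulrA; congr (_ * _).
rewrite (bigD1 j) //= big1 ?addr0 => [|m mj]; last first.
  by rewrite !mxE (eq_sym j m) (negPf mj) mulr0n mul0r.
by rewrite !mxE.
Qed.

Variable K : 'M[R]_(3 + 1).
Hypotheses (sK : K^T = K) (pK : posdef K).

Let K3 : 'M[R]_3 := ulsubmx K.
Let k : 'cV[R]_3 := ursubmx K.
Let kap := drsubmx K 0 0.

Let KE : K = block_mx K3 k k^T kap%:M.
Proof. by rewrite -[LHS]submxK /kap -mx11_scalar trmx_ursub sK. Qed.

Let kap0 : 0 < kap.
Proof.
have n0 : (row_mx 0 1%:M : 'rV[R]_(3 + 1)) != 0.
  apply/eqP; rewrite -[RHS]row_mx0 => /eq_row_mx[_ /matrixP/(_ 0 0) /eqP].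
  by rewrite !mxE oner_eq0.
have := pK n0; rewrite KE mul_row_block !mul1mx !mul0mx !add0r.
by rewrite tr_row_mx mul_row_col trmx1 trmx0 mulmx1 mulmx0 add0r mxE mulr1n.
Qed.

Let S := K3 - kap^-1 *: (k *m k^T).

Let sS : S^T = S.
Proof.
by rewrite linearB linearZ /= trmx_mul trmxK /K3 trmx_ulsub sK.
Qed.

Let pS : posdef S.
Proof.
(* Lifts [u] to the vector (u, a) orthogonal to the centre, on which the form of [K] takes the value
   of [S] at [u]. *)
move=> u u0; pose a : 'M[R]_1 := - kap^-1 *: (u *m k).
have n0 : (row_mx u a : 'rV[R]_(3 + 1)) != 0.
  by apply: contraNneq u0 => e; have := e; rewrite -[RHS]row_mx0 => /eq_row_mx[->].
have := pK n0; rewrite KE mul_row_block tr_row_mx mul_row_col.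
have -> : u *m k + a *m kap%:M = 0.
  by rewrite mul_mx_scalar /a scalerA mulrN mulfV ?gt_eqF // scaleN1r subrr.
rewrite mul0mx addr0 /S /a mulmxBr -scalemxAr -scalemxAl mulmxA.
by rewrite scaleNr.
Qed.

Let n := Num.sqrt kap.
Let n0 : n != 0. Proof. by rewrite gt_eqF // sqrtr_gt0. Qed.
Let n2 : n ^+ 2 = kap. Proof. by rewrite sqr_sqrtr // ltW. Qed.

(* Simultaneous diagonalization of the Schur complement of K and of the base form
   turns the bracket (x, y) |-> 2 (x * y) D, with * the cross product, into a
   diagonal one; the last vector of the frame is central. *)
Lemma adapted_frame : exists (F : 'M[R]_4) (l1 l2 l3 b1 b2 b3 : R),
  [/\ F \in unitmx, F *m K *m F^T = 1%:M, [/\ l1 != 0, l2 != 0 & l3 != 0],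
    forall e f c, \sum_b \sum_d F e b * F f d * lie_struct (2 * eps) 2 2 0 0 0 b d c
      = \sum_a lie_struct l1 l2 l3 b1 b2 b3 e f a * F a c &
    [/\ b1 * b2 = 0, b2 * b3 = 0, b3 * b1 = 0 & exists r,
      [/\ l1 ^+ 2 + b1 ^+ 2 = r * l1, l2 ^+ 2 + b2 ^+ 2 = r * l2 &
          l3 ^+ 2 + b3 ^+ 2 = r * l3]] ->
    exists rho, ulsubmx K = rho *: base_form].
Proof.
have [T [d [uT TS TD]]] := simultaneous_diag sS pS base_form_tr.
(* The central components that make the first three frame vectors orthogonal to the centre; the
   fourth is the unit vector along it. *)
pose w : 'cV[R]_3 := - kap^-1 *: (T *m k).
pose F : 'M[R]_(3 + 1) := block_mx T w 0 n^-1%:M.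
have dT : \det T != 0 by rewrite -unitfE -unitmxE.
have e0 : eps != 0 by apply: contra_eq_neq eps2 => ->; rewrite expr0n eq_sym oner_eq0.
have d0 i : d 0 i != 0.
  have : diag_mx d \in unitmx.
    rewrite -TD !unitmx_mul unitmx_tr uT andbT /= unitmxE det_diag unitfE.
    by rewrite !big_ord_recl big_ord0 !mxE /= !mulr1.
  by rewrite unitmxE det_diag unitfE => /prodf_neq0; apply.
(* The value forced by [cofactor_diag]: the bracket of two rows of [T] is twice D applied to their
   cross product, and D has square 1. *)
pose l i := 2 * \det T / d 0 i.
have l0 i : l i != 0 by rewrite !mulf_neq0 ?invr_eq0 // pnatr_eq0.
pose be i := (T *m k) i 0 / n.
(* Entries are indexed by natural numbers so that those of the 3 x 3 minors and those of the 4 x 4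
   sums become the same atoms. *)
pose f (a b : nat) : R := T (inord a) (inord b).
have fE i j : T i j = f i j by rewrite /f !inord_val.
pose wf (a : nat) : R := w (inord a) 0.
have FE (e c : 'I_(3 + 1)) : F e c = if (e < 3)%N then if (c < 3)%N then f e c else wf e
    else if (c < 3)%N then 0 else n^-1.
  have lt (i : 'I_3) : (lshift 1 i < 3)%N = true by apply: (ltn_ord i).
  have rt (i : 'I_1) : (rshift 3 i < 3)%N = false by rewrite ltnNge leq_addr.
  rewrite /F /wf; case: (split_ordP e) => i ->; case: (split_ordP c) => j ->.
  - by rewrite block_mxEul ?lt fE.
  - by rewrite block_mxEur ?lt ?rt inord_val ord1.
  - by rewrite block_mxEdl ?lt ?rt mxE.
  by rewrite block_mxEdr ?rt !ord1 mxE eqxx mulr1n.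
have lF (i j : 'I_3) : l i * f i j = 2 * base_form j j * cofactor T i j.
  have e2 : base_form j j * base_form j j = 1.
    rewrite mxE eqxx mulr1n mxE; case: ifP => _; last by rewrite mulr1.
    by rewrite -expr2.
  have := cofactor_diag i j TD; rewrite -fE => c.
  apply: (mulfI (d0 i)); transitivity (2 * base_form j j * (cofactor T i j * d 0 i)).
    rewrite c; transitivity (2 * \det T * T i j); first by rewrite /l; field.
    by rewrite -[in LHS](mulr1 2) -e2; ring.
  by ring.
pose b i := l i * be i.
have wE (i : 'I_3) : wf i = - be i / n.
  rewrite /wf /w /be inord_val !mxE -n2; by field.
pose o0 := @Ordinal 3 0 isT; pose o1 := @Ordinal 3 1 isT; pose o2 := @Ordinal 3 2 isT.
pose cr (a a' j : nat) : R := match j with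
  | 0 => f a 1%N * f a' 2%N - f a 2%N * f a' 1%N
  | 1 => f a 2%N * f a' 0%N - f a 0%N * f a' 2%N
  | _ => f a 0%N * f a' 1%N - f a 1%N * f a' 0%N end.
have ord3 (P : 'I_3 -> Prop) : P o0 -> P o1 -> P o2 -> forall i, P i.
  by move=> p0 p1 p2 [[|[|[|//]]] ij]; rewrite (bool_irrelevance ij isT).
have c0 (j : 'I_3) : cofactor T o0 j = cr 1%N 2%N j.
  move: j; apply: ord3; rewrite /cofactor det2 !mxE !fE /= /bump /=; ring.
have c1 (j : 'I_3) : cofactor T o1 j = cr 2%N 0%N j.
  move: j; apply: ord3; rewrite /cofactor det2 !mxE !fE /= /bump /=; ring.
have c2 (j : 'I_3) : cofactor T o2 j = cr 0%N 1%N j.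
  move: j; apply: ord3; rewrite /cofactor det2 !mxE !fE /= /bump /=; ring.
have uF : F \in unitmx.
  rewrite unitmxE det_ublock unitrM -!unitmxE uT /= unitmxE det_scalar1.
  by rewrite unitfE invr_eq0.
have FKF : F *m K *m F^T = 1%:M.
  have FT : F^T = block_mx T^T 0 w^T n^-1%:M.
    by rewrite tr_block_mx tr_scalar_mx trmx0.
  rewrite FT KE /F !mulmx_block !mul0mx !add0r.
  have -> : T *m k + w *m kap%:M = 0.
    by rewrite mul_mx_scalar /w scalerA mulrN mulfV ?gt_eqF // scaleN1r subrr.
  have -> : T *m K3 + w *m k^T = T *m S.
    by rewrite /S mulmxBr /w -scalemxAl -scalemxAr mulmxA scaleNr.
  rewrite !mul0mx !mulmx0 !addr0 !add0r TS -!scalar_mxM.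
  have -> : n^-1%:M *m k^T *m T^T + (n^-1 * kap)%:M *m w^T = 0.
    rewrite /w linearZ /= trmx_mul -!mulmxA !mul_scalar_mx scalerA.
    by rewrite mulrN mulfK ?gt_eqF // scaleNr subrr.
  have -> : n^-1 * kap * n^-1 = 1 by rewrite -n2; field.
  exact: esym (@scalar_mx_block _ 3 1 1).
exists F, (l o0), (l o1), (l o2), (b o0), (b o1), (b o2); split=> //.
- have L0 (j : 'I_3) : l o0 * f 0%N j = 2 * base_form j j * cr 1%N 2%N j.
    by rewrite -c0 -lF.
  have L1 (j : 'I_3) : l o1 * f 1%N j = 2 * base_form j j * cr 2%N 0%N j.
    by rewrite -c1 -lF.
  have L2 (j : 'I_3) : l o2 * f 2%N j = 2 * base_form j j * cr 0%N 1%N j.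
    by rewrite -c2 -lF.
  have D0 : base_form o0 o0 = eps by rewrite !mxE.
  have D1 : base_form o1 o1 = 1 by rewrite !mxE.
  have D2 : base_form o2 o2 = 1 by rewrite !mxE.
  have L00 := L0 o0; have L01 := L0 o1; have L02 := L0 o2.
  have L10 := L1 o0; have L11 := L1 o1; have L12 := L1 o2.
  have L20 := L2 o0; have L21 := L2 o1; have L22 := L2 o2.
  rewrite !(D0, D1, D2) /cr /= in L00 L01 L02 L10 L11 L12 L20 L21 L22.
  have w0 : l o0 * wf 0%N = - b o0 / n by rewrite (wE o0) /b; ring.
  have w1 : l o1 * wf 1%N = - b o1 / n by rewrite (wE o1) /b; ring.
  have w2 : l o2 * wf 2%N = - b o2 / n by rewrite (wE o2) /b; ring.
  move: (l o0) (l o1) (l o2) (b o0) (b o1) (b o2) L00 L01 L02 L10 L11 L12 L20 L21 L22 w0 w1 w2.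
  clear -FE => m0 m1 m2 b0 b1 b2 L00 L01 L02 L10 L11 L12 L20 L21 L22 w0 w1 w2.
  move=> e g c; rewrite !sum_ord4 !FE.
  move: e g c; apply: ord4_ind; apply: ord4_ind; apply: ord4_ind;
    rewrite /lie_struct /= ?mulNr ?L00 ?L01 ?L02 ?L10 ?L11 ?L12 ?L20 ?L21 ?L22 ?w0 ?w1 ?w2;
    ring.
move=> [b12 b23 b31 [r [r0 r1 r2]]].
(* The diagonal of T K3 T^T is 1 + be_i^2. The relation l_i^2 + b_i^2 = r l_i, divided by l_i^2 and
   combined with l_i d_i = 2 det T, makes it proportional to d. *)
have rr (i : 'I_3) : 1 + be i ^+ 2 = r / (2 * \det T) * d 0 i.
  have ri : l i ^+ 2 + b i ^+ 2 = r * l i by move: i; apply: ord3.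
  apply: (mulfI (l0 i)); apply: (mulfI (l0 i)).
  transitivity (l i ^+ 2 + b i ^+ 2); first by rewrite /b; ring.
  have ld : l i * d 0 i = 2 * \det T by rewrite /l mulfVK.
  transitivity (l i * (r / (2 * \det T)) * (l i * d 0 i)); last by ring.
  by rewrite ld ri; field.
have be0 (i j : 'I_3) : i != j -> be i * be j = 0.
  have H (x y : 'I_3) : b x * b y = 0 -> be x * be y = 0.
    move=> e; apply: (mulfI (l0 x)); apply: (mulfI (l0 y)); rewrite !mulr0 -[RHS]e /b; ring.
  by move: i j; apply: (ord3 _); apply: (ord3 _) => // _;
    first [exact: H | rewrite mulrC; exact: H].
exists (r / (2 * \det T)).
have TK : T *m ulsubmx K *m T^T = T *m (r / (2 * \det T) *: base_form) *m T^T.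
  rewrite -scalemxAr -scalemxAl TD.
  have -> : ulsubmx K = S + kap^-1 *: (k *m k^T) by rewrite /S subrK.
  rewrite mulmxDr mulmxDl TS -scalemxAr -scalemxAl.
  have -> : T *m (k *m k^T) *m T^T = T *m k *m (T *m k)^T.
    by rewrite trmx_mul !mulmxA.
  apply/matrixP => i j.
  have -> : (1%:M + kap^-1 *: (T *m k *m (T *m k)^T)) i j = (i == j)%:R + be i * be j.
    have E (u : 'cV[R]_3) (c : R) :
        (1%:M + c *: (u *m u^T)) i j = (i == j)%:R + c * (u i 0 * u j 0).
      by rewrite !mxE big_ord1 !mxE.
    by rewrite E /be -n2; congr (_ + _); field.
  rewrite [RHS]mxE [diag_mx d i j]mxE; have [->|ij] := eqVneq i j.
    by rewrite -expr2 mulr1n rr.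
  by rewrite be0 // mulr0n mulr0 addr0.
move: TK => /(can_inj (mulmxK _)); rewrite unitmx_tr => /(_ uT) /(can_inj (mulKmx uT)).
by [].
Qed.

End AdaptedFrame.

Section CoframeChange.
Variables (R : realType) (n : nat).

Lemma form_sum (M : 'M[R]_n) (u v : 'rV[R]_n) :
  \sum_b \sum_d u 0 b * v 0 d * M b d = (u *m M *m v^T) 0 0.
Proof.
rewrite mxE exchange_big; apply: eq_bigr => d _; rewrite mxE mulr_suml.
by apply: eq_bigr => b _; rewrite !mxE; ring.
Qed.

(** Tensoriality of the structure equation under a constant change of coframe: if the rows of [F]
    form a basis with structure constants [S'], then [T], which is O F^-1, satisfies the structure
    equation with [S']. [V] stands for the exterior derivative of [O] in directions i and j. *)
Lemma torsion_change (O T F : 'M[R]_n) (S S' : 'I_n -> 'I_n -> 'I_n -> R)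
    (V : 'I_n -> R) i j a :
  F \in unitmx -> O = T *m F ->
  (forall e f c, \sum_b \sum_d F e b * F f d * S b d c = \sum_k S' e f k * F k c) ->
  (forall c, V c = - \sum_b \sum_d O i b * O j d * S b d c) ->
  \sum_c V c * invmx F c a = - \sum_e \sum_f T i e * T j f * S' e f a.
Proof.
move=> uF OE FS VE.
pose Sm c := \matrix_(b, d) S b d c; pose Sm' c := \matrix_(b, d) S' b d c.
have E c : V c = - \sum_k ((row i T *m Sm' k *m (row j T)^T) 0 0 * F k c).
  have FSF : F *m Sm c *m F^T = \sum_k F k c *: Sm' k.
    apply/matrixP => e f; rewrite summxE; under [RHS]eq_bigr do rewrite !mxE mulrC.
    rewrite -FS; transitivity (\sum_b \sum_d row e F 0 b * row f F 0 d * Sm c b d).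
      by rewrite form_sum -row_mul !mxE; apply: eq_bigr => k _; rewrite !mxE.
    by apply: eq_bigr => b _; apply: eq_bigr => d _; rewrite !mxE.
  rewrite VE; congr (- _).
  transitivity (\sum_b \sum_d row i O 0 b * row j O 0 d * Sm c b d).
    by apply: eq_bigr => b _; apply: eq_bigr => d _; rewrite !mxE.
  rewrite form_sum OE !row_mul trmx_mul.
  have -> : row i T *m F *m Sm c *m (F^T *m (row j T)^T)
      = row i T *m (F *m Sm c *m F^T) *m (row j T)^T by rewrite !mulmxA.
  rewrite FSF mulmx_sumr mulmx_suml summxE; apply: eq_bigr => k _.
  by rewrite -scalemxAr -scalemxAl mxE mulrC.
under eq_bigr do rewrite E mulNr mulr_suml.
rewrite sumrN exchange_big /=; congr (- _).
transitivity (\sum_k (row i T *m Sm' k *m (row j T)^T) 0 0 * (k == a)%:R).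
  apply: eq_bigr => k _; under eq_bigr do rewrite -mulrA.
  rewrite -mulr_sumr; congr (_ * _).
  by have := congr1 (fun M : 'M[R]_n => M k a) (mulmxV uF); rewrite !mxE.
rewrite (bigD1 a) //= eqxx mulr1 big1 ?addr0 => [|k ka]; last first.
  by rewrite (negPf ka) mulr0.
rewrite -form_sum.
by apply: eq_bigr => b _; apply: eq_bigr => d _; rewrite !mxE.
Qed.

End CoframeChange.

Section CriticalGram.
Variables (R : realType) (G : lie_group R) (eps : R).
Variables q0 q1 q2 q3 s : 'rV[R]_4 -> R^o.
Notation U := (lg_dom G).
Hypothesis qc : quaternion_chart eps U (lg_mul G) q0 q1 q2 q3 s.
Let oU : open U := @lg_dom_open _ G.
Notation Om := (maurer_cartan eps q0 q1 q2 q3 s).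

Lemma lie_structC (l1 l2 l3 b1 b2 b3 : R) i j k :
  lie_struct l1 l2 l3 b1 b2 b3 i j k = - lie_struct l1 l2 l3 b1 b2 b3 j i k.
Proof.
by move: i j k; apply: ord4_ind; apply: ord4_ind; apply: ord4_ind;
  rewrite /lie_struct /= ?opprK ?oppr0.
Qed.

Lemma lie_conn_skew (l1 l2 l3 b1 b2 b3 : R) b :
  (lie_conn l1 l2 l3 b1 b2 b3 b)^T = - lie_conn l1 l2 l3 b1 b2 b3 b.
Proof.
apply/matrixP => c a; rewrite !mxE.
rewrite (lie_structC _ _ _ _ _ _ a c) (lie_structC _ _ _ _ _ _ b a).
by rewrite (lie_structC _ _ _ _ _ _ c b); ring.
Qed.

Lemma lie_conn_torsion (l1 l2 l3 b1 b2 b3 : R) b c a :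
  lie_conn l1 l2 l3 b1 b2 b3 b c a - lie_conn l1 l2 l3 b1 b2 b3 c b a
  = lie_struct l1 l2 l3 b1 b2 b3 b c a.
Proof.
rewrite !mxE (lie_structC _ _ _ _ _ _ c b) (lie_structC _ _ _ _ _ _ c a).
by rewrite (lie_structC _ _ _ _ _ _ b a); field.
Qed.

(** The inverse of the adapted frame turns the Maurer-Cartan coframe into an orthonormal one with
    connection [lie_conn]; criticality becomes the polynomial system, whose solutions
    [adapted_frame] translates back into a condition on [K]. *)
Lemma critical_gram g (K : 'M[R]_(3 + 1)) t : riemannian U g -> K^T = K -> posdef K ->
  (forall x, U x -> g x = Om x *m K *m (Om x)^T) -> Ft_critical t U g ->
  exists rho, ulsubmx K = rho *: base_form eps.
Proof.
move=> rg sK pK gE crit.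
have [F [l1 [l2 [l3 [b1 [b2 [b3 [uF FK [l10 l20 l30] FS]]]]]]]] :=
  adapted_frame (qc_eps qc) sK pK; apply.
pose Th x := Om x *m invmx F.
have sO := msmooth_maurer_cartan oU qc.
have sF : msmooth U (fun=> invmx F) by apply: msmooth_cst.
have sTh : msmooth U Th by apply: msmoothM.
have gTh x : U x -> g x = Th x *m (Th x)^T.
  move=> Ux; rewrite gE // /Th trmx_mul -!mulmxA; congr (_ *m _); rewrite !mulmxA.
  congr (_ *m _); have <- : invmx F *m (F *m K *m F^T) *m (invmx F)^T = K.
    by rewrite !mulmxA mulVmx // mul1mx -mulmxA -trmx_mul mulVmx // trmx1 mulmx1.
  by rewrite FK mulmx1.
apply: (@lie_EL_eq0 _ l1 l2 l3 b1 b2 b3 t l10 l20 l30).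
apply: (critical_lie_EL oU rg sTh gTh (lie_conn_skew l1 l2 l3 b1 b2 b3) _
  (@lg_dom_one _ G) crit) => x Ux i j a.
have mT k l : mpd k Th x l a = \sum_c mpd k Om x l c * invmx F c a.
  have e : mpd k Th x = mpd k Om x *m invmx F.
    by apply: etrans (mpdM oU k sO sF Ux) _; rewrite mpd_cst mulmx0 addr0.
  by rewrite e mxE.
apply: etrans (f_equal2 (fun x y => x - y) (mT i j) (mT j i)) _.
have OE : Om x = Th x *m F by rewrite /Th mulmxKV.
have TC := torsion_change a uF OE FS (maurer_cartan_torsion oU qc Ux i j).
rewrite -sumrB; transitivity (\sum_c (mpd i Om x j c - mpd j Om x i c) * invmx F c a).
  by apply: eq_bigr => c _; rewrite mulrBl.
apply: etrans TC _.
congr (- _); apply: eq_bigr => b _; apply: eq_bigr => c _; rewrite lie_conn_torsion.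
by [].
Qed.

End CriticalGram.

(** * Splitting off the line *)

Section Untwisting.
Variables (R : realType) (U : set 'rV[R]_4) (m : 'rV[R]_4 -> 'rV[R]_4 -> 'rV[R]_4).
Variables q0 q1 q2 q3 s : 'rV[R]_4 -> R^o.
Hypotheses (oU : open U) (qc : quaternion_chart 1 U m q0 q1 q2 q3 s).
Variables (w n1 n2 n3 : R).
Hypothesis n_unit : n1 ^+ 2 + n2 ^+ 2 + n3 ^+ 2 = 1.
Notation Om := (maurer_cartan 1 q0 q1 q2 q3 s).

Let s0 : smooth U q0. Proof. by case: (qc_smooth qc). Qed.
Let s1 : smooth U q1. Proof. by case: (qc_smooth qc). Qed.
Let s2 : smooth U q2. Proof. by case: (qc_smooth qc). Qed.
Let s3 : smooth U q3. Proof. by case: (qc_smooth qc). Qed.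
Let ss : smooth U s. Proof. by case: (qc_smooth qc). Qed.

Let C (x : 'rV[R]_4) : R^o := cos (w * s x).
Let S (x : 'rV[R]_4) : R^o := sin (w * s x).

Let sws : smooth U (fun x => w * s x : R^o).
Proof. by apply: smoothM => //; apply: smooth_cst. Qed.

Let CS x : C x ^+ 2 + S x ^+ 2 = 1.
Proof. exact: cos2Dsin2. Qed.

(** A component of q exp (w s n) for a unit imaginary n, where [a] is that component of q and [b]
    that of q n. *)
Definition twist (a b : 'rV[R]_4 -> R^o) (x : 'rV[R]_4) : R^o :=
  a x * cos (w * s x) + b x * sin (w * s x).

Lemma smooth_twist a b : smooth U a -> smooth U b -> smooth U (twist a b).
Proof.
move=> sa sb; apply: smoothD => //; apply: smoothM => //.
  exact: smooth_cos.
exact: smooth_sin.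
Qed.

Lemma derive_twist (a b : 'rV[R]_4 -> R^o) x v : smooth U a -> smooth U b -> U x ->
  'D_v (twist a b) x = 'D_v a x * C x + 'D_v b x * S x
    + w * 'D_v s x * (b x * C x - a x * S x).
Proof.
move=> sa sb Ux.
have d (f : 'rV[R]_4 -> R^o) : smooth U f -> derivable f x v.
  by move=> sf; apply: smooth_derivable sf Ux.
have dws : differentiable (fun y => w * s y : R^o) x by apply: smooth_differentiable sws Ux.
have Dws : 'D_v (fun y => w * s y : R^o) x = w * 'D_v s x.
  by apply: (@deriveZ _ _ _ s); apply: d.
have [_ dC] := derive_comp_scalar v dws (is_derive_cos (w * s x)).
have [_ dS] := derive_comp_scalar v dws (is_derive_sin (w * s x)).
have sC : smooth U C by apply: smooth_cos.
have sS : smooth U S by apply: smooth_sin.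
have saC : smooth U (fun y => a y * C y : R^o) by apply: smoothM.
have sbS : smooth U (fun y => b y * S y : R^o) by apply: smoothM.
apply: etrans (@deriveD _ _ _ (fun y => a y * C y : R^o) (fun y => b y * S y : R^o)
  x v (d _ saC) (d _ sbS)) _.
have eC := @deriveM _ _ a C x v (d _ sa) (d _ sC).
have eS := @deriveM _ _ b S x v (d _ sb) (d _ sS).
rewrite Dws in dC dS.
apply: etrans (f_equal2 +%R eC eS) _; rewrite dC dS /C /S /GRing.scale /=.
by move: ('D_v a x) ('D_v b x) ('D_v s x) (cos _) (sin _) => *; ring.
Qed.

Let lin (c0 c1 c2 c3 : R) (x : 'rV[R]_4) : R^o :=
  c0 * q0 x + c1 * q1 x + c2 * q2 x + c3 * q3 x.

(* The product of q with cos (w s) + sin (w s) (n1 i + n2 j + n3 k). *)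
Definition untwist0 := twist q0 (lin 0 (- n1) (- n2) (- n3)).
Definition untwist1 := twist q1 (lin n1 0 n3 (- n2)).
Definition untwist2 := twist q2 (lin n2 (- n3) 0 n1).
Definition untwist3 := twist q3 (lin n3 n2 (- n1) 0).

Let slin c0 c1 c2 c3 : smooth U (lin c0 c1 c2 c3).
Proof.
have sZ (c : R) (f : 'rV[R]_4 -> R^o) : smooth U f -> smooth U (fun x => c * f x : R^o).
  by move=> sf; apply: smoothM => //; apply: smooth_cst.
apply: (smoothD oU); last exact: sZ.
by apply: (smoothD oU); [apply: (smoothD oU)|]; apply: sZ.
Qed.

Let dlin c0 c1 c2 c3 x v : U x -> 'D_v (lin c0 c1 c2 c3) x
  = c0 * 'D_v q0 x + c1 * 'D_v q1 x + c2 * 'D_v q2 x + c3 * 'D_v q3 x.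
Proof.
by move=> Ux; apply: derive_comb4; [apply: smooth_derivable s0 Ux|
  apply: smooth_derivable s1 Ux|apply: smooth_derivable s2 Ux|
  apply: smooth_derivable s3 Ux].
Qed.

Lemma smooth_untwist : [/\ smooth U untwist0, smooth U untwist1, smooth U untwist2
  & smooth U untwist3].
Proof. by split; apply: smooth_twist. Qed.

Lemma untwist_norm x : U x ->
  untwist0 x ^+ 2 + untwist1 x ^+ 2 + untwist2 x ^+ 2 + untwist3 x ^+ 2 = 1.
Proof.
move=> Ux; have N := qc_norm qc Ux; have T := CS x.
rewrite /untwist0 /untwist1 /untwist2 /untwist3 /twist /lin -/(C x) -/(S x).
move: (C x) (S x) (q0 x) (q1 x) (q2 x) (q3 x) N T => c t a0 a1 a2 a3.
rewrite mul1r => N T.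
transitivity ((a0 ^+ 2 + a1 ^+ 2 + (a2 ^+ 2 + a3 ^+ 2))
  * (c ^+ 2 + (n1 ^+ 2 + n2 ^+ 2 + n3 ^+ 2) * t ^+ 2)); first by ring.
by rewrite N n_unit !mul1r T.
Qed.

(** The twist depends only on [s], which is kept, and it is undone by multiplying with the conjugate
    exponential. *)
Lemma untwist_inj x y : quaternion_inj U q0 q1 q2 q3 s -> U x -> U y ->
  s x = s y -> untwist0 x = untwist0 y -> untwist1 x = untwist1 y ->
  untwist2 x = untwist2 y -> untwist3 x = untwist3 y -> x = y.
Proof.
move=> inj Ux Uy es e0 e1 e2 e3.
have cE : C x = C y by rewrite /C es.
have sE : S x = S y by rewrite /S es.
have H z : [/\
  q0 z = untwist0 z * C z + (n1 * untwist1 z + n2 * untwist2 z + n3 * untwist3 z) * S z,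
  q1 z = untwist1 z * C z - (n1 * untwist0 z + n3 * untwist2 z - n2 * untwist3 z) * S z,
  q2 z = untwist2 z * C z - (n2 * untwist0 z + n1 * untwist3 z - n3 * untwist1 z) * S z &
  q3 z = untwist3 z * C z - (n3 * untwist0 z + n2 * untwist1 z - n1 * untwist2 z) * S z].
  have T := CS z.
  rewrite /untwist0 /untwist1 /untwist2 /untwist3 /twist /lin -/(C z) -/(S z).
  move: (C z) (S z) (q0 z) (q1 z) (q2 z) (q3 z) T => c t a0 a1 a2 a3 T.
  have X (a X : R) : a * (c ^+ 2 + (n1 ^+ 2 + n2 ^+ 2 + n3 ^+ 2) * t ^+ 2) = X -> a = X.
    by rewrite n_unit mul1r T mulr1.
  by split; apply: X; ring.
have [x0 x1 x2 x3] := H x; have [y0 y1 y2 y3] := H y.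
by apply: inj => //; [rewrite x0 y0|rewrite x1 y1|rewrite x2 y2|rewrite x3 y3];
  rewrite cE sE e0 e1 e2 e3.
Qed.

(** With e = exp (w s n), d(q e) = q (conj q dq + w n ds) e, and multiplication by the unit
    quaternions q and e preserves the norm. *)
Lemma untwist_metric x u v : U x ->
  'D_u untwist0 x * 'D_v untwist0 x + 'D_u untwist1 x * 'D_v untwist1 x
  + 'D_u untwist2 x * 'D_v untwist2 x + 'D_u untwist3 x * 'D_v untwist3 x =
  let z := u *m Om x in let z' := v *m Om x in
  let o0 := @Ordinal 4 0 isT in let o1 := @Ordinal 4 1 isT in
  let o2 := @Ordinal 4 2 isT in let o3 := @Ordinal 4 3 isT in
  (z 0 o0 + w * n1 * z 0 o3) * (z' 0 o0 + w * n1 * z' 0 o3)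
  + (z 0 o1 + w * n2 * z 0 o3) * (z' 0 o1 + w * n2 * z' 0 o3)
  + (z 0 o2 + w * n3 * z 0 o3) * (z' 0 o2 + w * n3 * z' 0 o3).
Proof.
move=> Ux /=.
have D t := derive_quaternion oU qc t Ux.
have Z t c := mulmx_maurer_cartan qc t c Ux.
have DU t : let z := t *m Om x in let o0 := @Ordinal 4 0 isT in
  let o1 := @Ordinal 4 1 isT in let o2 := @Ordinal 4 2 isT in
  let o3 := @Ordinal 4 3 isT in
  let z1 := z 0 o0 + w * n1 * z 0 o3 in let z2 := z 0 o1 + w * n2 * z 0 o3 in
  let z3 := z 0 o2 + w * n3 * z 0 o3 in
  let E1 := n1 * S x in let E2 := n2 * S x in let E3 := n3 * S x in
  (* The quaternion (z1 i + z2 j + z3 k) e, to be multiplied by q on the left. *)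
  let y0 := - (z1 * E1 + z2 * E2 + z3 * E3) in
  let y1 := z1 * C x + z2 * E3 - z3 * E2 in
  let y2 := z2 * C x + z3 * E1 - z1 * E3 in
  let y3 := z3 * C x + z1 * E2 - z2 * E1 in
  [/\ 'D_t untwist0 x = q0 x * y0 - q1 x * y1 - q2 x * y2 - q3 x * y3,
      'D_t untwist1 x = q0 x * y1 + q1 x * y0 + q2 x * y3 - q3 x * y2,
      'D_t untwist2 x = q0 x * y2 + q2 x * y0 + q3 x * y1 - q1 x * y3 &
      'D_t untwist3 x = q0 x * y3 + q3 x * y0 + q1 x * y2 - q2 x * y1].
  have [d0 d1 d2 d3] := D t.
  have := Z t (@Ordinal 4 0 isT); have := Z t (@Ordinal 4 1 isT).
  have := Z t (@Ordinal 4 2 isT); have := Z t (@Ordinal 4 3 isT) => /= z3 z2 z1 z0.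
  rewrite /untwist0 /untwist1 /untwist2 /untwist3.
  rewrite (derive_twist _ s0 (slin _ _ _ _) Ux) (derive_twist _ s1 (slin _ _ _ _) Ux).
  rewrite (derive_twist _ s2 (slin _ _ _ _) Ux) (derive_twist _ s3 (slin _ _ _ _) Ux).
  rewrite !(dlin _ _ _ _ _ Ux).
  rewrite -z0 -z1 -z2 in d0 d1 d2 d3.
  rewrite d0 d1 d2 d3 -z3 /lin.
  have e1 : n1 * n1 = 1 - n2 * n2 - n3 * n3.
    by rewrite -n_unit; ring.
  move: (t *m _) (C x) (S x) (q0 x) (q1 x) (q2 x) (q3 x).
  clear -e1 => z c e a0 a1 a2 a3.
  by split; ring: e1.
have [a0 a1 a2 a3] := DU u; have [b0 b1 b2 b3] := DU v.
apply: etrans (f_equal2 +%R (f_equal2 +%R (f_equal2 +%R (f_equal2 *%R a0 b0)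
  (f_equal2 *%R a1 b1)) (f_equal2 *%R a2 b2)) (f_equal2 *%R a3 b3)) _.
have N := qc_norm qc Ux; have T := CS x; rewrite mul1r in N.
(* Left multiplication by a unit quaternion is an isometry (polarized four-square identity). *)
have NM (c0 c1 c2 c3 x0 x1 x2 x3 y0 y1 y2 y3 : R) :
  c0 ^+ 2 + c1 ^+ 2 + (c2 ^+ 2 + c3 ^+ 2) = 1 ->
  (c0 * x0 - c1 * x1 - c2 * x2 - c3 * x3) * (c0 * y0 - c1 * y1 - c2 * y2 - c3 * y3)
  + (c0 * x1 + c1 * x0 + c2 * x3 - c3 * x2) * (c0 * y1 + c1 * y0 + c2 * y3 - c3 * y2)
  + (c0 * x2 + c2 * x0 + c3 * x1 - c1 * x3) * (c0 * y2 + c2 * y0 + c3 * y1 - c1 * y3)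
  + (c0 * x3 + c3 * x0 + c1 * x2 - c2 * x1) * (c0 * y3 + c3 * y0 + c1 * y2 - c2 * y1)
  = x0 * y0 + x1 * y1 + x2 * y2 + x3 * y3.
  move=> e; transitivity ((c0 ^+ 2 + c1 ^+ 2 + (c2 ^+ 2 + c3 ^+ 2))
    * (x0 * y0 + x1 * y1 + x2 * y2 + x3 * y3)); first by ring.
  by rewrite e mul1r.
apply: etrans (NM _ _ _ _ _ _ _ _ _ _ _ _ N) _.
move: (u *m _) (v *m _) (C x) (S x) T; clear -n_unit => z z' c t T.
move: (z 0 _ + w * n1 * _) (z 0 _ + w * n2 * _) (z 0 _ + w * n3 * _) => z1 z2 z3.
move: (z' 0 _ + w * n1 * _) (z' 0 _ + w * n2 * _) (z' 0 _ + w * n3 * _) => y1 y2 y3.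
transitivity ((c ^+ 2 + (n1 ^+ 2 + n2 ^+ 2 + n3 ^+ 2) * t ^+ 2)
  * (z1 * y1 + z2 * y2 + z3 * y3)); first by ring.
by rewrite n_unit mul1r T mul1r.
Qed.

End Untwisting.

(** * The isometry with a line times a round sphere *)

Section RoundProduct.
Variable R : realType.

Lemma inner_round n r (y u v : 'rV[R]_n) :
  inner (round_metric r) y u v = r ^+ 2 * (\sum_i u 0 i * v 0 i
    + (\sum_i y 0 i * u 0 i) * (\sum_i y 0 i * v 0 i) / (1 - norm2 y)).
Proof.
rewrite innerE mulrDr mulr_sumr.
transitivity (\sum_i (r ^+ 2 * (u 0 i * v 0 i) + r ^+ 2 * (y 0 i * u 0 i
   * (\sum_j y 0 j * v 0 j) / (1 - norm2 y)))).
  apply: eq_bigr => i _.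
  transitivity (\sum_j ((i == j)%:R * (r ^+ 2 * (u 0 i * v 0 j))
     + r ^+ 2 * (y 0 i * u 0 i) / (1 - norm2 y) * (y 0 j * v 0 j))).
    by apply: eq_bigr => j _; rewrite mxE; ring.
  rewrite big_split /= -mulr_sumr (bigD1 i) //= eqxx mul1r big1 => [|j ji]; last first.
    by rewrite eq_sym (negPf ji) mul0r.
  by rewrite addr0; congr (_ + _); ring.
rewrite big_split /= -mulr_sumr; congr (_ + _).
move: (\sum_j y 0 j * v 0 j) => S.
by rewrite mulr_suml mulr_suml mulr_sumr.
Qed.

Lemma derive_sphere_normal (U : set 'rV[R]_4) (y0 y1 y2 y3 : 'rV[R]_4 -> R^o) x v : open U ->
  smooth U y0 -> smooth U y1 -> smooth U y2 -> smooth U y3 ->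
  (forall x, U x -> y0 x ^+ 2 + y1 x ^+ 2 + y2 x ^+ 2 + y3 x ^+ 2 = 1) -> U x ->
  y0 x * 'D_v y0 x + y1 x * 'D_v y1 x + y2 x * 'D_v y2 x + y3 x * 'D_v y3 x = 0.
Proof.
move=> oU s0 s1 s2 s3 N Ux.
have dM (f : 'rV[R]_4 -> R^o) : smooth U f -> derivable (fun y => f y * f y : R^o) x v.
  by move=> sf; apply: smooth_derivable Ux; apply: smoothM.
have DM (f : 'rV[R]_4 -> R^o) : smooth U f ->
    'D_v (fun y => f y * f y : R^o) x = 2 * (f x * 'D_v f x).
  move=> sf; have df : derivable f x v by apply: smooth_derivable sf Ux.
  by rewrite (@deriveM _ _ f f); [rewrite mulr_natl mulr2n|exact: df|exact: df].
have := @derive_comb4 R _ 1 1 1 1 _ _ _ _ x v (dM _ s0) (dM _ s1) (dM _ s2) (dM _ s3).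
rewrite (DM _ s0) (DM _ s1) (DM _ s2) (DM _ s3) => e.
have e0 : 'D_v (fun y => 1 * (y0 y * y0 y) + 1 * (y1 y * y1 y) + 1 * (y2 y * y2 y)
    + 1 * (y3 y * y3 y) : R^o) x = 0.
  transitivity ('D_v (fun=> 1 : R^o) x); last by rewrite derive_cst.
  by apply: (eq_on_derive oU _ _ Ux) => y Uy; rewrite -[RHS](N y Uy); ring.
apply: (mulfI (_ : 2 != 0)); first by rewrite pnatr_eq0.
rewrite mulr0 -[RHS]e0 e.
by move: ('D_v y0 x) ('D_v y1 x) ('D_v y2 x) ('D_v y3 x) => *; ring.
Qed.

Lemma axis_vector (a1 a2 a3 : R) : exists w n1 n2 n3,
  [/\ n1 ^+ 2 + n2 ^+ 2 + n3 ^+ 2 = 1, w * n1 = a1, w * n2 = a2 & w * n3 = a3].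
Proof.
pose d := a1 ^+ 2 + a2 ^+ 2 + a3 ^+ 2; pose w := Num.sqrt d.
have d0 : 0 <= d by rewrite !addr_ge0 // sqr_ge0.
have [e|dn] := eqVneq d 0.
  exists 0, 1, 0, 0; move/eqP: e.
  rewrite !paddr_eq0 ?addr_ge0 ?sqr_ge0 // !sqrf_eq0 => /andP[/andP[/eqP-> /eqP->] /eqP->].
  by split; ring.
have w2 : w ^+ 2 = d by rewrite sqr_sqrtr.
have w0 : w != 0 by rewrite -sqrf_eq0 w2.
exists w, (a1 / w), (a2 / w), (a3 / w); split; try by field.
rewrite !expr_div_n -!mulrDl w2; by rewrite mulfV.
Qed.

Definition row3 (a b c : R) : 'rV[R]_3 :=
  \row_j match val j with 0%N => a | 1%N => b | _ => c end.

Lemma inner_round3 r (b1 b2 b3 d1 d2 d3 e1 e2 e3 : R) :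
  inner (round_metric r) (row3 b1 b2 b3) (row3 d1 d2 d3) (row3 e1 e2 e3)
  = r ^+ 2 * (d1 * e1 + d2 * e2 + d3 * e3
    + (b1 * d1 + b2 * d2 + b3 * d3) * (b1 * e1 + b2 * e2 + b3 * e3)
      / (1 - norm2 (row3 b1 b2 b3))).
Proof.
rewrite inner_round; move: (norm2 _) => N.
by rewrite !big_ord_recl !big_ord0 !mxE /= !addr0 !addrA.
Qed.

(** At a point b of the unit sphere with height b0, tangency of d expresses the product of the
    projected vectors through b0 d0; the correction term of [round_metric] is then exactly the
    missing d0 e0. *)
Lemma hemisphere_algebra (c r ds ds' b0 b1 b2 b3 d0 d1 d2 d3 e0 e1 e2 e3 : R) :
  b0 != 0 -> b0 * d0 + b1 * d1 + b2 * d2 + b3 * d3 = 0 ->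
  b0 * e0 + b1 * e1 + b2 * e2 + b3 * e3 = 0 ->
  c * ds * (c * ds') + r ^+ 2 * (d1 * e1 + d2 * e2 + d3 * e3
    + (b1 * d1 + b2 * d2 + b3 * d3) * (b1 * e1 + b2 * e2 + b3 * e3) / b0 ^+ 2)
  = c ^+ 2 * (ds * ds') + r ^+ 2 * (d0 * e0 + d1 * e1 + d2 * e2 + d3 * e3).
Proof.
move=> b00 Gv Gv'.
have -> : b1 * d1 + b2 * d2 + b3 * d3 = - (b0 * d0).
  by apply/eqP; rewrite -addr_eq0; apply/eqP; rewrite -[RHS]Gv; ring.
have -> : b1 * e1 + b2 * e2 + b3 * e3 = - (b0 * e0).
  by apply/eqP; rewrite -addr_eq0; apply/eqP; rewrite -[RHS]Gv'; ring.
field.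
exact: b00.
Qed.

(* A map (s, u) to R x S^3 pulling back c2 ds^2 + rho |du|^2 to g; around p, rotate
   the sphere by the conjugate of u p and project it along the real axis. *)
Lemma line_sphere_product (U : set 'rV[R]_4) (g : metric_field R 4)
    (s u0 u1 u2 u3 : 'rV[R]_4 -> R^o) (c2 rho : R) : open U ->
  smooth U s -> smooth U u0 -> smooth U u1 -> smooth U u2 -> smooth U u3 ->
  0 < c2 -> 0 < rho ->
  (forall x, U x -> u0 x ^+ 2 + u1 x ^+ 2 + u2 x ^+ 2 + u3 x ^+ 2 = 1) ->
  (forall x y, U x -> U y -> s x = s y -> u0 x = u0 y -> u1 x = u1 y ->
    u2 x = u2 y -> u3 x = u3 y -> x = y) ->
  (forall x v v', U x -> inner g x v v' = c2 * ('D_v s x * 'D_v' s x) + rho *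
    ('D_v u0 x * 'D_v' u0 x + 'D_v u1 x * 'D_v' u1 x + 'D_v u2 x * 'D_v' u2 x
     + 'D_v u3 x * 'D_v' u3 x)) ->
  locally_line_times_space_form rho^-1 U g.
Proof.
move=> oU ss s0 s1 s2 s3 c20 rho0 uN uI uM.
pose c := Num.sqrt c2; pose r := Num.sqrt rho.
have c2E : c ^+ 2 = c2 by rewrite sqr_sqrtr // ltW.
have c0 : c != 0 by rewrite gt_eqF // sqrtr_gt0.
have r2 : r ^+ 2 = rho by rewrite sqr_sqrtr // ltW.
have r0 : 0 < r by rewrite sqrtr_gt0.
exists (@unit_ball R 3), (round_metric r); split.
- exact: open_unit_ball.
- exact: riemannian_round.
- by rewrite -r2; apply: const_sectional_round.
move=> p Up; have NP := uN p Up.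
have [P0 E0] : exists a : R, u0 p = a by exists (u0 p).
have [P1 E1] : exists a : R, u1 p = a by exists (u1 p).
have [P2 E2] : exists a : R, u2 p = a by exists (u2 p).
have [P3 E3] : exists a : R, u3 p = a by exists (u3 p).
rewrite E0 E1 E2 E3 in NP.
pose lin (a0 a1 a2 a3 : R) (x : 'rV[R]_4) : R^o :=
  a0 * u0 x + a1 * u1 x + a2 * u2 x + a3 * u3 x.
have sZ (a : R) (f : 'rV[R]_4 -> R^o) : smooth U f -> smooth U (fun x => a * f x : R^o).
  by move=> sf; apply: smoothM => //; apply: smooth_cst.
have slin a0 a1 a2 a3 : smooth U (lin a0 a1 a2 a3).
  apply: (smoothD oU); last exact: sZ.
  by apply: (smoothD oU); [apply: (smoothD oU)|]; apply: sZ.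
have dlin a0 a1 a2 a3 x v : U x -> 'D_v (lin a0 a1 a2 a3) x
    = a0 * 'D_v u0 x + a1 * 'D_v u1 x + a2 * 'D_v u2 x + a3 * 'D_v u3 x.
  move=> Ux; apply: derive_comb4; [apply: smooth_derivable s0 Ux|
    apply: smooth_derivable s1 Ux|apply: smooth_derivable s2 Ux|
    apply: smooth_derivable s3 Ux].
(* The quaternion product of the conjugate of u(p) with u, which takes [p] to the pole 1 of the
   sphere. *)
pose y0 := lin P0 P1 P2 P3; pose y1 := lin (- P1) P0 P3 (- P2).
pose y2 := lin (- P2) (- P3) P0 P1; pose y3 := lin (- P3) P2 (- P1) P0.
have sy0 : smooth U y0 by apply: slin.
have yN x : U x -> y0 x ^+ 2 + y1 x ^+ 2 + y2 x ^+ 2 + y3 x ^+ 2 = 1.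
  move=> /uN; rewrite /y0 /y1 /y2 /y3 /lin; move: (u0 x) (u1 x) (u2 x) (u3 x) => a0 a1 a2 a3 N.
  transitivity ((P0 ^+ 2 + P1 ^+ 2 + P2 ^+ 2 + P3 ^+ 2)
    * (a0 ^+ 2 + a1 ^+ 2 + a2 ^+ 2 + a3 ^+ 2)); first by ring.
  by rewrite N NP mul1r.
have uy x : [/\ u0 x = P0 * y0 x - P1 * y1 x - P2 * y2 x - P3 * y3 x,
    u1 x = P0 * y1 x + P1 * y0 x + P2 * y3 x - P3 * y2 x,
    u2 x = P0 * y2 x + P2 * y0 x + P3 * y1 x - P1 * y3 x &
    u3 x = P0 * y3 x + P3 * y0 x + P1 * y2 x - P2 * y1 x].
  rewrite /y0 /y1 /y2 /y3 /lin; move: (u0 x) (u1 x) (u2 x) (u3 x) => a0 a1 a2 a3.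
  have X (a X : R) : a * (P0 ^+ 2 + P1 ^+ 2 + P2 ^+ 2 + P3 ^+ 2) = X -> a = X.
    by rewrite NP mulr1.
  by split; apply: X; ring.
pose Y (x : 'rV[R]_4) : 'rV[R]_3 := row3 (y1 x) (y2 x) (y3 x).
pose phi (x : 'rV[R]_4) : 'rV[R]_4 := row_mx (c * s x)%:M (Y x).
have phiL x (k : 'I_1) : phi x 0 (lshift 3 k : 'I_(1 + 3)) = c * s x.
  by apply: etrans (@row_mxEl R 1 1 3 _ _ 0 k) _; rewrite (ord1 k) mxE eqxx mulr1n.
have phiR x (k : 'I_3) : phi x 0 (rshift 1 k : 'I_(1 + 3)) = Y x 0 k.
  exact: (@row_mxEr R 1 1 3 _ _ 0 k).
have sY : msmooth U Y.
  move=> i j; apply: (smooth_ext oU (f := fun x => match val j with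
    0%N => y1 x | 1%N => y2 x | _ => y3 x end : R^o)) => [x _|]; first by rewrite mxE.
  by case: (val j) => [|[|_]]; apply: slin.
have sphi : msmooth U phi.
  move=> i; rewrite (ord1 i) => j; case: (split_ordP (j : 'I_(1 + 3))) => k ->.
    apply: (smooth_ext oU (f := fun x => c * s x : R^o)) => [x _|]; last exact: sZ.
    by rewrite phiL.
  apply: (smooth_ext oU (f := fun x => Y x 0 k : R^o)) => [x _|]; last exact: sY.
  by rewrite phiR.
have norm2Y x : U x -> norm2 (Y x) = 1 - y0 x ^+ 2.
  move=> /yN <-; rewrite /norm2 !big_ord_recl big_ord0 !mxE /=; ring.
(* The preimage of the open hemisphere around the pole, where the projection along the real axis is
   injective and lands in the unit ball. *)
pose W := [set x | U x /\ 0 < y0 x].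
have WU : W `<=` U by move=> x [].
have oW : open W.
  rewrite openE => x [Ux yx].
  have c0x : y0 @ x --> y0 x := smooth_continuous sy0 Ux.
  have n1 : \forall z \near x, U z by exact: open_near.
  have n2 : \forall z \near x, 0 < y0 z by exact: cvgr_gt c0x _ yx.
  by apply: filterS2 n1 n2 => z Uz yz; split.
exists W, phi; split.
- split=> //; split=> //; rewrite /y0 /lin E0 E1 E2 E3 -!expr2 NP.
  exact: ltr01.
- by apply: smooth_sub WU _; apply/(smooth_mxP _ oU).
- move=> x z; rewrite !inE => -[Ux x0] [Uz z0] e.
  have [es eY] := @eq_row_mx _ _ 1 3 _ _ _ _ e.
  have esx : s x = s z.
    by apply: (mulfI c0); move/matrixP/(_ 0 0): es; rewrite !mxE eqxx !mulr1n.
  have e1 : y1 x = y1 z by move/rowP/(_ (@Ordinal 3 0 isT)): eY; rewrite !mxE.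
  have e2 : y2 x = y2 z by move/rowP/(_ (@Ordinal 3 1 isT)): eY; rewrite !mxE.
  have e3 : y3 x = y3 z by move/rowP/(_ (@Ordinal 3 2 isT)): eY; rewrite !mxE.
  (* The height is the positive square root determined by the other three coordinates. *)
  have e0 : y0 x = y0 z.
    apply: (@pexpIrn _ 2) => //; rewrite ?nnegrE ?ltW //.
    have Nx := yN x Ux; have Nz := yN z Uz; rewrite e1 e2 e3 -Nz in Nx.
    by apply: (addIr (y1 z ^+ 2)); apply: (addIr (y2 z ^+ 2)); apply: (addIr (y3 z ^+ 2)).
  have [x0' x1' x2' x3'] := uy x; have [z0' z1' z2' z3'] := uy z.
  by apply: uI; rewrite ?x0' ?x1' ?x2' ?x3' ?z0' ?z1' ?z2' ?z3' ?e0 ?e1 ?e2 ?e3.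
- move=> x [Ux x0]; rewrite /line_prod_dom /= /phi row_mxKr /unit_ball /= norm2Y //.
  by rewrite ltrBlDr ltrDl exprn_gt0.
move=> x [Ux x0] v v'.
have dphi : differentiable phi x.
  by apply: (smooth_differentiable (U := U)) => //; apply/(smooth_mxP _ oU).
have dY : differentiable Y x.
  by apply: (smooth_differentiable (U := U)) => //; apply/(smooth_mxP _ oU).
have DY t : 'D_t Y x = row3 ('D_t y1 x) ('D_t y2 x) ('D_t y3 x).
  apply/rowP => j; rewrite derive_entry //.
  have -> : (fun z => Y z 0 j : R^o) = (fun z => match val j with
    0%N => y1 z | 1%N => y2 z | _ => y3 z end : R^o) by apply/funext => z; rewrite mxE.
  by rewrite mxE; case: (val j) => [|[|?]].
have Dphi t : 'D_t phi x = row_mx (c * 'D_t s x)%:M ('D_t Y x).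
  apply/rowP => j; rewrite derive_entry //; case: (split_ordP (j : 'I_(1 + 3))) => k ->.
    apply: etrans _ (esym (@row_mxEl R 1 1 3 _ _ 0 k)).
    rewrite (ord1 k) mxE eqxx mulr1n.
    transitivity ('D_t (fun z => c * s z : R^o) x).
      by apply: (eq_on_derive oU _ _ Ux) => z _; rewrite phiL.
    by apply: (@deriveZ _ _ _ s); apply: smooth_derivable ss Ux.
  apply: etrans _ (esym (@row_mxEr R 1 1 3 _ _ 0 k)); rewrite derive_entry //.
  by apply: (eq_on_derive oU _ _ Ux) => z _; rewrite phiR.
have G t := derive_sphere_normal t oU sy0 (slin _ _ _ _) (slin _ _ _ _) (slin _ _ _ _) yN Ux.
have E : 'D_v u0 x * 'D_v' u0 x + 'D_v u1 x * 'D_v' u1 x + 'D_v u2 x * 'D_v' u2 x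
    + 'D_v u3 x * 'D_v' u3 x = 'D_v y0 x * 'D_v' y0 x + 'D_v y1 x * 'D_v' y1 x
    + 'D_v y2 x * 'D_v' y2 x + 'D_v y3 x * 'D_v' y3 x.
  rewrite !(dlin _ _ _ _ _ _ Ux).
  move: ('D_v u0 x) ('D_v u1 x) ('D_v u2 x) ('D_v u3 x) => d0 d1 d2 d3.
  move: ('D_v' u0 x) ('D_v' u1 x) ('D_v' u2 x) ('D_v' u3 x) => e0 e1 e2 e3.
  transitivity ((P0 ^+ 2 + P1 ^+ 2 + P2 ^+ 2 + P3 ^+ 2)
    * (d0 * e0 + d1 * e1 + d2 * e2 + d3 * e3)); last by ring.
  by rewrite NP mul1r.
have IL (a b b' : R) (y t t' : 'rV[R]_3) :
    inner (line_prod_metric (round_metric r)) (row_mx a%:M y : 'rV_(1 + 3))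
      (row_mx b%:M t : 'rV_(1 + 3)) (row_mx b'%:M t' : 'rV_(1 + 3))
    = b * b' + inner (round_metric r) y t t'.
  apply: etrans (inner_line_prod _ _ _ _ _ _) _.
  by rewrite mxE tr_scalar_mx -scalar_mxM mxE eqxx mulr1n row_mxKr.
rewrite (uM _ _ _ Ux) E; have := G v; have := G v'.
rewrite !Dphi; move=> Gv' Gv; apply: etrans (IL _ _ _ _ _ _) _.
rewrite (DY v) (DY v') /Y inner_round3 (norm2Y _ Ux) -c2E -r2 opprB [1 + _]addrC subrK.
have y00 : y0 x != 0 by rewrite gt_eqF.
exact: hemisphere_algebra y00 Gv Gv'.
Qed.

Variables (U : set 'rV[R]_4) (m : 'rV[R]_4 -> 'rV[R]_4 -> 'rV[R]_4).
Variables q0 q1 q2 q3 s : 'rV[R]_4 -> R^o.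
Hypotheses (oU : open U) (qc : quaternion_chart 1 U m q0 q1 q2 q3 s).
Hypothesis inj : quaternion_inj U q0 q1 q2 q3 s.
Notation Om := (maurer_cartan 1 q0 q1 q2 q3 s).
Variables (g : metric_field R 4) (K : 'M[R]_(3 + 1)) (rho : R).
Hypotheses (sK : K^T = K) (pK : posdef K) (rho0 : 0 < rho).
Hypothesis K3 : ulsubmx K = rho *: base_form 1.
Hypothesis gE : forall x, U x -> g x = Om x *m K *m (Om x)^T.

Let o0 := @Ordinal 4 0 isT.
Let o1 := @Ordinal 4 1 isT.
Let o2 := @Ordinal 4 2 isT.
Let o3 := @Ordinal 4 3 isT.

(** The positive quantity is the Schur complement of the round block: the squared length of the
    vector orthogonal to the ideal whose central component is 1. *)
Lemma gram_entries : exists k1 k2 k3 kap : R,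
  0 < kap - (k1 ^+ 2 + k2 ^+ 2 + k3 ^+ 2) / rho /\
  forall z z' : 'rV[R]_4, (z *m K *m z'^T) 0 0 =
    rho * (z 0 o0 * z' 0 o0 + z 0 o1 * z' 0 o1 + z 0 o2 * z' 0 o2)
    + (k1 * z 0 o0 + k2 * z 0 o1 + k3 * z 0 o2) * z' 0 o3
    + z 0 o3 * (k1 * z' 0 o0 + k2 * z' 0 o1 + k3 * z' 0 o2)
    + kap * z 0 o3 * z' 0 o3.
Proof.
pose M : 'M[R]_4 := K.
have MC i j : M i j = M j i by rewrite /M -[in LHS]sK mxE.
have e (i j : 'I_3) : M (lshift 1 i) (lshift 1 j) = rho * ((i == j)%:R).
  have := congr1 (fun A : 'M[R]_3 => A i j) K3; rewrite !mxE => ->.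
  by rewrite if_same; congr (_ * _); case: eqP.
have lE (i j : 'I_3) (a b : 'I_4) : val a = val i -> val b = val j ->
    M a b = rho * ((i == j)%:R).
  by move=> ea eb; rewrite -e; congr (M _ _); apply: val_inj.
have e00 := @lE (@Ordinal 3 0 isT) (@Ordinal 3 0 isT) o0 o0 erefl erefl.
have e01 := @lE (@Ordinal 3 0 isT) (@Ordinal 3 1 isT) o0 o1 erefl erefl.
have e02 := @lE (@Ordinal 3 0 isT) (@Ordinal 3 2 isT) o0 o2 erefl erefl.
have e11 := @lE (@Ordinal 3 1 isT) (@Ordinal 3 1 isT) o1 o1 erefl erefl.
have e12 := @lE (@Ordinal 3 1 isT) (@Ordinal 3 2 isT) o1 o2 erefl erefl.
have e22 := @lE (@Ordinal 3 2 isT) (@Ordinal 3 2 isT) o2 o2 erefl erefl.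
rewrite /= in e00 e01 e02 e11 e12 e22.
have F (z z' : 'rV[R]_4) : (z *m K *m z'^T) 0 0 =
    rho * (z 0 o0 * z' 0 o0 + z 0 o1 * z' 0 o1 + z 0 o2 * z' 0 o2)
    + (M o0 o3 * z 0 o0 + M o1 o3 * z 0 o1 + M o2 o3 * z 0 o2) * z' 0 o3
    + z 0 o3 * (M o0 o3 * z' 0 o0 + M o1 o3 * z' 0 o1 + M o2 o3 * z' 0 o2)
    + M o3 o3 * z 0 o3 * z' 0 o3.
  rewrite -(form_sum M) !sum_ord4 -/o0 -/o1 -/o2 -/o3.
  rewrite (MC o1 o0) (MC o2 o0) (MC o2 o1) (MC o3 o0) (MC o3 o1) (MC o3 o2).
  rewrite e00 e01 e02 e11 e12 e22; ring.
exists (M o0 o3), (M o1 o3), (M o2 o3), (M o3 o3); split=> //.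
(* That orthogonal vector. *)
pose z : 'rV[R]_4 := \row_j match val j with
  | 0%N => - M o0 o3 / rho | 1%N => - M o1 o3 / rho | 2%N => - M o2 o3 / rho | _ => 1 end.
have z0 : z != 0.
  by apply/eqP => /rowP/(_ o3) /eqP; rewrite !mxE /= oner_eq0.
have := pK z0; rewrite F !mxE /=; congr (0 < _).
by field; rewrite gt_eqF.
Qed.

(** Completing the square with a = k / rho writes the metric as rho |conj q dq + a ds|^2 + c2 ds^2;
    untwisting by exp (s a) absorbs the mixed term. *)
Lemma round_product : locally_line_times_space_form rho^-1 U g.
Proof.
have [k1 [k2 [k3 [kap [c20 KE]]]]] := gram_entries.
have [w [n1 [n2 [n3 [nn a1 a2 a3]]]]] := axis_vector (k1 / rho) (k2 / rho) (k3 / rho).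
set c2 := kap - _ in c20.
have [su0 su1 su2 su3] := smooth_untwist oU qc w n1 n2 n3.
apply: (@line_sphere_product U g s _ _ _ _ _ rho oU _ su0 su1 su2 su3 c20 rho0).
- by case: (qc_smooth qc).
- by move=> x; apply: (untwist_norm qc w nn).
- by move=> x y Ux Uy es e0 e1 e2 e3; exact: (untwist_inj nn inj Ux Uy es e0 e1 e2 e3).
move=> x v v' Ux; have uM := untwist_metric oU qc w nn v v' Ux.
have Ds t : 'D_t s x = (t *m Om x) 0 o3 by rewrite (mulmx_maurer_cartan qc t o3 Ux).
rewrite /= a1 a2 a3 -/o0 -/o1 -/o2 -/o3 in uM.
apply: etrans _ (f_equal2 (fun a b => a + rho * b) _ (esym uM)); last first.
  by apply: (f_equal2 (fun a b => c2 * (a * b)) (esym (Ds v)) (esym (Ds v'))).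
rewrite /inner (gE Ux).
have -> : v *m (Om x *m K *m (Om x)^T) *m v'^T = (v *m Om x) *m K *m (v' *m Om x)^T.
  by rewrite trmx_mul !mulmxA.
rewrite KE /c2; move: (v *m _) (v' *m _) => z z'; field.
by rewrite gt_eqF.
Qed.

End RoundProduct.

(** * The value of the curvature *)

Section RoundFrames.
Variables (R : realType) (eps : R).
Hypothesis eps2 : eps ^+ 2 = 1.

Lemma form_ul n p (K : 'M[R]_(n + p)) (u v : 'rV[R]_n) :
  (row_mx u 0 *m K *m (row_mx v 0)^T) 0 0 = (u *m ulsubmx K *m v^T) 0 0.
Proof.
rewrite -[K in LHS]submxK mul_row_block !mul0mx !addr0.
by rewrite tr_row_mx mul_row_col trmx0 mulmx0 addr0.
Qed.

Lemma posdef_ul n p (K : 'M[R]_(n + p)) : posdef K -> posdef (ulsubmx K).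
Proof.
move=> pK u u0; have n0 : row_mx u (0 : 'rV[R]_p) != 0.
  by apply: contraNneq u0 => e; have := e; rewrite -[RHS]row_mx0 => /eq_row_mx[->].
by have := pK _ n0; rewrite form_ul.
Qed.

Lemma gram_pos (K : 'M[R]_(3 + 1)) rho : posdef K ->
  ulsubmx K = rho *: base_form eps -> 0 < rho /\ 0 < eps.
Proof.
move=> /posdef_ul pK e.
have P (j : 'I_3) : 0 < rho * base_form eps j j.
  have n0 : delta_mx 0 j != 0 :> 'rV[R]_3.
    by apply/eqP => /rowP/(_ j)/eqP; rewrite !mxE !eqxx oner_eq0.
  have := pK _ n0; rewrite -rowE trmx_delta -colE e; congr (0 < _).
  by rewrite [LHS]mxE [LHS]mxE [LHS]mxE.
have := P (@Ordinal 3 0 isT); have := P (@Ordinal 3 1 isT).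
rewrite !mxE /= !mulr1n mulr1 => r0; rewrite pmulr_rgt0 // => e0.
Qed.

(** Let T be the matrix of ideal components of the [y i]. The bracket relations give T D T^T = m
    with m = 2 det T / lam, and orthonormality gives T K3 T^T = 1, so D = m K3. Determinants yield
    m^3 = (det T)^2, and with lam m = 2 det T this leaves m = lam^2 / 4. *)
Lemma round_frame_gram (lam : R) (K : 'M[R]_(3 + 1)) (y : 'I_3 -> 'rV[R]_4) :
  let o0 := @Ordinal 3 0 isT in let o1 := @Ordinal 3 1 isT in
  let o2 := @Ordinal 3 2 isT in
  let br u v c := \sum_b \sum_d
    u 0 b * v 0 d * lie_struct (2 * eps) 2 2 0 0 0 b d c in
  lam != 0 -> posdef K ->
  (forall i j, (y i *m K *m (y j)^T) 0 0 = (i == j)%:R) ->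
  (forall c, [/\ br (y o1) (y o2) c = lam * y o0 0 c, br (y o2) (y o0) c = lam * y o1 0 c
    & br (y o0) (y o1) c = lam * y o2 0 c]) ->
  ulsubmx K = (lam ^+ 2 / 4)^-1 *: base_form eps.
Proof.
move=> o0 o1 o2 br lam0 pK orth brE.
pose f (i j : nat) : R := y (inord i) 0 (inord j).
pose T : 'M[R]_3 := \matrix_(i, j) f i j.
have ord3 (P : 'I_3 -> Prop) : P o0 -> P o1 -> P o2 -> forall i, P i.
  by move=> p0 p1 p2 [[|[|[|//]]] ij]; rewrite (bool_irrelevance ij isT).
have fE i j : y i 0 j = f i j by rewrite /f !inord_val.
have br3 (i : 'I_3) (c : 'I_4) : exists i1 i2, lam * y i 0 c = br (y i1) (y i2) c.
  have [e0 e1 e2] := brE c.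
  by move: i; apply: (ord3 _); [exists o1, o2|exists o2, o0|exists o0, o1].
(* Each [y i] is a multiple of a bracket, and brackets have no central component. *)
have y3 (i : 'I_3) : f i 3%N = 0.
  apply: (mulfI lam0); rewrite mulr0.
  have [i1 [i2]] := br3 i (@Ordinal 4 3 isT); rewrite fE /= => ->.
  by rewrite /br !sum_ord4 /lie_struct /=; ring.
have D2 (j : 'I_3) : base_form eps j j * base_form eps j j = 1.
  by rewrite mxE eqxx mulr1n mxE; case: ifP => _; rewrite ?mulr1 // -expr2.
have cofE (i j : 'I_3) : lam * T i j = 2 * base_form eps j j * cofactor T i j.
  pose c : 'I_4 := widen_ord (isT : (3 <= 4)%N) j.
  have [e0 e1 e2] := brE c.
  have fc i' : y i' 0 c = f i' j by rewrite fE.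
  rewrite !fc in e0 e1 e2.
  have E : lam * T i j = lam * f i j by rewrite mxE.
  rewrite {}E; move: i e0 e1 e2; apply: (ord3 _) => e0 e1 e2;
    [rewrite -e0|rewrite -e1|rewrite -e2]; rewrite /c /br; clear c e0 e1 e2 fc;
    move: j; apply: (ord3 _);
    by rewrite !sum_ord4 /lie_struct !fE /cofactor det2 !mxE /= /bump /= ?mulr1n; ring.
have TDE i j : (T *m base_form eps) i j = T i j * base_form eps j j.
  by rewrite mul_mx_diag !mxE eqxx mulr1n.
have TDT : lam *: (T *m base_form eps *m T^T) = (2 * \det T)%:M.
  have -> : lam *: (T *m base_form eps *m T^T) = (lam *: (T *m base_form eps)) *m T^T.
    by rewrite scalemxAl.
  have -> : lam *: (T *m base_form eps) = 2 *: (\adj T)^T.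
    apply/matrixP => i j; rewrite [LHS]mxE TDE [RHS]mxE [_^T i j]mxE [\adj _ _ _]mxE.
    rewrite mulrA cofE; have := D2 j.
    by move: (base_form eps j j) (cofactor T i j) => d a e; rewrite -[RHS]mulr1 -e; ring.
  by rewrite -scalemxAl -trmx_mul mul_mx_adj tr_scalar_mx scale_scalar_mx.
have TKT : T *m ulsubmx K *m T^T = 1%:M.
  have yE i : y i = row_mx (row i T) (0 : 'rV[R]_1) :> 'rV[R]_(3 + 1).
    apply/rowP => j; case: (split_ordP (j : 'I_(3 + 1))) => k ->.
      by rewrite row_mxEl !mxE fE.
    by rewrite row_mxEr mxE (ord1 k) fE y3.
  apply/matrixP => i j; rewrite [RHS]mxE -orth.
  have -> : (y i *m K *m (y j)^T) 0 0 = (row i T *m ulsubmx K *m (row j T)^T) 0 0.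
    by rewrite -form_ul !yE.
  by rewrite -row_mul !mxE; apply: eq_bigr => k _; rewrite !mxE.
have [uT _] := mulmx1_unit (etrans (mulmxA _ _ _) TKT).
pose m := 2 * \det T / lam.
have TDm : T *m base_form eps *m T^T = m%:M.
  apply: (scalerI lam0); rewrite TDT scale_scalar_mx /m; congr (_%:M).
  by field.
have uTT : T^T \in unitmx by rewrite unitmx_tr.
have DK : base_form eps = m *: ulsubmx K.
  apply: (can_inj (mulKmx uT)); apply: (can_inj (mulmxK uTT)).
  by rewrite TDm -scalemxAr -scalemxAl TKT scale_scalar_mx mulr1.
have m0 : m != 0.
  apply/eqP => e; have := congr1 (fun M : 'M[R]_3 => M o1 o1) DK.
  by rewrite e scale0r !mxE /= mulr1n => /eqP; rewrite oner_eq0.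
have KD : ulsubmx K = m^-1 *: base_form eps by rewrite DK scalerA mulVf // scale1r.
(* Positivity of [K] singles out eps = 1, so that D has determinant 1. *)
have [_ e0] := gram_pos pK KD.
have e1 : eps = 1.
  by move/eqP: eps2; rewrite -subr_eq0 subr_sqr_1 mulf_eq0 => /orP[/eqP|/eqP]; lra.
have dD : \det (base_form eps) = 1.
  by rewrite det_diag !big_ord_recl big_ord0 !mxE e1 !mulr1.
have m3 : m ^+ 3 = \det T ^+ 2.
  by rewrite -(det_scalar 3) -TDm !det_mulmx det_tr dD mulr1 expr2.
rewrite KD; congr (_^-1 *: _); apply: (mulIf (expf_neq0 2 m0)).
have lm : lam * m = 2 * \det T by rewrite /m mulrC mulfVK.
transitivity ((lam * m) ^+ 2 / 4); last by field.
by rewrite lm -exprS m3; field.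
Qed.

End RoundFrames.

(** Left-invariant fields have constant components in the Maurer-Cartan coframe, so the frame and
    its brackets can be evaluated at the identity, where they become the data of
    [round_frame_gram]. *)
Lemma described_gram (R : realType) (G : lie_group R) (g : metric_field R 4)
    (eps : R) (q0 q1 q2 q3 s : 'rV[R]_4 -> R^o) (K : 'M[R]_(3 + 1)) (lam k1 k2 k3 : R) :
  quaternion_chart eps (lg_dom G) (lg_mul G) q0 q1 q2 q3 s -> posdef K ->
  (forall x, lg_dom G x -> g x = maurer_cartan eps q0 q1 q2 q3 s x *m K
    *m (maurer_cartan eps q0 q1 q2 q3 s x)^T) ->
  described_by G g lam lam lam k1 k2 k3 ->
  ulsubmx K = (lam ^+ 2 / 4)^-1 *: base_form eps.
Proof.
move=> qc pK gE [l0 [e1 [e2 [e3 [e4 [[L1 L2 L3 L4] orth br _]]]]]].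
have oU : open (lg_dom G) := @lg_dom_open _ G.
have U1 := @lg_dom_one _ G; pose Om := maurer_cartan eps q0 q1 q2 q3 s.
have lam0 : lam != 0 by apply: contraNneq l0 => ->; rewrite mulr0.
pose z X := X (lg_one G) *m Om (lg_one G) : 'rV[R]_4.
pose y (i : 'I_3) : 'rV[R]_4 := z (nth e1 [:: e1; e2; e3] i).
have LE X : left_invariant_field G X -> forall x, lg_dom G x -> X x *m Om x = z X.
  by move=> LX; apply: left_invariant_field_coframe qc _ LX.
have B X Y Z c : left_invariant_field G X -> left_invariant_field G Y ->
    (lie_bracket X Y (lg_one G) = lam *: Z (lg_one G)) ->
    \sum_b \sum_d z X 0 b * z Y 0 d * lie_struct (2 * eps) 2 2 0 0 0 b d c
    = lam * z Z 0 c.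
  move=> LX LY e; have [sX _] := LX; have [sY _] := LY.
  rewrite -(lie_bracket_coframe (msmooth_maurer_cartan oU qc)
    (maurer_cartan_torsion oU qc) c sX sY (LE X LX) (LE Y LY) U1).
  by rewrite e -scalemxAl mxE.
have [b1 b2 b3] := br _ U1.
apply: (round_frame_gram (qc_eps qc) (y := y) lam0 pK).
  move=> i j; have := orth _ U1 (widen_ord (isT : (3 <= 4)%N) i)
    (widen_ord (isT : (3 <= 4)%N) j).
  rewrite /inner (gE _ U1) => o; rewrite -[RHS]o.
  have N (k : 'I_3) : nth 0 [:: e1 (lg_one G); e2 (lg_one G); e3 (lg_one G); e4 (lg_one G)] k
      = nth e1 [:: e1; e2; e3] k (lg_one G).
    by case: k => -[|[|[|]]].
  by rewrite /= !N /y /z trmx_mul !mulmxA.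
by move=> c; split; [exact: (B e2 e3 e1 c L2 L3 b1)|exact: (B e3 e1 e2 c L3 L1 b2)|
  exact: (B e1 e2 e3 c L1 L2 b3)].
Qed.

Theorem theorem2p2 (R : realType) (G : lie_group R) (g : metric_field R 4)
  (hG : is_univ_SL2R_times_R G \/ is_SU2_times_R G)
  (hg : left_invariant_metric G g) :
  ((exists t : R, Ft_critical t (lg_dom G) g) <->
   (exists kappa : R, locally_line_times_space_form kappa (lg_dom G) g)) /\
  (forall l1 l2 l3 k1 k2 k3 lambda : R,
     described_by G g l1 l2 l3 k1 k2 k3 ->
     l1 = lambda -> l2 = lambda -> l3 = lambda ->
     forall kappa : R,
       locally_line_times_space_form kappa (lg_dom G) g <->
       kappa = lambda ^+ 2 / 4).
Proof.
have oU : open (lg_dom G) := @lg_dom_open _ G.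
have U1 := @lg_dom_one _ G; have [rg _] := hg.
have [eps [q0 [q1 [q2 [q3 [s [qc pos]]]]]]] := quaternion_chart_exists hG.
have [K [sK pK gE]] := left_invariant_gram qc hg.
have round rho : ulsubmx (K : 'M[R]_(3 + 1)) = rho *: base_form eps ->
    locally_line_times_space_form rho^-1 (lg_dom G) g.
  move=> K3; have [rho0 e0] := gram_pos pK K3; have [e1 inj] := pos e0.
  rewrite {}e1 in qc gE K3.
  exact (round_product oU qc inj sK pK rho0 K3 gE).
split.
  split=> [[t crit]|[kappa lp]].
    have [rho K3] := critical_gram qc rg sK pK gE crit.
    by exists rho^-1; apply: round.
  (* The coefficient of [g] is half of 12 kappa^2 + 36 t kappa^2, that of the Ricci tensor is - (4 +
     12 t) kappa, and this [t] makes both vanish. *)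
  exists (- 3^-1) => x Ux i j.
  have [-> -> /(_ i j)[-> ->]] := local_product_tensors oU rg lp Ux.
  by move: (g x i j) (ricci g i j x) => a b; field.
move=> l1 l2 l3 k1 k2 k3 lam + l1E l2E l3E; rewrite l1E l2E l3E => desc kappa.
have lp : locally_line_times_space_form (lam ^+ 2 / 4) (lg_dom G) g.
  by rewrite -[_ / 4]invrK; apply: round; apply: described_gram qc pK gE desc.
split=> [lp'|->//].
(* Two admissible curvatures give the same scalar curvature 6 kappa at the identity. *)
have [e _ _] := local_product_tensors oU rg lp U1.
have [e' _ _] := local_product_tensors oU rg lp' U1.
apply: (mulfI (_ : 6 != 0)); first by rewrite pnatr_eq0.
by rewrite -e' e.
Qed.
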